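(* Let $G$ be a finite group, let $x\in G$, let $K=x^G$ be the conjugacy class of $x$ in $G$, and suppose that $K^2=\{1\}\cup D$, where $D$ is a conjugacy class of $G$. Then $\langle D\rangle=[x,G]$, and $\langle D\rangle$ is either cyclic or a $p$-group for some prime $p$. Moreover $|\langle K\rangle/\langle D\rangle|\leq 2$, and $\langle K\rangle=\langle x\rangle[x,G]$ is solvable. More precisely: \begin{enumerate} \item Suppose that $|K|=2$. \begin{enumerate} \item If $o(x)=2$, then $\langle K\rangle\cong\mathbb{Z}_2\times\mathbb{Z}_2$, $\langle D\rangle\cong\mathbb{Z}_2$ and $\langle D\rangle\subseteq \mathbf{Z}(G)$. \item If $o(x)=n>2$, then $\langle K\rangle\cong\mathbb{Z}_n$ and $\langle D\rangle$ is cyclic. \end{enumerate} \item Suppose that $|K|\geq 3$. \begin{enumerate} \item If $o(x)=2$, then either $\langle K\rangle$ and $\langle D\rangle$ are elementary abelian $2$-groups, or there are an odd prime $p$ and a positive integer $r$ such that $\langle D\rangle$ is a $p$-group and $|K|=p^r$. \item If $o(x)>2$, then there is an odd prime $p$ such that $\langle D\rangle$ is an elementary abelian $p$-group and, furthermore, either $o(x)=p$ or $o(x)=2p$. \end{enumerate} \end{enumerate}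
   Context: For a finite group $G$ and $x\in G$: $x^G=\{g^{-1}xg : g\in G\}$ is the conjugacy class of $x$; $o(x)$ is the order of $x$; $[x,G]$ is the subgroup generated by all commutators $[x,g]=x^{-1}g^{-1}xg$ with $g\in G$; $\mathbf{Z}(G)$ is the center of $G$. For a subset $K\subseteq G$, $K^2=\{ab : a,b\in K\}$ and $\langle K\rangle$ is the subgroup generated by $K$. $\mathbb{Z}_n$ denotes the cyclic group of order $n$. *)

(* Defs.v *)
From mathcomp Require Import all_boot all_order all_algebra all_fingroup all_solvable.

Set Implicit Arguments.
Unset Strict Implicit.
Unset Printing Implicit Defensive.

(* Main.v *)
(* If o(x) > 2, comparing |K|, |D| and the number of pairs with da outside K
   shows that N = {1} U D is a subgroup; its nontrivial elements are all
   conjugate in G, so N is elementary abelian, and p = 2 is excluded because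
   then C_G(x) = C_G(x^2) contains N, which makes k |-> k^2 constant on K.

   If x is an involution, x inverts every product xk, and K^2 = {1} U D forces
   all products of two elements of K to have order dividing one prime p. If
   p = 2 then K commutes. If p is odd, |K| is a power of p by induction on |G|:
   one may assume G = <K> and Z(G) = 1. An involution y <> x of C_G(x) gives
   |K| = |x^C(y)| |x^C(xy)|. Otherwise x is the only involution of a Sylow
   2-subgroup S, which is cyclic or generalized quaternion. In the cyclic case
   S has a normal complement of odd order, and x fixes one of its Sylow
   r-subgroups, centralizing it unless r = p. The quaternion case contradicts
   G = <K>, in the manner of the Brauer-Suzuki theorem: a class function that
   only depends on the 2-part and restricts to a virtual character of S is a
   virtual character of G, and one of norm 3 is exhibited that cannot exist.
   Finally, as |K| is a power of p, a maximal x-invariant p-subgroup P is a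
   Sylow subgroup transitive on K, so that xk lies in P for all k in K. *)

Require Import Defs.
From mathcomp Require Import all_boot all_order all_algebra all_fingroup all_solvable.
From mathcomp Require Import all_field all_character.
From mathcomp Require Import ring zify.

Set Implicit Arguments.
Unset Strict Implicit.
Unset Printing Implicit Defensive.

Import GroupScope Order.TTheory GRing.Theory Num.Theory.

(** * Virtual characters determined by their restriction to a Sylow 2-subgroup *)

(** In the quaternion case the virtual characters used take at every [x * x ^ u] the same value as
    at 1, since these products have odd order, while the mean over u of an irreducible chi at
    [x * x ^ u] is chi(x)^2 / chi(1). So norm 3 gives three equations, from the values at 1, at x
    and from this mean, on three signs, three degrees and three values at x. If |S| >= 16, the
    cyclic subgroup A of index 2 in S has a linear character trivial on x and not real. It leads to
    a virtual character that contains 1 once and vanishes at 1 and x, for which the equations are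
    contradictory. If |S| = 8, the characters of A trivial on x are real and nothing of this kind
    exists. The substitute [g2] restricts to S as the character of degree 2 and is orthogonal to 1;
    its equations have solutions, and only show that exactly one coefficient is -1 and that the
    constituents are real. The missing information is the mean of [g2] over squares, hence the
    Frobenius-Schur indicators. Finding them in even degree requires that the constituents vanish on
    elements whose 2-part has order 4, which is proved by a congruence modulo 2. *)

Lemma card_conj_into (gT : finGroupType) (N H : {group gT}) (u : gT) :
  H \subset N -> u \in N ->
  #|[set y in N | u ^ y \in H]| = (#|H| * #|'Fix_(rcosets H N | 'Rs)[u]|)%N.
Proof.
move=> sHN Nu; set A := [set y in N | _]; set P := 'Fix_(_ | _)[_].
have sPr: P \subset rcosets H N by apply: subsetIl.
have unifP: {in P, forall C : {set gT}, #|C| = #|H|}.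
  by move=> C /(subsetP sPr)/rcosetsP[y _ ->]; rewrite card_rcoset.
have tiP: partition P (cover P).
  apply/and3P; split=> //.
    by apply: trivIsetS sPr _; have /and3P[] := rcosets_partition sHN.
  apply/negP=> P0; have := unifP _ P0; rewrite cards0 => /esym/eqP.
  by rewrite eqn0Ngt cardG_gt0.
(* The set is inverted because [u ^ y] lies in [H] exactly when [u] fixes the right coset of
   [y^-1]. *)
rewrite mulnC -(card_uniform_partition unifP tiP) -card_invg.
apply: eq_card => y; rewrite !inE groupV; apply/andP/bigcupP => [[Ny Hy]|].
  exists (H :* y); last exact: rcoset_refl.
  rewrite !inE sub1set !inE mem_rcosets mulSGid //= (Ny) /=.
  rewrite rcosetE -rcosetM; apply/eqP/rcoset_eqP; rewrite mem_rcoset.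
  by rewrite conjgE invgK mulgA in Hy.
case=> C /setIP[/rcosetsP[z Nz ->]]; rewrite !inE sub1set inE => /eqP Cz.
move/rcosetP=> [h Hh ->]; have Nh := subsetP sHN h Hh.
split; first by rewrite groupM.
have : z * u \in H :* z.
  by move: Cz; rewrite /= rcosetE -rcosetM => <-; apply: rcoset_refl.
by rewrite mem_rcoset -mulgA => Hzu; rewrite invMg conjgM groupJ ?groupV // conjgE invgK.
Qed.

(* An r-hyperelementary subgroup H = <g_{r'}> R; the integer 'Ind 1 g is the
   number of fixed points of the r-element g_r on 'N(<g_{r'}>)/H. *)
Lemma hyperelementary_Ind1 (gT : finGroupType) (G : {group gT}) (g : gT) (r : nat) :
  prime r -> g \in G ->
  exists Z R : {group gT}, let H := (Z <*> R)%G in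
    [/\ cyclic Z && r^'.-group Z, r.-group R, H \subset G, Z ><| R = H
      & exists2 n : nat, ('Ind[G, H] (1 : 'CF(H)) g = n%:R)%R & ~~ (r %| n)%N].
Proof.
move=> r_pr Gg; pose Z := <[g.`_r^']>%G; pose N := ('N_G(Z))%G.
have r'Z : r^'.-group Z by rewrite /pgroup -orderE; exact: p_elt_constt.
have sZG : Z \subset G by rewrite cycle_subG groupX.
have Ngr : g.`_r \in N.
  rewrite inE groupX //=; apply: (subsetP (cent_sub _)); rewrite cent_cycle.
  by apply/cent1P/commuteX2.
have r_gr : r.-group <[g.`_r]> by rewrite /pgroup -orderE; exact: p_elt_constt.
have sgN : <[g.`_r]> \subset N by rewrite cycle_subG.
have [R sylR sgR] := Sylow_superset sgN r_gr.
have [sRN rR _] := and3P sylR.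
have nZR : R \subset 'N(Z) by apply: subset_trans sRN (subsetIr _ _).
have sZN : Z \subset N by rewrite subsetI sZG normG.
have tiZR : Z :&: R = 1 by rewrite setIC coprime_TIg // (pnat_coprime rR r'Z).
exists Z, R; set H := (Z <*> R)%G.
have sHN : H \subset N by rewrite join_subG sZN.
have sHG : H \subset G := subset_trans sHN (subsetIl _ _).
have defH : Z ><| R = H by rewrite sdprodEY.
split=> //; first by rewrite cycle_cyclic.
pose F := 'Fix_(rcosets H N | 'Rs)[g.`_r].
have hallZ : r^'.-Hall(H) Z.
  rewrite pHallE joing_subl /= -(sdprod_card defH) partnM ?cardG_gt0 //.
  by rewrite part_pnat_id // part_p'nat ?muln1 // pnatNK.
have nsZH : Z <| H by have [] := sdprod_context defH.
(* [Z] is the normal Hall r'-subgroup of [H], so an element conjugating [g] into [H] sends the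
   r'-part of [g] into [Z], which that part generates; it therefore normalizes [Z], and the induced
   value only sees [N]. *)
have NP y : y \in G -> g ^ y \in H -> y \in N.
  move=> Gy Hgy; rewrite inE Gy /= -groupV.
  have Zgy : g.`_r^' ^ y \in Z.
    rewrite (mem_normal_Hall hallZ nsZH) ?groupX //; last by rewrite -consttJ groupX.
    by rewrite p_eltJ p_elt_constt.
  rewrite groupV; apply/normP/eqP; rewrite eqEcard cardJg leqnn andbT.
  by rewrite /= -cycleJ cycle_subG.
have HE y : y \in G -> (g ^ y \in H) = (y \in N) && (g.`_r ^ y \in H).
  move=> Gy; apply/idP/andP => [Hgy | [Ny Hr]].
    by split; [exact: NP | rewrite -consttJ groupX].
  rewrite -(consttC r g) conjMg groupM // (subsetP (joing_subl _ _)) //.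
  by rewrite memJ_norm ?cycle_id //; case/setIP: Ny.
(* Fixed points of the r-group generated by the r-part are counted modulo r by |N : H|, a divisor of
   |N : R|, which is prime to r since [R] is Sylow in [N]. *)
exists #|F|; last first.
  have actsR := subset_trans sgN (actsRs_rcosets H N).
  have := pgroup_fix_mod r_gr actsR; rewrite afix_cycle // -/F => eqF.
  rewrite /dvdn -eqF -/(dvdn r _) -[#|rcosets H N|]/(#|N : H|).
  have r'NR : r^'.-nat #|N : R| by case/and3P: sylR.
  rewrite -p'natE //; apply: pnat_dvd r'NR.
  by rewrite -(@Lagrange_index _ N H R) ?dvdn_mulr ?joing_subr.
pose A := [set y in N | g.`_r ^ y \in H].
rewrite cfIndE // (eq_bigr (fun y => (y \in A)%:R%R)); last first.
  by move=> y Gy; rewrite cfun1E HE // [y \in A]inE.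
have sum_A : (\sum_(y in G) (y \in A) = #|H| * #|F|)%N.
  rewrite -card_conj_into // -sum1_card [RHS]big_mkcond [LHS]big_mkcond /=.
  apply: eq_bigr => y _; rewrite !inE.
  by case: (y \in G); case: (y \in 'N(Z)); case: (_ \in H).
by rewrite -natr_sum sum_A natrM mulKf ?neq0CG.
Qed.

Section HyperelementaryInduction.
Local Open Scope ring_scope.

(** Brauer's characterization of characters. The virtual characters [phi] with [f * phi] virtual
    form an ideal, which contains each 'Ind 1 from a hyperelementary subgroup because [f] times it
    is the induction of 'Res f. The proof shows that 1 is in this ideal, first one point at a
    time. *)
Lemma vchar_hyperelementary (gT : finGroupType) (G : {group gT}) (f : 'CF(G)) :
    (forall (r : nat) (Z R H : {group gT}), prime r -> cyclic Z ->
       r^'.-group Z -> r.-group R -> (Z ><| R = H)%g -> H \subset G ->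
       'Res[H] f \in 'Z[irr H]) ->
  f \in 'Z[irr G].
Proof.
move=> f_hyper.
pose J (phi : 'CF(G)) := phi \in 'Z[irr G] /\ f * phi \in 'Z[irr G].
have JB phi psi : J phi -> J psi -> J (phi - psi).
  by move=> [? ?] [? ?]; split; rewrite ?mulrBr rpredB.
have JD phi psi : J phi -> J psi -> J (phi + psi).
  by move=> [? ?] [? ?]; split; rewrite ?mulrDr rpredD.
have JM phi psi : J phi -> psi \in 'Z[irr G] -> J (phi * psi).
  by move=> [? ?] Zpsi; split; rewrite ?mulrA mul_vchar.
have Jn n phi : J phi -> J (phi *+ n).
  by move=> [? ?]; split; rewrite ?mulrnAr rpredMn.
have J_prime g r : g \in G -> prime r ->
  exists2 n : nat, ~~ (r %| n)%N & exists2 phi, J phi & phi g = n%:R.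
- move=> Gg r_pr; have [Z [R [/andP[cZ r'Z] rR sHG defH [n Dn r'n]]]] :=
    hyperelementary_Ind1 r_pr Gg.
  exists n => //; exists ('Ind[G, (Z <*> R)%G] 1) => //; split.
    by rewrite cfInd_vchar ?cfun1_vchar.
  rewrite mulrC -cfIndM // mul1r cfInd_vchar //.
  exact: f_hyper r_pr cZ r'Z rR defH sHG.
have J_one g : g \in G -> exists2 phi, J phi & phi g = 1.
  move=> Gg; have [n n2] := J_prime g 2 Gg isT.
  have: (0 < n)%N by case: (n) n2.
  move: {n2} n; elim/ltn_ind=> n IHn n_gt0 [phi Jphi Dn].
  have [n1 | n_neq1] := eqVneq n 1%N; first by exists phi; rewrite // Dn n1.
  have r_pr : prime (pdiv n) by rewrite pdiv_prime // ltn_neqAle eq_sym n_neq1.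
  have [m r'm [psi Jpsi Dm]] := J_prime g _ Gg r_pr.
  case: (@egcdnP n m n_gt0) => u v Duv _.
  have dv_n : (gcdn n m %| n)%N by apply: dvdn_gcdl.
  apply: (IHn (gcdn n m)).
  - rewrite ltn_neqAle dvdn_leq // andbT; apply: contraNneq r'm => eq_n.
    by rewrite (dvdn_trans (pdiv_dvd n)) // -eq_n dvdn_gcdr.
  - by rewrite gcdn_gt0 n_gt0.
  exists (phi *+ u - psi *+ v); first by apply: JB; apply: Jn.
  rewrite -!scaler_nat !cfunE Dn Dm -!natrM Duv natrD addrAC subrr add0r.
  by [].
have J_seq (s : seq gT) : {subset s <= G} ->
  exists2 phi, J phi & {in s, forall g, phi g = 1}.
- elim: s => [_ | g s IHs sgG].
    have [phi Jphi _] := J_one 1%g (group1 G); exists phi => // g; by rewrite in_nil.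
  have [|phi Jphi phi1] := IHs; first by move=> h sh; rewrite sgG // inE sh orbT.
  have [|psi Jpsi psi1] := J_one g; first by rewrite sgG ?mem_head.
  (* This is 1 - (1 - phi)(1 - psi), hence 1 wherever [phi] or [psi] is. *)
  exists (phi + psi - phi * psi).
    by apply: JB; [apply: JD | apply: JM => //; case: Jpsi].
  move=> h; rewrite inE => /predU1P[-> | sh]; rewrite !cfunE.
    by rewrite psi1 mulr1 addrAC subrr add0r.
  by rewrite phi1 // mul1r addrK.
have [|phi [_ Jphi] phi1] := J_seq (enum G); first by move=> g; rewrite mem_enum.
suff phiE: phi = 1 by rewrite phiE mulr1 in Jphi.
by apply/cfun_inP=> g Gg; rewrite phi1 ?mem_enum // cfun1E Gg.
Qed.

End HyperelementaryInduction.

(** The automorphism group of a cyclic group of order 2^k has order totient(2^k), a power of 2, so a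
    group of odd order acts trivially. *)
Lemma odd_cent_cyclic2 (gT : finGroupType) (T R : {group gT}) :
  cyclic T -> 2.-group T -> odd #|R| -> R \subset 'N(T) -> R \subset 'C(T).
Proof.
move=> cycT /p_natP[k oT] oddR nTR.
rewrite -ker_conj_aut -sub_morphim_pre // (_ : _ @* R = 1) ?sub1G //.
apply/eqP; rewrite trivg_card1 -dvdn1.
have: coprime 2 #|conj_aut T @* R|.
  by rewrite coprime2n (dvdn_odd (dvdn_morphim _ _)).
move/(coprimeXl k.-1)/eqP <-; rewrite dvdn_gcd dvdnn andbT.
have dvA: #|conj_aut T @* R| %| #|Aut T| by rewrite cardSg ?Aut_conj_aut.
apply: dvdn_trans dvA _; rewrite card_Aut_cyclic // oT.
by case: (k) => [|j] //; rewrite totient_pfactor // mul1n.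
Qed.

(** By Sylow the 2-part of [k * t] has a conjugate in [T], and the conjugating element can be
    corrected to lie in [O]. Modulo [O] nothing has then changed, so this conjugate has the image of
    [t], and [T] embeds in the quotient. *)
Lemma constt2_sdprod_conj (gT : finGroupType) (O T H : {group gT}) (k t : gT) :
  O ><| T = H -> 2^'.-group O -> 2.-group T -> k \in O -> t \in T ->
  exists2 u, u \in H & (k * t).`_2 ^ u = t.
Proof.
move=> defH oddO pT Ok Tt.
have [nsOH sTH defOT nOT tiOT] := sdprod_context defH.
have sylT : 2.-Sylow(H) T.
  rewrite pHallE sTH -(sdprod_card defH) partnM ?cardG_gt0 //=.
  by rewrite (part_p'nat oddO) (part_pnat_id pT) mul1n.
have Hkt: k * t \in H by rewrite -defOT mem_mulg.
have nOH := normal_norm nsOH; have sOH := normal_sub nsOH.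
have ptk: 2.-group <[(k * t).`_2]> by rewrite /pgroup -orderE; exact: p_elt_constt.
have sgH : <[(k * t).`_2]> \subset H by rewrite cycle_subG groupX.
have [u Hu] := Sylow_Jsub sylT sgH ptk.
rewrite -cycleJ cycle_subG => Tu.
have: u \in O * T by rewrite defOT.
case/mulsgP=> a b Oa Tb Du.
exists (u * b^-1); first by rewrite groupM // groupV (subsetP sTH).
have Tt' : (k * t).`_2 ^ (u * b^-1) \in T by rewrite conjgM groupJ ?groupV.
have nOT' s : s \in T -> s \in 'N(O) by apply: subsetP.
have nOH' h : h \in H -> h \in 'N(O) by apply: subsetP.
have injT: {in T &, injective (coset O)}.
  move=> s s' Ts Ts' /(rcoset_kercosetP (nOT' _ Ts) (nOT' _ Ts')).
  rewrite mem_rcoset => Oss; apply/eqP; rewrite eq_mulgV1 -in_set1.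
  by rewrite -set1gE -tiOT inE Oss groupM ?groupV.
have Ot: coset O (k * t) = coset O t by rewrite coset_kerl // (subsetP sOH).
have Hub: u * b^-1 \in H by rewrite groupM // groupV (subsetP sTH).
apply: injT => //; rewrite morphJ ?nOH' ?groupX //=.
rewrite morph_constt ?nOH' //= Ot -morph_constt ?nOT' //=.
rewrite (constt_p_elt (mem_p_elt pT Tt)) Du -mulgA mulgV mulg1.
by rewrite (coset_id Oa) conjg1.
Qed.

(** A class function that sees only 2-parts is the inflation of its restriction to [T] through H /
    O. *)
Lemma vchar_sdprod (gT : finGroupType) (O T H : {group gT}) (f : 'CF(H)) :
    O ><| T = H -> 2^'.-group O -> 2.-group T ->
    {in H, forall h, f h = f h.`_2} -> ('Res[T] f \in 'Z[irr T])%R ->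
  (f \in 'Z[irr H])%R.
Proof.
move=> defH oddO pT f2 ZfT.
have [_ sTH defOT _ _] := sdprod_context defH.
have ->: f = cfSdprod defH ('Res[T] f)%R.
  apply/cfun_inP=> h Hh; move: (Hh); rewrite -{1}defOT => /mulsgP[k t Ok Tt Dh].
  have [u Hu Dt] := constt2_sdprod_conj defH oddO pT Ok Tt.
  rewrite {2}Dh cfSdprodE // cfResE // -Dt -Dh cfunJ //; exact: f2.
have [psi Npsi [xi Nxi ->]] := vcharP _ ZfT.
by rewrite raddfB /= rpredB ?char_vchar ?cfSdprod_char.
Qed.

Lemma vchar_constt2 (gT : finGroupType) (G : {group gT}) (f : 'CF(G)) :
    {in G, forall g, f g = f g.`_2} ->
    (forall T : {group gT}, T \subset G -> 2.-group T -> ('Res[T] f \in 'Z[irr T])%R) ->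
  (f \in 'Z[irr G])%R.
Proof.
move=> f2 ZfT; apply: vchar_hyperelementary => r Z R H r_pr cZ r'Z rR defH sHG.
have f2H: {in H, forall h, ('Res[H] f)%R h = ('Res[H] f)%R h.`_2}.
  by move=> h Hh; rewrite !cfResE ?groupX //; apply/f2/(subsetP sHG).
have ZfTH (T : {group gT}) : T \subset H -> 2.-group T -> ('Res[T] ('Res[H] f) \in 'Z[irr T])%R.
  by move=> sTH pT; rewrite cfResRes // ZfT // (subset_trans sTH).
have [nsZH sRH _ nZR tiZR] := sdprod_context defH.
have [r2 | r_neq2] := eqVneq r 2.
  rewrite {r}r2 in r_pr r'Z rR *.
  by apply: (vchar_sdprod defH) => //; apply: ZfTH.
have oddR: odd #|R|.
  by rewrite odd_2'nat; apply: (sub_in_pnat _ rR) => q _; rewrite !inE => /eqP->.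
(* For odd r the Sylow 2-subgroup of [H] lies in the cyclic group [Z]; [Z] and [R] both centralize
   it, so it has a normal complement of odd order and [vchar_sdprod] applies again. *)
pose T := 'O_2(Z)%G.
have chTZ: T \char Z by apply: pcore_char.
have sTZ := char_sub chTZ; have nsTH := char_normal_trans chTZ nsZH.
have pT: 2.-group T := pcore_pgroup _ _.
have hallT: 2.-Hall(Z) T by rewrite nilpotent_pcore_Hall // abelian_nil // cyclic_abelian.
have cTH: H \subset 'C(T).
  have [_ <- _ _] := sdprodP defH; rewrite mul_subG //.
    by rewrite centsC (subset_trans sTZ) // -/(abelian Z) cyclic_abelian.
  rewrite odd_cent_cyclic2 ?(cyclicS sTZ) //.
  by rewrite (subset_trans sRH) ?normal_norm.
have HallTH: 2.-Hall(H) T.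
  have [_ _ Z2] := and3P hallT.
  rewrite pHallE (normal_sub nsTH) -(sdprod_card defH) partnM ?cardG_gt0 //.
  rewrite odd_2'nat in oddR.
  by rewrite (part_p'nat oddR) muln1 (card_Hall hallT) eqxx.
have /splitsP[O /complP[tiTO defTO]] := SchurZassenhaus_split (pHall_Hall HallTH) nsTH.
have sOH: O \subset H by rewrite -defTO mulG_subr.
have defOT: O ><| T = H.
  rewrite sdprodE ?(setIC O) //.
    by rewrite -defTO -normC // (subset_trans sOH) ?normal_norm.
  by rewrite cents_norm // centsC (subset_trans sOH).
apply: (vchar_sdprod defOT) => //; last by rewrite ZfTH ?normal_sub.
have := HallTH; rewrite /pHall => /and3P[_ _].
have -> : #|H : T| = #|O|.
  by rewrite -divgS ?normal_sub // -(sdprod_card defOT) mulnK ?cardG_gt0.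
by [].
Qed.

Lemma vchar_Sylow2 (gT : finGroupType) (G S : {group gT}) (f : 'CF(G)) :
    2.-Sylow(G) S -> {in G, forall g, f g = f g.`_2} ->
    ('Res[S] f \in 'Z[irr S])%R -> (f \in 'Z[irr G])%R.
Proof.
move=> sylS f2 ZfS; apply: vchar_constt2 => // T sTG pT.
have [u Gu sTuS] := Sylow_Jsub sylS sTG pT.
set Q := (T :^ u)%G in sTuS.
have isoT: isom Q T (conjgm Q u^-1).
  by rewrite -[X in isom _ X _](conjsgK u) conj_isom.
have sSG := pHall_sub sylS.
have ->: ('Res[T] f = cfIsom isoT ('Res[Q] ('Res[S] f)))%R.
  apply/cfun_inP=> t Tt; have Qtu: t ^ u \in Q by rewrite memJ_conjg.
  have Gt := subsetP sTG t Tt.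
  have {2}->: t = conjgm Q u^-1 (t ^ u) by rewrite conjgmE conjgK.
  rewrite cfIsomE // !cfResE ?(subset_trans sTuS) ?(subsetP sTuS) //.
  by rewrite cfunJ.
have ZfQ := cfRes_vchar Q ZfS.
have [psi Npsi [xi Nxi ->]] := vcharP _ ZfQ.
by rewrite raddfB /= rpredB ?char_vchar ?cfIsom_char.
Qed.

(** * Central characters and Frobenius-Schur indicators *)

Section CentralSum.
Local Open Scope ring_scope.

(** By Schur's lemma the sum of the conjugates of [x] acts as a scalar, which its trace
    determines. *)
Lemma sum_irrMJ (gT : finGroupType) (G : {group gT}) (i : Iirr G) (g x : gT) :
    g \in G -> x \in G ->
  \sum_(u in G) 'chi_i (g * x ^ u)%g = #|G|%:R * 'chi_i g * 'chi_i x / 'chi_i 1%g.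
Proof.
move=> Gg Gx; have irrC := socle_irr (socle_of_Iirr i).
pose rG := 'Chi_i; pose A := \sum_(u in G) rG (x ^ u)%g.
have chiE h : h \in G -> 'chi_i h = \tr (rG h).
  by move=> Gh; rewrite -irrRepr cfunE Gh.
have cA: centgmx rG A.
  apply/centgmxP=> h Gh; rewrite /A mulmx_suml mulmx_sumr.
  rewrite (reindex_inj (mulIg h^-1%g)) /=.
  apply: eq_big => [u | u Gu]; first by rewrite groupMr ?groupV.
  have Gu' : u \in G by rewrite groupMr ?groupV // in Gu.
  rewrite -!repr_mxM ?groupJ ?groupM ?groupV //; congr (rG _).
  by rewrite [LHS]conjgC -conjgM mulgKV.
have [a Aa] := is_scalar_mxP (mx_abs_irr_cent_scalar (groupC irrC) cA).
have sumE h : h \in G -> \sum_(u in G) 'chi_i (h * x ^ u)%g = a * 'chi_i h.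
  move=> Gh; transitivity (\tr (rG h *m A)).
    rewrite /A mulmx_sumr raddf_sum; apply: eq_bigr => u Gu.
    have Gxu : (x ^ u)%g \in G by rewrite groupJ.
    have Ghxu : (h * x ^ u)%g \in G by rewrite groupM.
    rewrite (chiE _ Ghxu).
    by rewrite (repr_mxM rG).
  by rewrite Aa mul_mx_scalar mxtraceZ -chiE.
have := sumE 1%g (group1 G).
under eq_bigr => u Gu do rewrite mul1g cfunJ //.
rewrite sumr_const => aE; rewrite sumE //.
by rewrite [_ * 'chi_i g * _]mulrAC mulr_natl aE [RHS]mulrAC mulfK ?irr1_neq0.
Qed.

Lemma sum_irrM_class (gT : finGroupType) (G : {group gT}) (i : Iirr G) (A : {set gT}) (g : gT) :
    g \in G -> A \subset G -> G \subset 'N(A) ->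
  \sum_(a in A) 'chi_i (g * a)%g = 'chi_i g * ((\sum_(a in A) 'chi_i a) / 'chi_i 1%g).
Proof.
move=> Gg sAG nAG; apply: (mulfI (neq0CG G)).
transitivity (\sum_(u in G) \sum_(a in A) 'chi_i (g * a ^ u)%g).
  rewrite mulr_natl -sumr_const; apply: eq_bigr => u Gu.
  rewrite (reindex_inj (conjg_inj u)); apply: eq_bigl => a.
  by rewrite memJ_norm // (subsetP nAG).
rewrite exchange_big /= mulr_suml !mulr_sumr; apply: eq_bigr => a Aa.
have Ga := subsetP sAG a Aa; rewrite sum_irrMJ //.
by rewrite !mulrA.
Qed.

Lemma Aint_sum_class_div_irr1 (gT : finGroupType) (G : {group gT}) (i : Iirr G) (A : {set gT}) :
    A \subset G -> G \subset 'N(A) ->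
  (\sum_(a in A) 'chi_i a) / 'chi_i 1%g \in Aint.
Proof.
move=> sAG nAG.
have actsA: [acts G, on A | 'J] by apply/actsP=> u Gu a; rewrite /= memJ_norm ?(subsetP nAG).
rewrite (set_partition_big _ (orbit_partition actsA)) mulr_suml rpred_sum // => _ /imsetP[a Aa ->].
rewrite orbitJ (eq_bigr (fun=> 'chi_i a)); last first.
  by move=> _ /imsetP[u Gu ->]; rewrite cfunJ.
by rewrite sumr_const -mulr_natl Aint_class_div_irr1 ?(subsetP sAG).
Qed.

End CentralSum.

Section FrobeniusSchur.
Local Open Scope ring_scope.

Lemma mxtrace_idem (F : fieldType) (n : nat) (P : 'M[F]_n) :
  P *m P = P -> \tr P = (\rank P)%:R.
Proof.
move=> PP; rewrite -{1}(mulmx_base P) mxtrace_mulC.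
suff ->: row_base P *m col_base P = 1%:M by rewrite mxtrace1.
have /row_free_inj injR := row_base_free P.
have /row_fullP[L' L'L] := col_base_full P.
apply: injR; rewrite mul1mx -[LHS]mul1mx -L'L.
have /esym L'P := congr1 (mulmx L') (mulmx_base P); rewrite mulmxA L'L mul1mx in L'P.
rewrite -mulmxA -[RHS]L'P; congr (_ *m _).
rewrite -[RHS]PP -[in RHS](mulmx_base P).
by rewrite !mulmxA.
Qed.

Lemma skew_unitmx_even (n : nat) (A : 'M[algC]_n) :
  A \in unitmx -> A^T = - A -> ~~ odd n.
Proof.
rewrite unitmxE unitfE => detA At; apply: contra_eqN At => odd_n.
apply: contraNneq detA => At; have := det_tr A.
rewrite At -scaleN1r detZ -signr_odd odd_n expr1 mulN1r => /eqP.
by rewrite eq_sym -addr_eq0 -mulr2n mulrn_eq0.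
Qed.

(* The form [u B T^T v^T] on the eigenspace of Y for the eigenvalue z^-1 = - z is
   skew and nondegenerate when B is symmetric. *)
Lemma sym_eigen_even (n : nat) (z : algC) (Y T B : 'M[algC]_n) :
    let P := (1%:M - z *: Y) *m (1%:M - Y *m Y) in
    z * z = -1 -> B \in unitmx -> B^T = B ->
    Y *m B *m Y^T = B -> T *m B *m T^T = B ->
    T *m T = Y *m Y -> Y *m Y *m (Y *m Y) = 1%:M -> Y *m T *m Y = T ->
  P *m P = 4%:R *: P /\ ~~ odd (\rank P).
Proof.
move=> P zz uB symB YB TB TT XX YTY; set X := Y *m Y in P TT XX *.
have defX: Y *m Y = X by [].
have cXY: X *m Y = Y *m X by rewrite /X mulmxA.
clearbody X.
have cXT: X *m T = T *m X by rewrite -TT mulmxA.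
have PX: P *m X = - P.
  by rewrite /P -mulmxA [(1%:M - X) *m X]mulmxBl mul1mx XX -mulmxN opprB.
have PE: P = 1%:M - z *: Y - X + z *: (Y *m X).
  rewrite /P mulmxBr mulmx1 mulmxBl mul1mx -scalemxAl.
  by rewrite opprB addrA addrAC.
(* As Y^4 = 1, [P] kills the eigenvalues 1, -1 and -z of [Y] and acts as 4 on the eigenvalue z; [Q]
   does the same for -z. The form [B] pairs these two eigenspaces ([PB]) and [T] exchanges them
   ([PT]), so [B *m T^T] pairs the image of [P] with itself. It is skew there since [X] acts as
   -1. *)
pose Q := (1%:M + z *: Y) *m (1%:M - X).
have QE : Q = 1%:M + z *: Y - X - z *: (Y *m X).
  by rewrite /Q mulmxBr mulmx1 mulmxDl mul1mx -scalemxAl opprD addrA.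
have YXY: Y *m X *m Y = 1%:M by rewrite -cXY -mulmxA defX XX.
clearbody P Q.
have BY: B *m Y^T = Y *m X *m B.
  by rewrite -[X in _ = _ *m X]YB !mulmxA YXY mul1mx.
have BX: B *m X^T = X *m B.
  by rewrite -{1}defX trmx_mul mulmxA BY -mulmxA BY !mulmxA YXY mul1mx.
have BYX: B *m (Y *m X)^T = Y *m B.
  by rewrite trmx_mul mulmxA BX -mulmxA BY !mulmxA cXY -[Y *m X *m X]mulmxA XX mulmx1.
have swap (a b c d : 'M[algC]_n): a - b - c + d = a + d - c - b.
  by rewrite addrAC [a - b + d]addrAC addrAC.
have PB: P *m B = B *m Q^T.
  have ->: Q^T = 1%:M + z *: Y^T - X^T - z *: (Y *m X)^T.
    by rewrite QE !linearB /= linearD /= !linearZ /= trmx1.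
  rewrite PE !mulmxBr mulmxDr mulmxDl !mulmxBl mulmx1 mul1mx -!scalemxAr -!scalemxAl.
  by rewrite BY BX BYX swap.
have YT: Y *m T = T *m (Y *m X).
  by rewrite -[X in _ = X *m _]YTY -!mulmxA [Y *m (Y *m X)]mulmxA defX XX mulmx1.
have YXT: Y *m X *m T = T *m Y.
  by rewrite -mulmxA cXT mulmxA YT -!mulmxA XX mulmx1.
have PT: P *m T = T *m Q.
  rewrite PE QE !mulmxBr mulmxDr mulmxDl !mulmxBl mulmx1 mul1mx -!scalemxAr -!scalemxAl.
  by rewrite cXT YT YXT swap.
pose C := B *m T^T.
have PC: P *m C = C *m P^T.
  by rewrite /C mulmxA PB -!mulmxA -!trmx_mul PT.
have CT: C^T = X *m C.
  by rewrite /C trmx_mul trmxK symB -{1}TB -TT !mulmxA.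
have PY: P *m Y = z *: P.
  rewrite PE !mulmxDl !mulNmx mul1mx -!scalemxAl YXY defX cXY.
  rewrite !scalerDr !scalerN !scalerA zz !scaleN1r opprK.
  by rewrite addrC !addrA.
have PP: P *m P = 4%:R *: P.
  rewrite {2}PE mulmxDr !mulmxBr mulmx1 -!scalemxAr mulmxA PY PX -!scalemxAl PX.
  by rewrite !scalerA zz !scalerN !scaleN1r !opprK scaler_nat !mulrS mulr0n addr0 !addrA.
split=> //; set L := col_base P; set R := row_base P.
pose N := R *m C *m R^T.
have RX: R *m X = - R.
  have /row_fullP[L' L'L] := col_base_full P.
  have /esym L'P := congr1 (mulmx L') (mulmx_base P); rewrite mulmxA L'L mul1mx in L'P.
  by rewrite -[R]L'P -mulmxA PX mulmxN.
have Nt: N^T = - N.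
  by rewrite /N trmx_mul trmxK trmx_mul CT !mulmxA RX !mulNmx.
apply: (@skew_unitmx_even _ N) => //.
have uC: C \in unitmx.
  have [uT _]: T \in unitmx /\ X *m T \in unitmx.
    by apply: mulmx1_unit; rewrite mulmxA -cXT -mulmxA TT.
  by rewrite unitmx_mul uB unitmx_tr.
have PCP: P *m C *m P^T = L *m N *m L^T.
  by rewrite -[in LHS](mulmx_base P) trmx_mul !mulmxA.
rewrite -row_free_unit /row_free eqn_leq rank_leq_row /=.
apply: (@leq_trans (\rank (P *m C *m P^T))).
  rewrite -mulmxA -PC mulmxA PP -scalemxAl mxrank_scale_nz ?pnatr_eq0 //.
  by rewrite mxrankMfree // row_free_unit.
by rewrite PCP (leq_trans (mxrankM_maxl _ _)) ?mxrankM_maxr.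
Qed.

End FrobeniusSchur.

Section FrobeniusSchurIrr.
Local Open Scope ring_scope.

(** Invariant bilinear forms are averages [Avg A]; by Schur's lemma they are the multiples of one
    invertible [B], on which transposition acts as a sign. The sum over squares is a sum of entries
    of averaged elementary matrices, and transposing them turns it into the norm of the character
    times this sign. *)
Lemma Frobenius_Schur_irr (gT : finGroupType) (G : {group gT}) (n : nat)
    (rG : mx_representation algC G n) :
    mx_irreducible rG -> cfReal (cfRepr rG) ->
  exists nu, exists B : 'M[algC]_n,
    [/\ B \in unitmx, B^T = nu *: B,
        {in G, forall g, rG g *m B *m (rG g)^T = B}, nu = 1 \/ nu = -1
      & \sum_(g in G) cfRepr rG (g * g)%g = nu * #|G|%:R].
Proof.
move=> irrG /eqP real_chi; have irrC : mx_absolutely_irreducible rG := groupC irrG.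
have chiE h : h \in G -> cfRepr rG h = \tr (rG h).
  by move=> Gh; rewrite cfunE Gh.
pose inv (B : 'M[algC]_n) := forall g, g \in G -> rG g *m B *m (rG g)^T = B.
pose Avg (A : 'M[algC]_n) := \sum_(g in G) rG g *m A *m (rG g)^T.
have invAvg A : inv (Avg A).
  move=> h Gh; rewrite /Avg mulmx_sumr mulmx_suml.
  rewrite [RHS](reindex_inj (mulgI h)) /=.
  apply: eq_big => [u | u Gu]; first by rewrite groupMl.
  have Guh : (h * u)%g \in G by rewrite groupM.
  by rewrite (repr_mxM rG) // trmx_mul !mulmxA.
have AvgE j k r s : Avg (delta_mx j k) r s = \sum_(g in G) rG g r j * rG g s k.
  rewrite /Avg summxE; apply: eq_bigr => g _.
  rewrite -[delta_mx j k](mul_delta_mx (0 : 'I_1)) mulmxA -mulmxA -colE -trmx_delta.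
  rewrite -trmx_mul -colE mxE big_ord1 !mxE.
  by [].
(* This is where reality enters: the sum is |G| times the norm of the character, hence nonzero, so
   some average is a nonzero form. *)
have sumN : \sum_j \sum_k Avg (delta_mx j k) j k = #|G|%:R.
  transitivity (\sum_(g in G) cfRepr rG g * (cfRepr rG g)^* ).
    under eq_bigr => j _ do under eq_bigr => k _ do rewrite AvgE.
    under eq_bigr => j _ do rewrite exchange_big.
    rewrite exchange_big; apply: eq_bigr => g Gg.
    have ->: (cfRepr rG g)^* = cfRepr rG g.
      by move: (cfRepr rG) real_chi => c cE; rewrite -{2}cE cfunE.
    rewrite (chiE _ Gg) /mxtrace mulr_suml; apply: eq_bigr => j _.
    by rewrite mulr_sumr.
  have /irrP[i ->]: cfRepr rG \in irr G by apply/irr_reprP; exists (Representation rG).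
  have := cfnorm_irr i; rewrite cfdotE => /(congr1 ( *%R #|G|%:R)).
  by rewrite mulrA mulfV ?neq0CG // mul1r mulr1.
have uinv B : inv B -> B != 0 -> B \in unitmx.
  move=> invB; apply: contraR; rewrite -row_free_unit -kermx_eq0 => kB.
  have : mxmodule rG (kermx B).
    apply/mxmoduleP=> g Gg; apply/sub_kermxP.
    have : rG g *m B *m ((rG g)^T *m (rG g^-1%g)^T) = B *m (rG g^-1%g)^T.
      by rewrite mulmxA invB.
    rewrite -trmx_mul -(repr_mxM rG) ?groupV // mulVg (repr_mx1 rG) trmx1 mulmx1 => rB.
    by rewrite -mulmxA rB mulmxA mulmx_ker mul0mx.
  have [_ _ irr_full] := irrG.
  move=> /irr_full/(_ (submx1 _) kB) full; rewrite -[B]mul1mx.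
  by apply/eqP/sub_kermxP.
have [B invB uB]: exists2 B, inv B & B \in unitmx.
  suff /existsP[[j k] nz_jk]: [exists p, Avg (delta_mx p.1 p.2) != 0].
    by exists (Avg (delta_mx j k)); [apply: invAvg | apply: uinv].
  apply: contraR (neq0CG G) => /existsPn/= Avg0; rewrite -sumN; apply/eqP.
  rewrite big1 // => j _; rewrite big1 // => k _.
  by have:= Avg0 (j, k); rewrite negbK => /eqP->; rewrite mxE.
have invV g : g \in G -> (rG g)^T = invmx B *m rG g^-1%g *m B.
  move=> Gg; suff ->: (rG g)^T = invmx B *m (rG g^-1%g *m (rG g *m B *m (rG g)^T)).
    by rewrite invB // mulmxA.
  rewrite !mulmxA -[_ *m rG _ *m rG _]mulmxA -(repr_mxM rG) ?groupV // mulVg.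
  by rewrite (repr_mx1 rG) mulmx1 mulVmx // mul1mx.
have inv_scal A : inv A -> exists c, A = c *: B.
  move=> invA; have cA : centgmx rG (A *m invmx B).
    apply/centgmxP=> g Gg; rewrite -{1}(invA g Gg) invV // !mulmxA.
    rewrite -[_ *m B *m invmx B]mulmxA mulmxV // mulmx1.
    by rewrite -[LHS]mulmxA -(repr_mxM rG) ?groupV // mulVg (repr_mx1 rG) mulmx1.
  have /is_scalar_mxP[c Ac] := mx_abs_irr_cent_scalar irrC cA.
  by exists c; rewrite -mul_scalar_mx -Ac mulmxKV.
have [nu BT]: exists nu, B^T = nu *: B.
  by apply: inv_scal => g Gg; rewrite -{2}(invB g Gg) !trmx_mul trmxK mulmxA.
exists nu, B; split=> //.
  have nzB: B != 0.
    apply: contraNneq (neq0CG G) => B0; rewrite -sumN big1 // => j _.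
    rewrite big1 // => k _; have [c ->] := inv_scal _ (invAvg (delta_mx j k)).
    by rewrite B0 scaler0 mxE.
  have : (nu * nu - 1) *: B = 0.
    by rewrite scalerBl scale1r -scalerA -BT -linearZ /= -BT trmxK subrr.
  move/eqP; rewrite scaler_eq0 (negPf nzB) orbF subr_eq0 -expr2 sqrf_eq1.
  by case/orP=> /eqP ->; [left | right].
rewrite -sumN mulr_sumr.
transitivity (\sum_j \sum_k Avg (delta_mx k j) j k).
  under [RHS]eq_bigr => j _ do under eq_bigr => k _ do rewrite AvgE.
  under [RHS]eq_bigr => j _ do rewrite exchange_big.
  rewrite [RHS]exchange_big; apply: eq_bigr => g Gg.
  rewrite chiE ?groupM // (repr_mxM rG) //; apply: eq_bigr => j _.
  by rewrite mxE.
apply: eq_bigr => j _; rewrite mulr_sumr; apply: eq_bigr => k _.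
have AvgT : Avg (delta_mx k j) = (Avg (delta_mx j k))^T.
  rewrite /Avg raddf_sum; apply: eq_bigr => g _.
  by rewrite /= !trmx_mul trmxK trmx_delta mulmxA.
have [c Ac] := inv_scal _ (invAvg (delta_mx j k)).
by rewrite AvgT Ac linearZ /= BT !mxE mulrCA.
Qed.

End FrobeniusSchurIrr.

Section FrobeniusSchurValues.
Local Open Scope ring_scope.
Variables (gT : finGroupType) (G : {group gT}) (i : Iirr G).
Hypothesis real_chi : cfReal 'chi_i.

Lemma Frobenius_Schur_odd n : 'chi_i 1%g = n%:R -> odd n ->
  \sum_(g in G) 'chi_i (g * g)%g = #|G|%:R.
Proof.
move=> chi1 odd_n; have := real_chi; have [rG irrG chiE] := irr_reprP (mem_irr i).
rewrite chiE => /(Frobenius_Schur_irr irrG) [nu [B [uB BT _ nu1 ->]]].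
case: nu1 BT => ->; rewrite ?mul1r // scaleN1r => /(skew_unitmx_even uB).
suff -> : rdegree rG = n by rewrite odd_n.
by apply/eqP; rewrite -(eqC_nat) -chi1 chiE cfRepr1.
Qed.

(** The hypotheses on the values make [e] the multiplicity of the eigenvalue i of [y], read as the
    trace of an idempotent. A symmetric invariant form would make it even by [sym_eigen_even]. *)
Lemma Frobenius_Schur_Q8 e y t : y \in G -> t \in G ->
    (y * y = t * t)%g -> (y * y * (y * y) = 1)%g -> (y * t * y = t)%g ->
    'chi_i y = 0 -> 'chi_i y^-1%g = 0 ->
    'chi_i 1%g - 'chi_i (y * y)%g = (4 * e)%:R -> odd e ->
  \sum_(g in G) 'chi_i (g * g)%g = - #|G|%:R.
Proof.
move=> Gy Gt tt yy yty chiy chiy' chi4 odd_e.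
have := real_chi; have [rG irrG chiE] := irr_reprP (mem_irr i).
have trE h : h \in G -> \tr (rG h) = 'chi_i h by move=> Gh; rewrite chiE cfunE Gh.
rewrite chiE => /(Frobenius_Schur_irr irrG) [nu [B [uB BT invB nu1 ->]]].
case: nu1 BT => ->; rewrite ?mulN1r // scale1r => symB.
have Gyy : (y * y)%g \in G by rewrite groupM.
have Gyt : (y * t)%g \in G by rewrite groupM.
have [] := @sym_eigen_even _ 'i (rG y) (rG t) B _ uB symB (invB y Gy) (invB t Gt).
- by rewrite -expr2 sqrCi.
- by rewrite -!(repr_mxM rG) // tt.
- by rewrite -!(repr_mxM rG) // yy (repr_mx1 rG).
- by rewrite -!(repr_mxM rG) // yty.
set P := (_ - _) *m (_ - _) => PP /negP[].
suff -> : \rank P = e by [].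
have : (4%:R^-1 *: P) *m (4%:R^-1 *: P) = 4%:R^-1 *: P.
  by rewrite -scalemxAl -scalemxAr PP !scalerA divfK ?pnatr_eq0.
move/mxtrace_idem; rewrite mxrank_scale_nz ?invr_eq0 ?pnatr_eq0 //.
have y3 : (y * (y * y) = y^-1)%g by apply: (mulgI y); rewrite mulgV !mulgA -yy !mulgA.
have -> : P = 1%:M - 'i *: rG y - rG (y * y)%g + 'i *: rG y^-1%g.
  rewrite /P -(repr_mxM rG) // mulmxBr mulmx1 mulmxBl mul1mx -scalemxAl.
  by rewrite -(repr_mxM rG) // y3 opprB addrA addrAC.
rewrite linearZ linearD !linearB !linearZ /= -(repr_mx1 rG) !trE ?groupV // chiy chiy'.
rewrite !mulr0 subr0 addr0 chi4 natrM mulKf ?pnatr_eq0 // => /eqP.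
by rewrite eqC_nat => /eqP.
Qed.

End FrobeniusSchurValues.

(** * Groups with a cyclic Sylow 2-subgroup *)

Lemma odd_perm_regular (aT : finGroupType) (a : aT) :
  odd_perm (actperm 'R%act a) = odd #|aT| (+) odd (#|aT| %/ #[a]).
Proof.
congr (_ (+) odd _); have Ta : a \in [set: aT] by rewrite inE.
rewrite -[#[a]]/#|<[a]>| -cardsT (divgS (G := [set: aT]%G)) ?subsetT // -card_lcosets.
apply: eq_card => A; apply/imsetP/imsetP=> -[u uT ->]; exists u; rewrite ?inE //.
  by rewrite porbit_actperm // orbitR lcosetE.
by rewrite porbit_actperm // orbitR lcosetE.
Qed.

(** The kernel of the sign of the regular representation: a generator of [S] has |G : S| cycles, an
    odd number, each of even length, so it is an odd permutation. *)
Lemma cyclic_Sylow2_index2 (gT : finGroupType) (G S : {group gT}) :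
  2.-Sylow(G) S -> cyclic S -> S :!=: 1 -> exists2 N : {group gT}, N <| G & #|G : N| = 2.
Proof.
move=> sylS /cyclicP[s defS] ntS.
pose sg g := odd_perm (actperm 'R%act (subg G g)).
have sgM: {in G &, forall g h, sg (g * h) = sg g (+) sg h}.
  by move=> g h Gg Gh; rewrite /sg morphM // actpermM ?inE // odd_permM.
have Gs : s \in G by rewrite -cycle_subG -defS (pHall_sub sylS).
have sg_s : sg s.
  rewrite /sg odd_perm_regular; have -> : #[subg G s] = #[s].
    by rewrite order_injm ?injm_subg.
  have oS : #[s] = (#|G|`_2)%N by rewrite orderE -defS (card_Hall sylS).
  have oG : #|subg_of G| = #|G|.
    by rewrite -cardsT /= -(card_injm (injm_subg G)) //= im_subg.
  have dvS : 2 %| #[s].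
    have pS : 2.-group <[s]> by rewrite -defS (pHall_pgroup sylS).
    by rewrite defS in ntS; have [] := pgroup_pdiv pS ntS.
  rewrite [#|_|]oG oS -{2}(partnC 2 (cardG_gt0 G)) mulKn ?part_gt0 //.
  rewrite (_ : odd #|G| = false); first by rewrite odd_2'nat part_pnat.
  by apply/negbTE; rewrite -dvdn2 (dvdn_trans dvS) // order_dvdG.
have gN : group_set [set g in G | ~~ sg g].
  apply/group_setP; split=> [|g h].
    by rewrite inE group1; have := sgM 1 1 (group1 G) (group1 G); rewrite mulg1 addbb => ->.
  rewrite !inE => /andP[Gg g0] /andP[Gh h0]; rewrite groupM // sgM //.
  by rewrite (negPf g0) (negPf h0).
pose N := Group gN; have sNG : N \subset G by apply/subsetP=> g; rewrite inE => /andP[].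
have iN : #|G : N| = 2.
  have eG : G :=: N :|: N :* s.
    apply/setP=> g; rewrite !inE mem_rcoset inE groupMr ?groupV //.
    have [Gg|//] /= := boolP (g \in G).
    have := sgM (g * s^-1) s; rewrite groupMr ?groupV // mulgKV sg_s addbT => -> //.
    by case: (sg _).
  apply/eqP; rewrite -(eqn_pmul2l (cardG_gt0 N)) Lagrange // {1}eG cardsU.
  rewrite card_rcoset disjoint_setI0 ?cards0 ?subn0 ?addnn ?muln2 //.
  rewrite disjoint_sym; apply/pred0P=> g /=; rewrite mem_rcoset !inE groupMr ?groupV //.
  have [Gg|//] /= := boolP (g \in G).
  have := sgM (g * s^-1) s; rewrite groupMr ?groupV // mulgKV sg_s addbT => -> //.
  by case: (sg _).
by exists N; rewrite // index2_normal.
Qed.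

Lemma cyclic_Sylow2_sdprod (gT : finGroupType) (G S : {group gT}) :
  2.-Sylow(G) S -> cyclic S -> 'O_2^'(G) ><| S = G.
Proof.
have [n] := ubnP #|G|; elim: n G S => // n IHn G S leGn sylS cycS.
apply/(sdprod_p'core_HallP sylS).
have [S1 | ntS] := eqsVneq S 1.
  have p'G : 2^'.-group G.
    have := sylS; rewrite /pHall => /and3P[_ _]; rewrite S1 indexg1.
    by [].
  by rewrite pcore_pgroup_id // /pHall subxx p'G indexgg.
have [N nsNG iN] := cyclic_Sylow2_index2 sylS cycS ntS.
have sylSN := Hall_setI_normal nsNG sylS.
have sNG := normal_sub nsNG.
have ltNn : #|N| < n.
  by rewrite -ltnS (leq_trans _ leGn) // ltnS -(Lagrange sNG) iN ltn_Pmulr.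
have [/= cycSN defN] := (cyclicS (subsetIr N S) cycS, IHn N (N :&: S)%G ltNn).
rewrite setIC in sylSN; have {}defN := defN sylSN cycSN.
have sOO : 'O_2^'(N) \subset 'O_2^'(G).
  by rewrite pcore_max ?pcore_pgroup // (char_normal_trans (pcore_char _ _)).
rewrite /pHall pcore_sub pcore_pgroup /= (eq_pnat _ (negnK 2)).
apply: pnat_dvd (indexgS G sOO) _.
rewrite -(Lagrange_index sNG (pcore_sub _ _)) iN pnatM.
have [nsON _ _ _ _] := sdprod_context defN.
rewrite -divgS ?pcore_sub // -(sdprod_card defN) mulKn ?cardG_gt0 //.
exact: pHall_pgroup sylSN.
Qed.

(** * Class functions of norm 3 vanishing on involution products *)

Section CharacterContradictions.
Local Open Scope ring_scope.
Variables (gT : finGroupType) (G : {group gT}) (x : gT).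
Hypotheses (Gx : x \in G) (genG : <<x ^: G>> = G).

Lemma sum_norm1_vcharM (xi : 'CF(G)) : xi \in 'Z[irr G] -> '[xi] = 1 ->
  \sum_(u in G) xi (x * x ^ u)%g = #|G|%:R * (xi x ^+ 2 / xi 1%g).
Proof.
move=> Zxi xi1; have [b [i ->]] := vchar_norm1P Zxi xi1.
under eq_bigr => u Gu do rewrite cfunE.
rewrite -mulr_sumr sum_irrMJ // !cfunE.
by case: b; rewrite ?expr0 ?mul1r ?expr1 ?mulN1r ?sqrrN ?invrN ?mulrN expr2 !mulrA.
Qed.

Lemma norm1_vchar1_neq0 (xi : 'CF(G)) : xi \in 'Z[irr G] -> '[xi] = 1 -> xi 1%g != 0.
Proof.
move=> Zxi xi1; have [b [i ->]] := vchar_norm1P Zxi xi1.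
by rewrite cfunE mulf_neq0 ?signr_eq0 ?irr1_neq0.
Qed.

(** Up to sign [xi] is irreducible with [x] in its kernel, and the conjugates of [x] generate
    [G]. *)
Lemma norm1_vchar_gen_class (xi : 'CF(G)) : xi \in 'Z[irr G] -> '[xi] = 1 ->
  xi x = xi 1%g -> exists b : bool, xi = (-1) ^+ b *: 1.
Proof.
move=> Zxi xi1; have [b [i ->]] := vchar_norm1P Zxi xi1.
have nz : (-1) ^+ b != 0 :> algC by rewrite signr_eq0.
rewrite !cfunE => /(mulfI nz) chix; exists b.
suff /eqP->: i == 0 by rewrite irr0.
rewrite -subGcfker -{1}genG gen_subG class_sub_norm ?normal_norm ?cfker_normal //.
by rewrite /= cfkerEirr inE chix.
Qed.

(* f = 1 + a + b with a, b of norm 1. The average of a (x * x ^ u) over u is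
   a(x)^2 / a(1), so 1 + a(x)^2/a(1) + b(x)^2/b(1) = 0; with f(1) = f(x) = 0
   this forces a(x) = a(1), i.e. a = +-1, against '[f, 1] = 1. *)
Lemma vchar_norm3_false (f : 'CF(G)) :
    f \in 'Z[irr G] -> '[f] = 3%:R -> '[f, 1] = 1 -> f 1%g = 0 -> f x = 0 ->
  {in G, forall u, f (x * x ^ u)%g = 0} -> False.
Proof.
move=> Zf f3 f_1 f1 fx fxx.
have Zg : f - 1 \in 'Z[irr G] by rewrite rpredB ?cfun1_vchar.
have g2 : '[f - 1] = 2%:R.
  by rewrite cfnormB f3 f_1 cfnorm1 rmorph1; ring.
have [S0 [/orthonormalP[uab onab] Zab Dab]] := zchar_small_norm Zg g2 isT.
have {}Zab : {subset tval S0 <= 'Z[irr G]} := Zab.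
case: (tval S0) (size_tuple S0) uab onab Zab Dab => [|a [|b []]] //= _ uab onab Zab Dab.
rewrite big_cons big_seq1 in Dab.
have {Zab}[Za Zb] : a \in 'Z[irr G] /\ b \in 'Z[irr G].
  by rewrite !Zab ?inE ?eqxx ?orbT.
have [aa ab bb] : [/\ '[a] = 1, '[a, b] = 0 & '[b] = 1].
  rewrite !onab ?inE ?eqxx ?orbT //; split=> //.
  by move: uab; rewrite /= inE andbT => /negPf->.
have Df : f = 1 + a + b by rewrite -addrA -Dab addrC subrK.
have v1 : b 1%g = - (1 + a 1%g).
  by apply/eqP; rewrite -addr_eq0 addrC -f1 Df !cfunE cfun11.
have vx : b x = - (1 + a x).
  by apply/eqP; rewrite -addr_eq0 addrC -fx Df !cfunE cfun1E Gx.
have na := norm1_vchar1_neq0 Za aa; have nb := norm1_vchar1_neq0 Zb bb.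
have sq : 1 + a x ^+ 2 / a 1%g + b x ^+ 2 / b 1%g = 0.
  apply: (mulfI (neq0CG G)); rewrite !mulrDr mulr0 -!sum_norm1_vcharM // mulr_natl -sumr_const.
  rewrite -!big_split big1 //= => u Gu; rewrite -[RHS](fxx u Gu) Df !cfunE cfun1E.
  by rewrite groupM ?groupJ.
have : (a x - a 1%g) ^+ 2 = 0.
  rewrite v1 oppr_eq0 in nb; rewrite v1 vx in sq.
  have -> : (a x - a 1%g) ^+ 2 =
      a 1%g * (1 + a 1%g) * (1 + a x ^+ 2 / a 1%g + (- (1 + a x)) ^+ 2 / - (1 + a 1%g)).
    by field; rewrite na nb.
  by rewrite sq mulr0.
move/eqP; rewrite sqrf_eq0 subr_eq0 => /eqP/(norm1_vchar_gen_class Za aa) [e De].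
have : '[f - 1, a] = 1 by rewrite Dab cfdotDl aa (cfdotC b) ab conjC0 addr0.
rewrite De cfdotZr cfdotBl f_1 cfnorm1 subrr mulr0 => /eqP.
by rewrite eq_sym oner_eq0.
Qed.

End CharacterContradictions.

(** * Quaternion Sylow 2-subgroups of order 8 *)

Section Fibres.
Local Open Scope ring_scope.

(** Points moved by the involution [s] pair off, and a pair contributes 2 F(a). *)
Lemma sum_invol_mod2 (T : finType) (A : {set T}) (s : T -> T) (F : T -> algC) :
    {in A, forall a, s a \in A} -> {in A, forall a, s (s a) = a} ->
    {in A, forall a, F (s a) = F a} -> {in A, forall a, F a \in Aint} ->
  (\sum_(a in A) F a == \sum_(a in A | s a == a) F a %[mod 2%:R])%A.
Proof.
have [n] := ubnP #|A|; elim: n A => // n IHn A leAn sA ssA Fs FA.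
have [a /andP[Aa sa] | s1] := pickP [pred a in A | s a != a]; last first.
  suff -> : \sum_(a in A | s a == a) F a = \sum_(a in A) F a by apply: eqAmod_refl.
  apply: eq_bigl => a; have /= := s1 a; case: (a \in A) => //= /negbT.
  by rewrite negbK.
have Asa : s a \in A :\ a by rewrite !inE sa sA.
rewrite (big_setD1 a) // (big_setD1 (s a)) //= addrA Fs // -mulr2n.
have -> : \sum_(b in A | s b == b) F b = \sum_(b in A :\ a :\ s a | s b == b) F b.
  apply: eq_bigl => b; rewrite !inE; have [Ab|] := boolP (b \in A); rewrite /= ?andbF //.
  have [->|] := eqVneq b a; first by rewrite (negPf sa) andbF.
  by have [->|] := eqVneq b (s a); rewrite ?ssA ?[a == _]eq_sym ?(negPf sa) //= => _ ->.
have IH : (\sum_(b in A :\ a :\ s a) F b ==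
           \sum_(b in A :\ a :\ s a | s b == b) F b %[mod 2%:R])%A.
  apply: IHn => [|b|b|b|b]; rewrite ?inE.
  - rewrite -ltnS (leq_trans _ leAn) // (cardsD1 a A) Aa (cardsD1 (s a) (A :\ a)) Asa.
    by rewrite !ltnS leqnSn.
  - case/and3P=> bsa ba Ab; rewrite sA // andbT.
    rewrite (can_in_eq ssA) // ba.
    by apply: contraNneq bsa => <-; rewrite ssA.
  - by case/and3P=> _ _; apply: ssA.
  - by case/and3P=> _ _; apply: Fs.
  by case/and3P=> _ _; apply: FA.
rewrite (eqAmod_trans _ IH) // -[X in (_ == X %[mod _])%A]add0r eqAmodDr.
by rewrite -[F a *+ 2]mulr_natl eqAmodMr0 // FA.
Qed.

(** [phi] commutes with conjugation, so [G] permutes its fibres over the class of [a]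
    transitively. *)
Lemma sum_fibres (R : nmodType) (gT : finGroupType) (G : {group gT}) (A : {set gT})
    (a : gT) (phi : gT -> gT) (F : gT -> R) :
    G \subset 'N(A) -> {in G, forall u g, phi (g ^ u)%g = (phi g ^ u)%g} ->
    {in G, forall u g, F (g ^ u)%g = F g} -> {in A, forall g, phi g \in a ^: G} ->
  \sum_(g in A) F g = (\sum_(g in A | phi g == a) F g) *+ #|a ^: G|.
Proof.
move=> nAG phiJ FJ phiA; rewrite (partition_big phi (mem (a ^: G))) //= -sumr_const.
apply: eq_bigr => _ /imsetP[u Gu ->]; rewrite (reindex_inj (conjg_inj u)) /=.
apply: eq_big => g; last by rewrite FJ.
by rewrite memJ_norm ?(subsetP nAG) // phiJ // (inj_eq (conjg_inj u)).
Qed.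

Lemma card_fibres (gT : finGroupType) (G : {group gT}) (A : {set gT})
    (a : gT) (phi : gT -> gT) :
    G \subset 'N(A) -> {in G, forall u g, phi (g ^ u)%g = (phi g ^ u)%g} ->
    {in A, forall g, phi g \in a ^: G} ->
  #|A| = (#|a ^: G| * #|[set g in A | phi g == a]|)%N.
Proof.
move=> nAG phiJ phiA; apply/eqP; rewrite -eqC_nat natrM mulr_natl -sumr_const.
by rewrite (sum_fibres (F := fun=> 1) nAG phiJ _ phiA) // -sum1dep_card natr_sum.
Qed.

End Fibres.

Lemma Q8_count (a b : nat) : (4 * b = a + a + b)%N -> (8 * a = 3 * (4 * b))%N.
Proof. lia. Qed.

Section NegativeCentral.
Local Open Scope ring_scope.

(** Otherwise [x] acts as -1, so [G], generated by conjugates of [x], acts by the scalars 1 and -1,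
    and the square [x] of [y] acts as 1. *)
Lemma irr_neg_gen_class (gT : finGroupType) (G : {group gT}) (x y : gT) (i : Iirr G) :
  x \in G -> <<x ^: G>> = G -> y \in G -> (y * y)%g = x -> 'chi_i x != - 'chi_i 1%g.
Proof.
move=> Gx genG Gy yy; have [rG irrG chiE] := irr_reprP (mem_irr i).
have n1 : 'chi_i 1%g = (rdegree rG)%:R by rewrite chiE cfRepr1.
apply/eqP=> chix.
have chixn : `|cfRepr rG x| = cfRepr rG 1%g.
  by rewrite -chiE chix normrN n1 normr_nat.
have [c _ rGx] := max_cfRepr_norm_scalar Gx chixn.
have n_neq0 : (rdegree rG)%:R != 0 :> algC by rewrite -n1 irr1_neq0.
have {c}rGx : rG x = - 1%:M.
  have trx : \tr (rG x) = - (rdegree rG)%:R by rewrite -n1 -chix chiE cfunE Gx.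
  rewrite rGx; have -> : c = -1.
    by apply: (mulIf n_neq0); rewrite mulN1r -trx rGx mxtrace_scalar mulr_natr.
  by rewrite raddfN.
pose H := [set g in G | (rG g == 1%:M) || (rG g == - 1%:M)].
have gH : group_set H.
  apply/group_setP; split=> [|g h]; first by rewrite inE group1 repr_mx1 eqxx.
  rewrite !inE => /andP[Gg Hg] /andP[Gh Hh]; rewrite groupM // repr_mxM //.
  case/orP: Hg => /eqP->; case/orP: Hh => /eqP->;
    by rewrite ?mulmxN ?mulNmx ?mulmx1 ?opprK eqxx ?orbT.
have sGH : G \subset Group gH.
  rewrite -{1}genG gen_subG; apply/subsetP=> _ /imsetP[u Gu ->].
  rewrite inE groupJ //= conjgE !repr_mxM ?groupM ?groupV // rGx.
  by rewrite mulNmx mul1mx mulmxN -repr_mxM ?groupV // mulVg repr_mx1 eqxx orbT.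
have := subsetP sGH y Gy; rewrite inE Gy /= => Hy.
have : rG x = 1%:M.
  rewrite -yy repr_mxM //; case/orP: Hy => /eqP->;
    by rewrite ?mulmxN ?mulNmx ?mulmx1 ?opprK.
move/(congr1 mxtrace); rewrite rGx raddfN /= mxtrace1 => /eqP.
by rewrite eq_sym -addr_eq0 -mulr2n mulrn_eq0 (negPf n_neq0).
Qed.

End NegativeCentral.

(** * Arithmetic of degrees and of central character values *)

Section OmegaArith.
Local Open Scope ring_scope.

(** Meant for [w] the central character value of the set of odd-order elements and [k] = |G : S|. A
    rational algebraic integer is an integer; with [n] even and [k] odd, 2 eps - m must be even, so
    m = 0, and then w (n / 2) is [k] up to sign. *)
Lemma even_degree_arith (w eps m : algC) (k n : nat) :
    w \in Aint -> w * n%:R = k%:R * (2%:R * eps - m) -> (0 < n)%N -> odd k -> ~~ odd n ->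
    eps = 1 \/ eps = -1 -> m \in [:: 0; 1; -1] ->
  exists z : int, [/\ m = 0, w = z%:~R, odd `|z|%N & odd n./2].
Proof.
move=> Aw wn n_gt0 odd_k even_n eps1 m1.
have [a Da am] : exists2 a : int, 2%:R * eps - m = a%:~R
    & odd `|a|%N || ((m == 0) && (`|a| == 2)%N).
  case: eps1 => ->; move: m1; rewrite !inE => /or3P[]/eqP->.
  - by exists 2%:Z; rewrite ?eqxx ?orbT // subr0 mulr1.
  - by exists 1; rewrite // mulr1; ring.
  - by exists 3%:Z; rewrite // mulr1; ring.
  - by exists (-2)%Z; rewrite ?eqxx ?orbT // subr0 mulrN1.
  - by exists (-3)%Z; rewrite // mulrN1; ring.
  by exists (-1)%Z; rewrite // mulrN1; ring.
have n_neq0 : n%:R != 0 :> algC by rewrite pnatr_eq0 -lt0n.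
have wE : w = k%:R * a%:~R / n%:R by rewrite -Da -wn mulfK.
have /intrP[z Dz] : w \in Num.int.
  by apply: Cint_rat_Aint => //; rewrite wE !rpredM ?rpredV ?rpred_nat ?rpred_int.
have absE : (`|z| * n = k * `|a|)%N.
  have: z * n%:Z = k%:Z * a.
    by apply: (@intr_inj algC); rewrite !rmorphM /= -Dz wn Da.
  by move/(congr1 absz); rewrite !abszM.
exists z; have even_a : ~~ odd `|a|%N.
  by move: (congr1 odd absE); rewrite !oddM (negPf even_n) andbF odd_k /= => <-.
rewrite (negPf even_a) /= in am; case/andP: am => /eqP-> /eqP a2.
have nE : n = (2 * n./2)%N.
  by rewrite -[LHS]odd_double_half (negPf even_n) mul2n.
have /eqP : (`|z| * n./2 * 2 = k * 2)%N by rewrite -mulnA (mulnC _ 2) -nE absE a2.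
rewrite eqn_pmul2r // => /eqP zk; move: odd_k; rewrite -zk oddM => /andP[oz on].
by split.
Qed.

End OmegaArith.

Lemma odd_absz_exists (z : int) : odd `|z|%N -> exists q : int, z = (2 * q + 1)%R.
Proof.
case: z => n /=; rewrite ?absz_nat => odd_n.
  exists (Posz n./2); rewrite -[in LHS](odd_double_half n) odd_n -mul2n; lia.
have even_n : ~~ odd n by [].
exists (- (Posz n./2) - 1)%R; rewrite NegzE -[in LHS](odd_double_half n) (negPf even_n) -mul2n.
lia.
Qed.

Lemma Aint_odd_mul (z : int) (a : algC) : odd `|z|%N -> a \in Aint ->
  (z%:~R * a == 0 %[mod 2%:R])%A%R -> exists2 b, b \in Aint & (a = 2%:R * b)%R.
Proof.
case/odd_absz_exists=> q -> Aa; rewrite eqAmod0 unfold_in pnatr_eq0 /= => Ab.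
exists (((2 * q + 1)%:~R * a) / 2%:R - q%:~R * a)%R.
  by rewrite rpredB // rpredM ?Aint_int ?rpred_int.
by rewrite rmorphD rmorphM /=; field.
Qed.

Lemma dvdn_div_Aint (d n : nat) : (0 < d)%N -> (n%:R / d%:R \in Aint)%R -> (d %| n)%N.
Proof.
move=> d_gt0 And; have d_neq0 : (d%:R != 0 :> algC)%R by rewrite pnatr_eq0 -lt0n.
have /intrP[z Dz] : ((n%:R : algC) / d%:R \in Num.int)%R.
  by apply: Cint_rat_Aint => //; rewrite rpredM ?rpredV ?rpred_nat.
apply/dvdnP; exists `|z|%N; have: (Posz n = z * Posz d)%R.
  by apply: (@intr_inj algC); rewrite rmorphM /= -Dz divfK.
by move/(congr1 absz); rewrite abszM.
Qed.

Lemma double_eq4 (n a e : nat) : (2 * n = 8 * a + 4 * e)%N -> n = (4 * a + 2 * e)%N.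
Proof. lia. Qed.

Lemma int_sqr_le3 (z : int) : (z ^+ 2 <= 3%:R)%R -> z \in [:: 0; 1; -1]%R.
Proof.
case: z => [[|[|n]]|[|n]] //= le3; exfalso; move: le3; rewrite ?NegzE expr2; nia.
Qed.

Section ConeArith.
Local Open Scope ring_scope.
Variable F : numFieldType.
Implicit Types n v : F.

(* n_i and v_i stand for 'chi_i 1 and 'chi_i 1 + 'chi_i x, where chi_1, chi_2,
   chi_3 are the constituents of a virtual character of norm 3. *)
Lemma cone_one_plus n1 n2 n3 v1 v2 v3 :
    0 < n2 -> 0 < n3 -> 0 < v2 -> 0 < v3 ->
    n1 = 2%:R + n2 + n3 -> v1 = v2 + v3 -> v1 ^+ 2 / n1 = v2 ^+ 2 / n2 + v3 ^+ 2 / n3 ->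
  False.
Proof.
move=> n2p n3p v2p v3p -> -> eqv.
have n2z := lt0r_neq0 n2p; have n3z := lt0r_neq0 n3p.
have n1z : 2%:R + n2 + n3 != 0 by rewrite lt0r_neq0 // !addr_gt0 // ltr0n.
(* Cauchy-Schwarz gives (v2 + v3)^2 / (n2 + n3) <= v2^2 / n2 + v3^2 / n3, and the extra 2 in the
   denominator makes the inequality strict. *)
have : (v2 * n3 - v3 * n2) ^+ 2 + 2%:R * (v2 ^+ 2 * n3 + v3 ^+ 2 * n2) =
       n2 * n3 * (2%:R + n2 + n3) *
         (v2 ^+ 2 / n2 + v3 ^+ 2 / n3 - (v2 + v3) ^+ 2 / (2%:R + n2 + n3)).
  by field; rewrite n1z n2z n3z.
rewrite eqv subrr mulr0 => /eqP; rewrite gt_eqF //.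
apply: ltr_wpDl; last by rewrite !(mulr_gt0, addr_gt0, exprn_gt0) ?ltr0n.
rewrite -real_normK ?exprn_ge0 //.
by rewrite realB // realM // ger0_real // ltW.
Qed.

(** With v3 = 2 v1 the last equation forces n3 = 2 n1, against a difference of 2. *)
Lemma cone_equal n1 n3 v1 v3 : 0 < n1 -> 0 < n3 -> 0 < v1 ->
  n1 + n1 - n3 = 2%:R -> v1 + v1 - v3 = 0 -> v1 ^+ 2 / n1 + v1 ^+ 2 / n1 - v3 ^+ 2 / n3 = 0 ->
  False.
Proof.
move=> n1p n3p v1p e1 /eqP; rewrite subr_eq0 => /eqP <- e3.
have n1z := lt0r_neq0 n1p; have n3z := lt0r_neq0 n3p.
have : v1 ^+ 2 * (n1 + n1 - n3) =
    - (n1 * n3) * (v1 ^+ 2 / n1 + v1 ^+ 2 / n1 - (v1 + v1) ^+ 2 / n3) / 2%:R.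
  by field; rewrite n1z n3z.
rewrite e3 mulr0 mul0r e1 => /eqP; rewrite mulf_eq0 pnatr_eq0 orbF.
by rewrite sqrf_eq0 gt_eqF.
Qed.

(** Three equal signs contradict the linear equation in the v's, and two minus signs fall under
    [cone_one_plus]. The last claim will exclude a pair of distinct complex conjugate
    constituents. *)
Lemma cone_arith (b1 b2 b3 : bool) n1 n2 n3 v1 v2 v3 :
    0 < n1 -> 0 < n2 -> 0 < n3 -> 0 < v1 -> 0 < v2 -> 0 < v3 ->
    (-1) ^+ b1 * n1 + (-1) ^+ b2 * n2 + (-1) ^+ b3 * n3 = 2%:R ->
    (-1) ^+ b1 * v1 + (-1) ^+ b2 * v2 + (-1) ^+ b3 * v3 = 0 ->
    (-1) ^+ b1 * (v1 ^+ 2 / n1) + (-1) ^+ b2 * (v2 ^+ 2 / n2)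
      + (-1) ^+ b3 * (v3 ^+ 2 / n3) = 0 ->
  (b1 + b2 + b3 = 1)%N /\ (b1 = b2 -> n1 = n2 -> v1 = v2 -> False).
Proof.
move=> n1p n2p n3p v1p v2p v3p e1 e2 e3.
have bs : (b1 + b2 + b3 = 1)%N.
  case: b1 b2 b3 e1 e2 e3 => [] [] [] //=; rewrite ?mul1r ?mulN1r => e1 e2 e3; exfalso.
  - have : v1 + v2 + v3 = 0 by apply: oppr_inj; rewrite oppr0 -e2; ring.
    by move/eqP; rewrite gt_eqF // !addr_gt0.
  - apply: (@cone_one_plus n3 n1 n2 v3 v1 v2) => //.
    + by rewrite -e1; ring.
    + by apply/eqP; rewrite -subr_eq0 -e2; apply/eqP; ring.
    by apply/eqP; rewrite -subr_eq0 -e3; apply/eqP; ring.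
  - apply: (@cone_one_plus n2 n1 n3 v2 v1 v3) => //.
    + by rewrite -e1; ring.
    + by apply/eqP; rewrite -subr_eq0 -e2; apply/eqP; ring.
    by apply/eqP; rewrite -subr_eq0 -e3; apply/eqP; ring.
  - apply: (@cone_one_plus n1 n2 n3 v1 v2 v3) => //.
    + by rewrite -e1; ring.
    + by apply/eqP; rewrite -subr_eq0 -e2; apply/eqP; ring.
    by apply/eqP; rewrite -subr_eq0 -e3; apply/eqP; ring.
  by move/eqP: e2; rewrite gt_eqF // !addr_gt0.
split=> // b12 n12 v12; case: b1 b2 b3 bs b12 e1 e2 e3 => [] [] [] // _ _.
rewrite -n12 -v12 !mul1r !mulN1r; exact: cone_equal.
Qed.

End ConeArith.

Lemma parity_signs (b1 b2 b3 : bool) (n1 n2 n3 : nat) : (b1 + b2 + b3 = 1)%N ->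
    ((-1) ^+ b1 * n1%:R + (-1) ^+ b2 * n2%:R + (-1) ^+ b3 * n3%:R = 2%:R :> algC)%R ->
  ((-1) ^+ b1 * (-1) ^+ (~~ odd n1) + (-1) ^+ b2 * (-1) ^+ (~~ odd n2)
     + (-1) ^+ b3 * (-1) ^+ (~~ odd n3) = 1 :> algC)%R -> False.
Proof.
move=> bs e1.
have : ~~ odd (n1 + n2 + n3).
  have : (n1%:R + n2%:R + n3%:R
    = 2%:R + ((b1 * n1).*2 + (b2 * n2).*2 + (b3 * n3).*2)%:R :> algC)%R.
    rewrite -e1 -!muln2 !natrD !natrM.
    by case: b1 {e1 bs} => //=; case: b2 => //=; case: b3 => //=; ring.
  rewrite -!natrD => /eqP; rewrite eqC_nat => /eqP->.
  by rewrite !oddD !odd_double.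
rewrite !oddD => par e.
have {}e : ((-1) ^+ b1 * (-1) ^+ (~~ odd n1) + (-1) ^+ b2 * (-1) ^+ (~~ odd n2)
     + (-1) ^+ b3 * (-1) ^+ (~~ odd n3) = 1 :> int)%R.
  apply: (@intr_inj algC); rewrite !rmorphD !rmorphM /= !rmorph_sign rmorph1 -[RHS]e.
  by [].
case: b1 b2 b3 (odd n1) (odd n2) (odd n3) bs par e {e1} => [] [] [] [] [] [] //.
Qed.

Lemma commute_constt (gT : finGroupType) (g h : gT) pi : commute g h -> commute g h.`_pi.
Proof. exact: commuteX. Qed.

Lemma odd_commute_invol_eq (gT : finGroupType) (k l : gT) :
  k * k = 1 -> l * l = 1 -> commute k l -> odd #[k * l] -> k = l.
Proof.
move=> kk ll ckl; have : (k * l) ^+ 2 = 1.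
  by rewrite expgMn // !expgS !expg0 !mulg1 kk ll mulg1.
move/eqP; rewrite -order_dvdn => /dvdn_leq le2 odd_kl.
have : #[k * l] == 1%N by case: #[_] (le2 isT) odd_kl => [|[|[|]]].
by rewrite order_eq1 => /eqP kl1; rewrite -[k]mulg1 -ll mulgA kl1 mul1g.
Qed.

Lemma lin_char_neq1 (gT : finGroupType) (A : {group gT}) (x : gT) :
  abelian A -> x != 1 -> exists2 lam : 'CF(A), lam \is a linear_char & (lam x != 1)%R.
Proof.
move=> abA ntx; have [i chi_x] : exists i, x \notin cfker ('chi[A]_i)%R.
  apply/existsP; apply: contraR ntx => /existsPn/= xker.
  have : x \in \bigcap_i cfker ('chi[A]_i)%R.
    by apply/bigcapP=> i _; have := xker i; rewrite negbK.
  by rewrite TI_cfker_irr inE.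
have lin_i := char_abelianP _ abA i; exists ('chi_i)%R => //.
by apply: contra chi_x => /eqP x1; rewrite cfkerEirr inE x1 lin_char1.
Qed.

Lemma lin_char_neg1 (gT : finGroupType) (A : {group gT}) (x : gT) :
    abelian A -> x \in A -> x * x = 1 -> x != 1 ->
  exists2 lam : 'CF(A), lam \is a linear_char & (lam x = -1)%R.
Proof.
move=> abA Ax xx /(lin_char_neq1 abA)[lam lin_lam lam_x]; exists lam => //.
have : (lam x ^+ 2 == 1)%R by rewrite expr2 -lin_charM // xx lin_char1.
by rewrite sqrf_eq1 (negPf lam_x) => /eqP.
Qed.

(** * 2-sections of [G] when all elements of order 4 of [S] are conjugate *)

Section Q8.
Variables (gT : finGroupType) (G S : {group gT}) (x y t : gT).
Hypotheses (sylS : 2.-Sylow(G) S) (oS : #|S| = 8) (Sy : y \in S) (St : t \in S).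
Hypotheses (yy : y * y = x) (tt : t * t = x) (xx : x * x = 1) (ntx : x != 1).
Hypotheses (yty : y * t * y = t) (ZS : 'Z(S) \subset <[x]>).
Hypothesis Selt : {in S, forall s, [|| s == 1, s == x | s \in y ^: G]}.
Hypothesis genG : <<x ^: G>> = G.
Hypothesis oddK : {in x ^: G &, forall k l, odd #[k * l]}.

Let sSG : S \subset G := pHall_sub sylS.
Let Gy : y \in G := subsetP sSG y Sy.
Let Gt : t \in G := subsetP sSG t St.
Let Gx : x \in G. Proof. by rewrite -yy groupM. Qed.
Let O := [set g in G | g.`_2 == 1].
Let X := [set g in G | g.`_2 \in x ^: G].
Let Y := [set g in G | g.`_2 \in y ^: G].

Let inX g : (g \in X) = (g \in G) && (g.`_2 \in x ^: G). Proof. by rewrite inE. Qed.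
Let inY g : (g \in Y) = (g \in G) && (g.`_2 \in y ^: G). Proof. by rewrite inE. Qed.
Let inO g : (g \in O) = (g \in G) && (g.`_2 == 1). Proof. by rewrite inE. Qed.

Let nsecG (B : {set gT}) : G \subset 'N(B) -> [set g in G | g.`_2 \in B] <| G.
Proof.
move=> nBG; apply/andP; split; first by apply/subsetP=> g; rewrite inE => /andP[].
apply/subsetP=> u Gu; rewrite inE; apply/subsetP=> _ /imsetP[g + ->]; rewrite !inE.
by rewrite consttJ => /andP[Gg Bg]; rewrite groupJ ?memJ_norm ?(subsetP nBG).
Qed.
Let nsXG : X <| G. Proof. exact/nsecG/class_norm. Qed.
Let nsYG : Y <| G. Proof. exact/nsecG/class_norm. Qed.
Let nsOG : O <| G.
Proof.
rewrite (_ : O = [set g in G | g.`_2 \in [set 1]]) ?nsecG ?norms1 //.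
by apply/setP=> g; rewrite !inE.
Qed.

Let xxJ k : k \in x ^: G -> k * k = 1.
Proof. by case/imsetP=> u _ ->; rewrite -conjMg xx conj1g. Qed.
Let yyJ a : a \in y ^: G -> a * a \in x ^: G.
Proof. by case/imsetP=> u Gu ->; rewrite -conjMg yy imset_f. Qed.
Let x_neq1 k : k \in x ^: G -> k != 1.
Proof. by case/imsetP=> u _ ->; rewrite conjg_eq1. Qed.
Let xyD k : k \in x ^: G -> (k \in y ^: G) = false.
Proof.
by move=> Kk; apply: contraFF (negPf (x_neq1 Kk)) => /yyJ; rewrite xxJ // => /x_neq1/eqP.
Qed.

Let GE g : g \in G -> [|| g \in O, g \in X | g \in Y].
Proof.
move=> Gg; rewrite !inE Gg /=.
have pg : 2.-group <[g.`_2]> by rewrite /pgroup -orderE; exact: p_elt_constt.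
have sgG : <[g.`_2]> \subset G by rewrite cycle_subG groupX.
have [u Gu] := Sylow_Jsub sylS sgG pg; rewrite -cycleJ cycle_subG => /Selt.
rewrite conjg_eq1 -!(memJ_norm g.`_2 (subsetP (class_norm _ _) u Gu)).
by case/or3P=> [->|/eqP->|->]; rewrite ?class_refl ?orbT.
Qed.

Let comK k l : k \in x ^: G -> l \in x ^: G -> commute k l -> k = l.
Proof. by move=> Kk Kl ckl; apply: odd_commute_invol_eq; rewrite ?xxJ ?oddK. Qed.

Let cardOXY (A : {set gT}) : A \subset G -> #|A| = (#|A :&: O| + #|A :&: X| + #|A :&: Y|)%N.
Proof.
move=> sAG; have E (B : {set gT}) : #|B| = \sum_g (g \in B).
  by rewrite -sum1_card big_mkcond; apply: eq_bigr => g _; case: (g \in B).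
rewrite !E -!big_split /=; apply: eq_bigr => g _.
rewrite !inE; have [Ag|//] := boolP (g \in A); have Gg := subsetP sAG g Ag.
have := GE Gg; rewrite !inE Gg /= => /or3P[/eqP->|Xg|Yg].
- rewrite eqxx; have [/x_neq1/eqP//|_] := boolP (1 \in x ^: G).
  by have [/yyJ/x_neq1|//] := boolP (1 \in y ^: G); rewrite mulg1 eqxx.
- by rewrite Xg (negPf (x_neq1 Xg)) xyD.
rewrite Yg; have [/xyD|_] := boolP (_ \in x ^: G); first by rewrite Yg.
by have [g1|//] := eqVneq; have /x_neq1 := yyJ Yg; rewrite g1 mulg1 eqxx.
Qed.

(** In C_G(x), multiplication by [x] exchanges [O] and [X], as distinct elements of the class of [x]
    never commute. [X] and [Y] fibre over this class through the 2-part and its square, with fibres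
    inside C_G(x), so |G| = 2|X| + |Y|; on the other hand |G| = |O| + |X| + |Y|. *)
Let cardOX : #|O| = #|X|.
Proof.
have constJ : {in G, forall u g, (g ^ u).`_2 = g.`_2 ^ u} by move=> u Gu g; rewrite consttJ.
have cX : #|X| = (#|x ^: G| * #|'C_G[x] :&: X|)%N.
  rewrite (card_fibres (a := x) (normal_norm nsXG) constJ) => [|g]; last by rewrite inE => /andP[].
  congr (_ * _)%N; apply: eq_card => g.
  rewrite in_set !in_setI ?inX ?inY; case Gg: (g \in G) => //=.
  apply/andP/andP=> [[Xg /eqP g2] | [/cent1P/commute_sym cg Xg]].
    by split=> //; rewrite -{1}g2; apply/cent1P/commute_constt.
  by split=> //; apply/eqP/comK; rewrite ?class_refl //; apply/commute_sym/commute_constt.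
have cY : #|Y| = (#|x ^: G| * #|'C_G[x] :&: Y|)%N.
  rewrite (card_fibres (a := x) (phi := fun g => g.`_2 * g.`_2) (normal_norm nsYG)).
  - congr (_ * _)%N; apply: eq_card => g.
    rewrite in_set !in_setI ?inX ?inY; case Gg: (g \in G) => //=.
    apply/andP/andP=> [[Yg /eqP g2] | [/cent1P/commute_sym cg Yg]].
      by split=> //; rewrite -{1}g2; apply/cent1P/commuteM; apply/commute_constt.
    split=> //; apply/eqP/comK; rewrite ?class_refl ?yyJ //.
    by apply/commute_sym/commuteM; apply/commute_constt.
  - by move=> u Gu g; rewrite consttJ conjMg.
  by move=> g; rewrite inE => /andP[_ /yyJ].
have cC : #|'C_G[x] :&: O| = #|'C_G[x] :&: X|.
  have px : 2.-elt x by rewrite -yy (mem_p_elt (pHall_pgroup sylS)) ?groupM.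
  have gx h : h \in 'C[x] -> (x * h).`_2 = x * h.`_2.
    move=> /cent1P/commute_sym cxh; rewrite consttM // (constt_p_elt px) //.
  rewrite -(card_imset _ (mulgI x)); apply: eq_card => g; rewrite in_setI inX.
  apply/imsetP/andP=> [[h + ->] | [/setIP[Gg Cg] /andP[_ Xg]]].
    rewrite !in_setI inO => /and3P[/andP[Gh Ch] _ /eqP h1].
    by rewrite !groupM ?cent1id ?gx ?h1 ?mulg1 ?class_refl.
  exists (x * g); last by rewrite mulgA xx mul1g.
  rewrite !in_setI inO !groupM ?cent1id ?gx // -eq_invg_mul.
  rewrite (comK Xg (class_refl _ _)) ?eq_invg_mul ?xx ?eqxx //.
  by apply/commute_sym/commute_constt/commute_sym/cent1P.
apply/eqP; rewrite -(eqn_add2r (#|X| + #|Y|)) addnA.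
have := cardOXY (subxx G); rewrite !(setIidPr _) ?normal_sub // => <-.
have := cardOXY (subsetIl G 'C[x]); rewrite cC => cCE.
rewrite -(Lagrange (subsetIl G 'C[x])) cCE index_cent1 addnA {1 2}cX cY -!mulnDr mulnC.
by [].
Qed.

Let oy : #[y] = 4.
Proof.
apply: (@orderXprime _ 2 2); rewrite ?expgS ?expg0 ?mulg1 ?yy //.
by apply: nt_prime_order; rewrite ?expgS ?expg0 ?mulg1.
Qed.
Let yS : 2.-group S := pHall_pgroup sylS.

(** A larger 2-subgroup would be conjugate to [S] and put an element of order 4 in its center. *)
Let sylCy : 2.-Sylow('C_G[y]) <[y]>.
Proof.
have pY : 2.-group <[y]> by rewrite (pgroupS _ yS) ?cycle_subG.
have sYC : <[y]> \subset 'C_G[y] by rewrite cycle_subG inE Gy cent1id.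
have [T sylT sYT] := Sylow_superset sYC pY.
suff -> : <[y]> = T by [].
have [sTC pT _] := and3P sylT; have sTG := subset_trans sTC (subsetIl _ _).
apply/eqP; rewrite eqEcard sYT -orderE oy /=.
have [u Gu sTuS] := Sylow_Jsub sylS sTG pT.
have : #|T| %| (2 ^ 3)%N by rewrite -[(2 ^ 3)%N]/8 -oS -(cardJg _ u) cardSg.
case/(dvdn_pfactor _ 3 (isT : prime 2)) => [[|[|[|[|]]]]] // _ oT; rewrite oT //.
have eTuS : T :^ u = S by apply/eqP; rewrite eqEcard sTuS cardJg oT oS.
have : y ^ u \in 'Z(S).
  apply/centerP; rewrite -eTuS memJ_conjg -cycle_subG; split=> // _ /imsetP[v Tv ->].
  rewrite /commute -!conjMg; congr (_ ^ u).
  by have /setIP[_ /cent1P] := subsetP sTC v Tv => /commute_sym.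
move=> /(subsetP ZS)/cycleP[i yu].
have : y ^ u * y ^ u != 1 by rewrite -conjMg yy conjg_eq1.
by rewrite yu -expgMn // xx expg1n eqxx.
Qed.

Let Oy := 'O_2^'('C_G[y]).
Let defCy : Oy ><| <[y]> = 'C_G[y].
Proof. by rewrite cyclic_Sylow2_sdprod ?cycle_cyclic. Qed.

Let OyE : Oy = 'C_G[y] :&: O.
Proof.
have /sdprod_context[nsO _ _ _ _] := defCy.
have hallO : 2^'.-Hall('C_G[y]) Oy by apply/(sdprod_p'core_HallP sylCy).
apply/setP=> g; rewrite in_setI inO; have [Cg|] := boolP (g \in 'C_G[y]); last first.
  by apply: contraNF => /(subsetP (normal_sub nsO)).
have Gg := subsetP (subsetIl G _) g Cg.
rewrite (mem_normal_Hall hallO nsO Cg) Gg /=; apply/idP/eqP => [/constt1P-> // | g1].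
by apply/constt1P.
Qed.
Let YyE g : (g \in Y) && (g.`_2 == y) = (y^-1 * g \in Oy).
Proof.
have py : 2.-elt y by rewrite (mem_p_elt yS).
have yg h : commute y h -> (y^-1 * h).`_2 = y^-1 * h.`_2.
  by move=> cyh; rewrite consttM ?consttV ?(constt_p_elt py) //; apply/commute_sym/commuteV.
rewrite OyE !in_setI inO inY.
apply/andP/and3P=> [[/andP[Gg Yg] /eqP g2]|].
  have cyg : commute y g by apply/commute_sym; rewrite -g2; apply: commute_constt.
  have Cg : g \in 'C[y] by apply/cent1P.
  by rewrite !groupM ?groupV ?cent1id //= ?yg ?g2 ?mulVg //; apply/commute_sym.
case=> [/andP[Gyg Cyg] _]; have Gg : g \in G by rewrite groupMl ?groupV in Gyg.
have cyg : commute y g.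
  by rewrite groupMl ?groupV ?cent1id // in Cyg; apply/commute_sym/cent1P.
by rewrite yg // -eq_mulVg1 Gg => /eqP<-; rewrite class_refl eqxx.
Qed.

Let sumY (R : nmodType) (F : gT -> R) : {in G, forall u g, F (g ^ u) = F g} ->
  (\sum_(g in Y) F g = (\sum_(h in Oy) F (y * h)%g) *+ #|y ^: G|)%R.
Proof.
move=> FJ; rewrite (@sum_fibres R gT G Y y (fun g => g.`_2)) ?normal_norm //; first 1 last.
- by move=> u Gu g; rewrite consttJ.
- by move=> g; rewrite inY => /andP[].
congr (_ *+ _)%R; rewrite (reindex_inj (mulgI y)) /=; apply: eq_bigl => h.
by rewrite YyE mulKg.
Qed.

(** The elements with 2-part [y] form the coset [y * Oy], and [Oy] has index 4 in the centralizer of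
    [y]. *)
Let cardY : #|G| = (4 * #|Y|)%N.
Proof.
have := @sumY algC (fun=> 1%R); rewrite !sumr_const -mulrnA => /(_ _)/eqP.
rewrite eqC_nat => /(_ _)/eqP-> //; rewrite -(Lagrange (subsetIl G 'C[y])) index_cent1.
by rewrite /= -(sdprod_card defCy) -[#|<[y]>|]/#[y] oy mulnAC mulnC.
Qed.

Local Open Scope ring_scope.

(* The extensions to G, constant on 2-sections, of the irreducible character of
   degree 2 of S and of 4 - 'Ind[S, <[x]>] 1. *)
Let g2 : 'CF(G) := 2%:R *: '1_O - 2%:R *: '1_X.
Let Th : 'CF(G) := 4%:R *: '1_Y.

Let g2E g : g2 g = 2%:R * (g \in O)%:R - 2%:R * (g \in X)%:R.
Proof. by rewrite !cfunE !cfuniE. Qed.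
Let ThE g : Th g = 4%:R * (g \in Y)%:R.
Proof. by rewrite !cfunE !cfuniE. Qed.

Let SE s : s \in S -> [|| s == 1%g, s == x | (s * s == x)%g && (s \in y ^: G)].
Proof.
move=> Ss; have /or3P[-> // | -> | ys] := Selt Ss; rewrite ?orbT // ys andbT.
have Kss := yyJ ys; have Sss : (s * s)%g \in S by rewrite groupM.
have /or3P[|-> |] := Selt Sss; rewrite ?orbT //; first by move/eqP=> ss; have /eqP := x_neq1 Kss.
by rewrite (xyD Kss).
Qed.

Let constt2S s : s \in S -> constt s 2 = s.
Proof. by move=> Ss; rewrite constt_p_elt // (mem_p_elt yS). Qed.

Let g2S s : s \in S -> g2 s = 2%:R * (s == 1%g)%:R - 2%:R * (s == x)%:R.
Proof.
move=> Ss; rewrite g2E inO inX (subsetP sSG) // constt2S //=; congr (_ - _ * _).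
case/or3P: (SE Ss) => [/eqP->|/eqP->|/andP[/eqP ss ys]].
- by rewrite eq_sym (negPf ntx); have [/x_neq1/eqP|] := boolP (_ \in _).
- by rewrite eqxx class_refl.
have [/xyD|_] := boolP (_ \in _); first by rewrite ys.
by have [sx|//] := eqVneq s x; move: ntx; rewrite -ss sx xx eqxx.
Qed.

Let ThS s : s \in S -> Th s = 4%:R - 4%:R * (s == 1%g)%:R - 4%:R * (s == x)%:R.
Proof.
move=> Ss; rewrite ThE inY (subsetP sSG) // constt2S //=.
case/or3P: (SE Ss) => [/eqP->|/eqP->|/andP[/eqP ss ys]].
- rewrite eqxx eq_sym (negPf ntx); have [/yyJ/x_neq1|_] := boolP (_ \in _).
    by rewrite mulg1 eqxx.
  by rewrite mulr1 subrr mulr0 subr0.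
- by rewrite eqxx (negPf ntx) xyD ?class_refl // mulr0 subr0 mulr1 subrr.
have [s1|_] := eqVneq s 1%g; first by move: ntx; rewrite -ss s1 mulg1 eqxx.
have [sx|_] := eqVneq s x; first by move: ntx; rewrite -ss sx xx eqxx.
by rewrite ys mulr1 mulr0 !subr0.
Qed.

Let xZS : x \in 'Z(S).
Proof.
apply/centerP; split=> [|s Ss]; first by rewrite -yy groupM.
case/or3P: (SE Ss) => [/eqP->|/eqP->|/andP[/eqP <- _]] //; first exact: commute1.
by rewrite /commute mulgA.
Qed.

Let sec2 g : g \in G ->
  [/\ (g.`_2 \in O) = (g \in O), (g.`_2 \in X) = (g \in X)
    & (g.`_2 \in Y) = (g \in Y)]%g.
Proof. by move=> Gg; rewrite !inO !inX !inY !groupX // Gg /= constt_p_elt // p_elt_constt. Qed.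

Let x_y : x \in <[y]>%g. Proof. by rewrite -yy groupM ?cycle_id. Qed.
Let sYS : <[y]> \subset S. Proof. by rewrite cycle_subG. Qed.
Let nsYS : <[y]> <| S.
Proof. by rewrite index2_normal // -divgS // oS -[#|<[y]>|]/#[y]%g oy. Qed.

Let Zg2 : g2 \in 'Z[irr G].
Proof.
apply: (vchar_Sylow2 sylS) => [g Gg|]; first by rewrite !g2E; have [-> ->] := sec2 Gg.
have [lam lin_lam lamx] := lin_char_neg1 (cycle_abelian y) x_y xx ntx.
rewrite (_ : 'Res _ = 'Ind[S] lam) ?cfInd_vchar ?char_vchar ?lin_charW //.
apply/cfun_inP=> s Ss; rewrite cfResE // g2S // cfIndE //.
have lamE u : u \in S -> lam (x ^ u)%g = -1.
  by move=> Su; have /centerP[_ cx] := xZS; rewrite conjgE cx // mulKg.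
have c8 : (#|<[y]>%g|%:R : algC)^-1 * #|S|%:R = 2%:R.
  by rewrite oS -[#|_|]/#[y]%g oy (natrM _ 4 2) mulKf ?pnatr_eq0.
case/or3P: (SE Ss) => [/eqP->|/eqP->|/andP[/eqP ss ys]].
- under eq_bigr => u Su do rewrite conj1g lin_char1 //.
  by rewrite sumr_const c8 eqxx eq_sym (negPf ntx) mulr1 mulr0 subr0.
- under eq_bigr => u Su do rewrite lamE //.
  by rewrite sumr_const mulNrn mulrN c8 eqxx (negPf ntx) mulr0 sub0r mulr1.
have [s1|_] := eqVneq s 1%g; first by move: ntx; rewrite -ss s1 mulg1 eqxx.
have [sx|_] := eqVneq s x; first by move: ntx; rewrite -ss sx xx eqxx.
rewrite !mulr0 subr0 (_ : \sum_(u in S) _ = 0) ?mulr0 //.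
have [Ys|nYs] := boolP (s \in <[y]>%g); last first.
  rewrite big1 // => u Su; apply: cfun0.
  by rewrite memJ_norm // (subsetP (normal_norm nsYS)).
have yt : (y ^ t = y^-1)%g by apply: (mulgI t); rewrite mulgA mulgV mul1g -{2}yty mulgK.
have st : (s ^ t = s * x)%g.
  have /cycleP[i Ds] := Ys; rewrite Ds conjXg yt expgVn -Ds.
  by apply: (mulgI s); rewrite mulgV mulgA ss xx.
(* Replacing u by t u multiplies [s ^ u] by [x], where [lam] is -1, so the sum is its own
   opposite. *)
have /eqP : \sum_(u in S) lam (s ^ u)%g = - \sum_(u in S) lam (s ^ u)%g.
  rewrite {1}(reindex_inj (mulgI t)) -sumrN /=.
  apply: eq_big => [u | u Su]; first by rewrite groupMl.
  have {}Su : u \in S by rewrite groupMl in Su.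
  have Ysu : (s ^ u \in <[y]>)%g by rewrite memJ_norm // (subsetP (normal_norm nsYS)).
  rewrite conjgM st conjMg lin_charM ?lamE ?mulrN1 //.
  by rewrite memJ_norm // (subsetP (normal_norm nsYS)).
by rewrite -addr_eq0 -mulr2n mulrn_eq0 => /eqP.
Qed.

Let ZTh : Th \in 'Z[irr G].
Proof.
apply: (vchar_Sylow2 sylS) => [g Gg|]; first by rewrite !ThE; have [_ _ ->] := sec2 Gg.
have sXS : <[x]> \subset S by rewrite cycle_subG (subsetP (center_sub S)).
have nsXS : <[x]> <| S by rewrite sub_center_normal // cycle_subG.
rewrite (_ : 'Res _ = 4%:R - 'Ind[S, <[x]>] 1); last first.
  apply/cfun_inP=> s Ss; rewrite cfResE // ThS // cfInd_cfun1 // !cfunE.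
  have ox : #[x]%g = 2 by apply: nt_prime_order; rewrite ?expgS ?expg0 ?mulg1.
  have -> : #|S : <[x]>%G| = 4%N by rewrite -divgS // oS -[#|_|]/#[x]%g ox.
  rewrite cfuniE // cfun1E Ss /= cycle2g //.
  rewrite !inE; have [->|_] := eqVneq s 1%g; rewrite ?(eq_sym 1%g) ?(negPf ntx) //=.
    by ring.
  by case: (s == x) => /=; ring.
rewrite rpredB ?rpred_nat ?cfInd_vchar ?cfun1_vchar //.
Qed.

Let cXY : (#|G| = 4 * #|Y|)%N /\ (8 * #|X| = 3 * #|G|)%N.
Proof.
split; first exact: cardY; have := cardOXY (subxx G).
rewrite !(setIidPr _) ?normal_sub // cardOX cardY.
exact: Q8_count.
Qed.

Let ctO g : g \in O -> (g \in X = false) /\ (g \in Y = false).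
Proof.
rewrite inO inX inY => /andP[-> /eqP->] /=.
have [/x_neq1/eqP//|_] := boolP (_ \in _).
by have [/yyJ/x_neq1|//] := boolP (_ \in _); rewrite mulg1 eqxx.
Qed.
Let ctX g : g \in X -> (g \in O = false) /\ (g \in Y = false).
Proof.
by rewrite inO inX inY => /andP[-> Xg] /=; rewrite xyD // (negPf (x_neq1 Xg)).
Qed.
Let ctY g : g \in Y -> (g \in O = false) /\ (g \in X = false).
Proof.
move=> Yg; split; first by apply/negP=> /ctO[_]; rewrite Yg.
by apply/negP=> /ctX[_]; rewrite Yg.
Qed.

Let dotu (A : {set gT}) : A <| G ->
  '[('1_A : 'CF(G)), 1] = #|A|%:R / #|G|%:R /\ '[('1_A : 'CF(G))] = #|A|%:R / #|G|%:R.
Proof.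
move=> nsA; rewrite -(cfuniG G) !cfdot_cfuni ?normal_refl // setIid.
by rewrite (setIidPl (normal_sub nsA)).
Qed.
Let dot0 (A B : {set gT}) : A <| G -> B <| G ->
  (forall g, g \in A -> g \in B = false) -> '[('1_A : 'CF(G)), '1_B] = 0.
Proof.
move=> nsA nsB AB; rewrite cfdot_cfuni // disjoint_setI0 ?cards0 ?mul0r //.
by apply/pred0P=> g /=; apply/negP=> /andP[/AB->].
Qed.
Let rX : (#|X|%:R / #|G|%:R = 3%:R / 8%:R :> algC) /\ (#|Y|%:R / #|G|%:R = 1 / 4%:R :> algC).
Proof.
have [cY cX] := cXY; split; apply/eqP; rewrite eqr_div ?neq0CG ?pnatr_eq0 // -!natrM ?mul1r eqC_nat.
  by rewrite mulnC cX.
by rewrite mulnC -cY.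
Qed.

Let norms : [/\ '[g2] = 3%:R, '[g2, 1] = 0, '[Th, 1] = 1, '[Th] = 4%:R & '[Th, g2] = 0].
Proof.
have [aX aY] := rX; have cX := dotu nsXG; have cY := dotu nsYG; have cO := dotu nsOG.
rewrite cardOX in cO; rewrite aX in cX cO; rewrite aY in cY.
have dOX : '[('1_O : 'CF(G)), '1_X] = 0 by apply: dot0 => // g /ctO[].
have dXO : '[('1_X : 'CF(G)), '1_O] = 0 by apply: dot0 => // g /ctX[].
have dYO : '[('1_Y : 'CF(G)), '1_O] = 0 by apply: dot0 => // g /ctY[].
have dYX : '[('1_Y : 'CF(G)), '1_X] = 0 by apply: dot0 => // g /ctY[].
rewrite /g2 /Th !(cfdotBl, cfdotBr, cfdotZl, cfdotZr) dOX dXO dYO dYX.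
rewrite !(cX.1, cX.2, cY.1, cY.2, cO.1, cO.2) !conjC_nat; by split; field.
Qed.

Let oGk : #|G| = (8 * #|G : S|)%N /\ odd #|G : S|.
Proof.
rewrite -oS Lagrange //; split=> //; rewrite odd_2'nat.
by have /and3P[] := sylS.
Qed.

(** * Real constituents of [g2] and their Frobenius-Schur indicators *)

Section OneIrr.
Variable i : Iirr G.
Let chi := 'chi_i.
Variables (eps m : algC) (n : nat).
Hypotheses (real_chi : cfReal chi) (ntchi : '[chi, 1] = 0) (g2chi : '[g2, chi] = eps).
Hypotheses (eps1 : eps = 1 \/ eps = -1) (Thchi : '[Th, chi] = m) (m1 : m \in [:: 0; 1; -1]).
Hypothesis chi1 : chi 1%g = n%:R.

Let conj_chi g : (chi g)^* = chi g.
Proof. by move/eqP: real_chi => {2}<-; rewrite cfunE. Qed.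

Let sumO : \sum_(g in O) chi g = (#|G|%:R / 8%:R) * (2%:R * eps - m).
Proof.
have -> : \sum_(g in O) chi g = #|G|%:R * '['1_O, chi].
  rewrite cfdotE mulVKf ?neq0CG // big_mkcond [RHS]big_mkcond /=; apply: eq_bigr => g _.
  rewrite inO; have [Gg|//] := boolP (g \in G); rewrite cfuniE // inO Gg /= conj_chi.
  by case: (_ == _); rewrite ?mul1r ?mul0r.
have -> : '1_O = 8%:R^-1 *: (4%:R *: 1 - Th + 2%:R *: g2).
  apply/cfun_inP=> g Gg; rewrite !cfunE cfun1E Gg !cfuniE //.
  case/or3P: (GE Gg) => [Og|Xg|Yg].
  - by have [-> ->] := ctO Og; rewrite Og /=; field.
  - by have [-> ->] := ctX Xg; rewrite Xg /=; field.
  by have [-> ->] := ctY Yg; rewrite Yg /=; field.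
rewrite cfdotZl cfdotDl cfdotBl Thchi (cfdotZl chi _ g2) g2chi.
rewrite (cfdotZl chi _ 1) (cfdotC 1) ntchi conjC0.
by field.
Qed.

Let sumYchi : m = 0 -> \sum_(h in Oy) chi (y * h)%g = 0.
Proof.
move=> m0; have : '[Th, chi] = 0 by rewrite Thchi.
rewrite cfdotE; move/eqP; rewrite mulf_eq0 invr_eq0 (negPf (neq0CG G)) /= => /eqP Ysum.
have : \sum_(g in Y) chi g = 0.
  have n4 : (4%:R : algC) != 0 by rewrite pnatr_eq0.
  apply: (mulfI n4); rewrite mulr0 -[RHS]Ysum mulr_sumr.
  rewrite big_mkcond [RHS]big_mkcond /=; apply: eq_bigr => g _; rewrite ThE.
  have [Gg|nGg] := boolP (g \in G); last by rewrite inY (negPf nGg).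
  by rewrite conj_chi; case: (g \in Y); rewrite ?mulr1 ?mulr0 ?mul0r.
rewrite sumY; last by move=> u Gu g; rewrite cfunJ.
by move/eqP; rewrite mulrn_eq0 -index_cent1 eqn0Ngt indexg_gt0 /= => /eqP.
Qed.

Let omega_odd : ~~ odd n -> exists z : int,
  [/\ m = 0, (\sum_(g in O) chi g) / chi 1%g = z%:~R, odd `|z|%N & odd n./2].
Proof.
have [oG odd_k] := oGk.
have n_neq0 : n%:R != 0 :> algC by rewrite -chi1 irr1_neq0.
move=> even_n; apply: (@even_degree_arith _ eps m #|G : S| n) => //.
- exact: Aint_sum_class_div_irr1 (normal_sub nsOG) (normal_norm nsOG).
- by rewrite chi1 divfK // sumO oG natrM [8%:R * _]mulrC mulfK ?pnatr_eq0.
by rewrite lt0n; apply: contraNneq n_neq0 => ->.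
Qed.

(* Modulo 2, the sum of chi (y * h * g) over g in O only sees the g fixed by y,
   where it vanishes by sumYchi. On the other hand it is chi (y * h) times the
   odd integer of omega_odd. *)
Let Ochi_mod2 h : ~~ odd n -> h \in Oy -> exists2 al, al \in Aint & chi (y * h)%g = 2%:R * al.
Proof.
move=> even_n Oyh; have [z [m0 Dz odd_z _]] := omega_odd even_n.
have := Oyh; rewrite OyE => /setIP[/setIP[Gh /cent1P cyh] Oh].
set a := (y * h)%g; have Ga : a \in G by rewrite groupM.
have cya : commute y a by rewrite /a; apply: commuteM => //; apply: commute_sym.
have cxa : commute x a by rewrite -yy; apply/commute_sym/commuteM; apply: commute_sym.
have Achi g : chi g \in Aint by apply: Aint_irr.
have nO u g : u \in G -> g \in O -> (g ^ u)%g \in O.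
  by move=> Gu Og; rewrite memJ_norm // (subsetP (normal_norm nsOG)).
have sumE := sum_irrM_class i Ga (normal_sub nsOG) (normal_norm nsOG).
have Fxy u g : u \in G -> commute u a -> chi (a * g ^ u)%g = chi (a * g)%g.
  move=> Gu cua; have au : (a ^ u)%g = a by rewrite conjgE -cua mulKg.
  by rewrite -{1}au -conjMg cfunJ.
(* Since [y] has order 4, the pairing is done in two stages: by the involution [x], then by [y] on
   the fixed points of [x], where it acts with order at most 2. *)
have mod1 : (\sum_(g in O) chi (a * g)%g ==
      \sum_(g in O | (g ^ x)%g == g) chi (a * g)%g %[mod 2%:R])%A.
  apply: sum_invol_mod2 => [g Og|g Og|g Og|//]; rewrite ?nO ?Fxy //.
  by rewrite -conjgM xx conjg1.
pose O1 := [set g in O | (g ^ x)%g == g].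
have mod2 : (\sum_(g in O1) chi (a * g)%g ==
      \sum_(g in O1 | (g ^ y)%g == g) chi (a * g)%g %[mod 2%:R])%A.
  apply: sum_invol_mod2 => [g|g|g|//]; rewrite inE => /andP[Og /eqP gx]; rewrite ?Fxy //.
    by rewrite inE nO //= -conjgM -{1}yy mulgA yy conjgM gx.
  by rewrite -conjgM yy.
have OyP g : (g \in O1) && (g ^ y == g)%g = (g \in Oy).
  have cgE u : (g ^ u == g)%g = (g \in 'C[u]%g).
    apply/eqP/cent1P; last by move=> cug; rewrite conjgE cug mulKg.
    by move=> gu; apply: (mulgI u^-1%g); rewrite -conjgE gu mulKg.
  rewrite inE OyE !cgE !in_setI; case Og: (g \in O); last by rewrite /= !andbF.
  rewrite (subsetP (normal_sub nsOG) g Og) /= andbT.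
  have [cgy|] := boolP (g \in 'C[y]%g); last by rewrite andbF.
  by rewrite andbT; apply/cent1P; rewrite -yy; apply: commuteM; apply/cent1P.
have sum_y : \sum_(g in O1 | (g ^ y)%g == g) chi (a * g)%g = 0.
  rewrite (eq_bigl _ _ OyP) -[RHS](sumYchi m0) (reindex_inj (mulgI h^-1%g)) /=.
  by apply: eq_big => [g | g _]; rewrite ?groupMl ?groupV // /a -!mulgA mulKVg.
have eO1 : \sum_(g in O1) chi (a * g)%g = \sum_(g in O | (g ^ x)%g == g) chi (a * g)%g.
  by apply: eq_bigl => g; rewrite inE.
rewrite -eO1 in mod1; have := eqAmod_trans mod1 mod2.
rewrite sum_y sumE Dz mulrC => /(Aint_odd_mul odd_z (Achi a)) [b Ab ->].
by exists b.
Qed.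

Let chi_nneg_sqr g : `|chi g| ^+ 2 = chi g * chi g.
Proof. by rewrite normCK conj_chi. Qed.

(* 4 (sum over Y of |chi|^2) / |G| is an integer less than 4, and a multiple of 4
   by Ochi_mod2. *)
Let chiY0 : ~~ odd n -> {in Y, forall g, chi g = 0}.
Proof.
move=> even_n; pose N := '[Th * chi, chi].
have FJ : {in G, forall u g, `|chi (g ^ u)%g| ^+ 2 = `|chi g| ^+ 2}.
  by move=> u Gu g; rewrite cfunJ.
have NE : #|G|%:R * N = 4%:R * \sum_(g in Y) `|chi g| ^+ 2.
  rewrite /N cfdotE mulVKf ?neq0CG // mulr_sumr big_mkcond [RHS]big_mkcond.
  apply: eq_bigr => g _ /=; rewrite cfunE ThE normCK.
  have [Gg|nGg] := boolP (g \in G); last by rewrite inY (negPf nGg).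
  by case: (g \in Y); rewrite ?mulr1 ?mulr0 ?mul0r ?mulrA.
have G_gt0 : 0 < #|G|%:R :> algC by rewrite ltr0n.
have sum_ge0 : 0 <= \sum_(g in Y) `|chi g| ^+ 2 by apply: sumr_ge0 => g _; rewrite exprn_ge0.
have ZN : N \in Num.nat.
  rewrite natrEint Cint_cfdot_vchar_irr ?mul_vchar ?irr_vchar //=.
  by rewrite -(pmulr_rge0 _ G_gt0) NE mulr_ge0 ?ler0n.
have [d Nd] := natrP ZN.
have ltd4 : (d < 4)%N.
  have : \sum_(g in G) `|chi g| ^+ 2 = #|G|%:R.
    have := cfnorm_irr i; rewrite cfdotE => /(congr1 ( *%R #|G|%:R)).
    rewrite mulVKf ?neq0CG // mulr1 => <-; apply: eq_bigr => g _.
    by rewrite normCK.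
  rewrite (big_setID Y) /= (setIidPr (normal_sub nsYG)) => sumG.
  have ltYG : \sum_(g in Y) `|chi g| ^+ 2 < #|G|%:R.
    rewrite -sumG ltrDl (big_setD1 1%g) /=; last first.
      by rewrite in_setD group1 andbT; apply/negP=> /ctY[]; rewrite inO group1 constt1 eqxx.
    rewrite ltr_pwDl ?sumr_ge0 // => [|g _]; last by rewrite exprn_ge0.
    by rewrite exprn_gt0 // normr_gt0 irr1_neq0.
  by rewrite -(ltr_nat algC) -Nd -(ltr_pM2l G_gt0) NE mulrC ltr_pM2r ?ltr0n.
have oddOy : odd #|Oy| by rewrite odd_2'nat -/(pgroup _ _) pcore_pgroup.
(* Fibring [Y] over the class of [y] turns [#|Oy| * N] into a sum of chi(y h)^2, each in 4 Aint; the
   oddness of |Oy| then leaves the factor 4 to [d]. *)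
have dvd4 : (4 %| #|Oy| * d)%N.
  apply: dvdn_div_Aint; rewrite // natrM -Nd.
  have -> : #|Oy|%:R * N = \sum_(h in Oy) `|chi (y * h)%g| ^+ 2.
    have c_neq0 : (4 * #|y ^: G|)%:R != 0 :> algC.
      by rewrite pnatr_eq0 muln_eq0 -index_cent1 -lt0n indexg_gt0.
    apply: (mulfI c_neq0); rewrite mulrA -natrM.
    have -> : (4 * #|y ^: G| * #|Oy| = #|G|)%N.
      rewrite -(Lagrange (subsetIl G 'C[y])) index_cent1 /= -(sdprod_card defCy).
      by rewrite -[#|<[y]>%g|]/#[y]%g oy mulnC mulnA mulnAC.
    by rewrite NE sumY // natrM -mulrA; congr (_ * _); rewrite mulr_natl.
  rewrite mulr_suml rpred_sum // => h Oyh.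
  have [al Aal chi_yh] := Ochi_mod2 even_n Oyh; rewrite chi_nneg_sqr chi_yh.
  rewrite (_ : _ / _ = al * al) ?rpredM //.
  by field.
have d0 : d = 0%N.
  move: dvd4; rewrite Gauss_dvdr; last by rewrite -[4%N]/(2 ^ 2)%N coprime_pexpl // coprime2n.
  by case: (d) ltd4 => [|[|[|[|]]]].
have Ysum0 : \sum_(g in Y) `|chi g| ^+ 2 = 0.
  apply: (mulfI (_ : 4%:R != 0)); first by rewrite pnatr_eq0.
  by rewrite -NE Nd d0 !mulr0.
move=> g Yg; apply/eqP; rewrite -normr_eq0 -sqrf_eq0; apply/eqP.
by apply: (psumr_eq0P _ Ysum0) => // h _; rewrite exprn_ge0.
Qed.

Let Y_S s : s \in S -> s != 1%g -> s != x -> s \in Y.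
Proof.
move=> Ss s1 sx; have := SE Ss; rewrite (negPf s1) (negPf sx) /= => /andP[_ ys].
by rewrite inY (subsetP sSG) // constt2S.
Qed.

Let sumS (A : {group gT}) (lam : 'CF(A)) : ~~ odd n -> x \in A -> A \subset S ->
  '['Res[A] chi, lam] = #|A|%:R^-1 * (chi 1%g * (lam 1%g)^* + chi x * (lam x)^*).
Proof.
move=> even_n Ax sAS; rewrite cfdotE; congr (_ * _); have sAG := subset_trans sAS sSG.
rewrite (big_setD1 1%g) ?group1 // (big_setD1 x) ?inE ?ntx //= !cfResE // addrA.
rewrite [X in _ + X]big1 ?addr0 // => s; rewrite !inE => /and3P[sx s1 As].
by rewrite cfResE // chiY0 ?mul0r // Y_S // (subsetP sAS).
Qed.

(** For even n, [chi] restricted to [S] lives on 1 and [x], so multiplicities in <y> and [S] give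
    chi(1) - chi(x) = 4e and chi(1) + chi(x) = 8a. Then n / 2 = 2a + e is odd, so [e] is odd and
    [Frobenius_Schur_Q8] applies. *)
Lemma FS_values : \sum_(g in G) chi (g * g)%g = (-1) ^+ (~~ odd n) * #|G|%:R.
Proof.
have [odd_n|even_n] := boolP (odd n).
  by rewrite mul1r (Frobenius_Schur_odd real_chi chi1).
have [_ [_ _ _ odd_n2]] := omega_odd even_n.
have [lam lin_lam lamx] := lin_char_neg1 (cycle_abelian y) x_y xx ntx.
have c1 : chi 1%g - chi x = 4%:R * '['Res[<[y]>] chi, lam].
  rewrite sumS // lamx (lin_char1 lin_lam) -[#|<[y]>%g|]/#[y]%g oy mulVKf ?pnatr_eq0 //.
  by rewrite rmorphN /= !conjC1 mulr1 mulrN1.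
have c2 : chi 1%g + chi x = 8%:R * '['Res[S] chi, 1].
  rewrite sumS //; last by rewrite (subsetP (center_sub S)).
  rewrite !cfun1E group1 (subsetP (center_sub S)) // oS mulVKf ?pnatr_eq0 //.
  by rewrite conjC1 !mulr1.
have /natrP[e De] : '['Res[<[y]>] chi, lam] \in Num.nat.
  by rewrite Cnat_cfdot_char ?cfRes_char ?irr_char ?lin_charW.
have /natrP[a Da] : '['Res[S] chi, 1] \in Num.nat.
  by rewrite Cnat_cfdot_char ?cfRes_char ?irr_char ?cfun1_char.
rewrite De in c1; rewrite Da in c2.
have nE : n = (4 * a + 2 * e)%N.
  apply: (double_eq4 (e := e)).
  apply/eqP; rewrite -(eqC_nat) natrD !natrM -c1 -c2 -chi1; apply/eqP; ring.
have odd_e : odd e.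
  have : odd ((4 * a + 2 * e)%N)./2 by rewrite -nE.
  rewrite (_ : (4 * a + 2 * e)%N = (2 * a + e).*2); last first.
    by rewrite -mul2n mulnDr mulnA.
  by rewrite doubleK oddD oddM.
have yV : (y^-1)%g \in Y.
  apply: Y_S; rewrite ?groupV // ?invg_eq1.
    by apply: contraNneq ntx => y1; rewrite -yy y1 mulg1.
  by apply: contraNneq ntx => y1; rewrite -yy -[y]invgK y1 -invMg xx invg1.
have yY : y \in Y.
  by rewrite inY Gy constt2S // class_refl.
rewrite mulN1r (Frobenius_Schur_Q8 real_chi (e := e) Gy Gt) ?yy ?tt //.
- exact: chiY0 yY.
- exact: chiY0 yV.
by rewrite c1 natrM.
Qed.

End OneIrr.

Let conj_g2 : (g2^*)%CF = g2.
Proof.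
apply/cfunP=> g; rewrite cfunE g2E rmorphB !rmorphM /= !conjC_nat.
by rewrite ?g2E.
Qed.

(** * Signs and reality of the three constituents of [g2] *)

Section Triple.
Variables (b1 b2 b3 : bool) (i1 i2 i3 : Iirr G).
Hypotheses (i12 : i1 != i2) (i13 : i1 != i3) (i23 : i2 != i3).
Hypothesis Dg2 : g2 = (-1) ^+ b1 *: 'chi_i1 + (-1) ^+ b2 *: 'chi_i2 + (-1) ^+ b3 *: 'chi_i3.

Let v (i : Iirr G) := 'chi_i 1%g + 'chi_i x.

Let conj_chix i : ('chi[G]_i x)^* = 'chi_i x.
Proof. by rewrite -irr_inv; congr ('chi_i _); apply/eqP; rewrite eq_invg_mul xx. Qed.

Let chi1_gt0 i : 0 < 'chi[G]_i 1%g. Proof. exact: irr1_gt0. Qed.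

Let v_gt0 i : 0 < v i.
Proof.
have realx : 'chi_i x \is Num.real by rewrite CrealE conj_chix.
have le1 := char1_ge_norm x (irr_char i).
have ge0 : 0 <= v i.
  by move: le1; rewrite real_ler_norml // => /andP[le1 _]; rewrite /v addrC -lerBlDr sub0r.
rewrite lt0r ge0 andbT /v addrC addr_eq0.
exact: irr_neg_gen_class Gx genG Gy yy.
Qed.

(** [g2] is 2 at 1, -2 at [x], and 2 at every [x * x ^ u], which lies in [O]. Passing to [v] makes
    the last two right-hand sides 2 - 2 and 2 - 4 + 2. *)
Let sums :
  [/\ (-1) ^+ b1 * 'chi_i1 1%g + (-1) ^+ b2 * 'chi_i2 1%g + (-1) ^+ b3 * 'chi_i3 1%g = 2%:R,
   (-1) ^+ b1 * v i1 + (-1) ^+ b2 * v i2 + (-1) ^+ b3 * v i3 = 0 &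
   (-1) ^+ b1 * (v i1 ^+ 2 / 'chi_i1 1%g) + (-1) ^+ b2 * (v i2 ^+ 2 / 'chi_i2 1%g)
      + (-1) ^+ b3 * (v i3 ^+ 2 / 'chi_i3 1%g) = 0].
Proof.
have e1 : (-1) ^+ b1 * 'chi_i1 1%g + (-1) ^+ b2 * 'chi_i2 1%g + (-1) ^+ b3 * 'chi_i3 1%g = 2%:R.
  have := congr1 (fun f : 'CF(G) => f 1%g) Dg2; rewrite g2S ?group1 // !cfunE => <-.
  by rewrite eqxx eq_sym (negPf ntx) mulr1 mulr0 subr0.
have ex : (-1) ^+ b1 * 'chi_i1 x + (-1) ^+ b2 * 'chi_i2 x + (-1) ^+ b3 * 'chi_i3 x = - 2%:R.
  have := congr1 (fun f : 'CF(G) => f x) Dg2.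
  rewrite g2S ?(subsetP (center_sub S)) // !cfunE => <-.
  by rewrite eqxx (negPf ntx) mulr1 mulr0 sub0r.
have e2 : (-1) ^+ b1 * v i1 + (-1) ^+ b2 * v i2 + (-1) ^+ b3 * v i3 = 0.
  by rewrite -(subrr 2%:R) -{1}e1 -ex /v; ring.
have e3 : (-1) ^+ b1 * ('chi_i1 x ^+ 2 / 'chi_i1 1%g) + (-1) ^+ b2 * ('chi_i2 x ^+ 2 / 'chi_i2 1%g)
      + (-1) ^+ b3 * ('chi_i3 x ^+ 2 / 'chi_i3 1%g) = 2%:R.
  apply: (mulfI (neq0CG G)); transitivity (\sum_(u in G) g2 (x * x ^ u)%g).
    rewrite Dg2; under [RHS]eq_bigr => u Gu do rewrite !cfunE.
    rewrite !big_split /= -!mulr_sumr !sum_irrMJ // !mulrDr.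
    by congr (_ + _ + _); rewrite mulrCA expr2 !mulrA.
  rewrite mulr_natl -sumr_const; apply: eq_bigr => u Gu.
  have Oxx : (x * x ^ u)%g \in O.
    rewrite inO groupM ?groupJ //=; apply/eqP/constt1P.
    by rewrite /p_elt -odd_2'nat oddK ?class_refl ?imset_f.
  by rewrite g2E Oxx; have [-> _] := ctO Oxx; rewrite mulr0 subr0 mulr1.
split=> //.
have vE i : v i ^+ 2 / 'chi_i 1%g = 'chi_i 1%g + 2%:R * 'chi_i x + 'chi_i x ^+ 2 / 'chi_i 1%g.
  by rewrite /v; field; rewrite irr1_neq0.
rewrite !vE; transitivity
  (((-1) ^+ b1 * 'chi_i1 1%g + (-1) ^+ b2 * 'chi_i2 1%g + (-1) ^+ b3 * 'chi_i3 1%g)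
   + 2%:R * ((-1) ^+ b1 * 'chi_i1 x + (-1) ^+ b2 * 'chi_i2 x + (-1) ^+ b3 * 'chi_i3 x)
   + ((-1) ^+ b1 * ('chi_i1 x ^+ 2 / 'chi_i1 1%g) + (-1) ^+ b2 * ('chi_i2 x ^+ 2 / 'chi_i2 1%g)
    + (-1) ^+ b3 * ('chi_i3 x ^+ 2 / 'chi_i3 1%g))); first by ring.
by rewrite e1 ex e3; ring.
Qed.

Lemma triple_arith : [/\ (b1 + b2 + b3 = 1)%N,
  b1 = b2 -> 'chi_i1 1%g = 'chi_i2 1%g -> v i1 = v i2 -> False &
  b1 = b3 -> 'chi_i1 1%g = 'chi_i3 1%g -> v i1 = v i3 -> False].
Proof.
have [e1 e2 e3] := sums.
have [|||||| bs eq12] := cone_arith _ _ _ _ _ _ e1 e2 e3; rewrite ?chi1_gt0 ?v_gt0 //.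
rewrite addrAC in e1; rewrite addrAC in e2; rewrite addrAC in e3.
by have [|||||| _ eq13] := cone_arith _ _ _ _ _ _ e1 e2 e3; rewrite ?chi1_gt0 ?v_gt0.
Qed.

Lemma triple_deg (n1 n2 n3 : nat) :
    'chi_i1 1%g = n1%:R -> 'chi_i2 1%g = n2%:R -> 'chi_i3 1%g = n3%:R ->
  (-1) ^+ b1 * n1%:R + (-1) ^+ b2 * n2%:R + (-1) ^+ b3 * n3%:R = 2%:R :> algC.
Proof. by have [e1 _ _] := sums => <- <- <-. Qed.

Lemma triple_dot i : '[g2, 'chi_i] =
  (-1) ^+ b1 *+ (i1 == i) + (-1) ^+ b2 *+ (i2 == i) + (-1) ^+ b3 *+ (i3 == i).
Proof. by rewrite Dg2 !cfdotDl !cfdotZl !cfdot_irr !mulr_natr. Qed.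

(** [g2] is real, so the conjugate is a constituent with the same sign, degree and value at [x]; if
    different, it is excluded by [triple_arith]. *)
Lemma triple_real : cfReal 'chi_i1.
Proof.
have [bs eq12 eq13] := triple_arith.
pose i' := conjC_Iirr i1; have chi' : 'chi_i' = ('chi_i1)^*%CF by rewrite conjC_IirrE.
have : '[g2, 'chi_i'] = (-1) ^+ b1.
  rewrite chi' -conj_g2 cfdot_conjC triple_dot eqxx eq_sym (negPf i12) eq_sym (negPf i13).
  by rewrite addr0 addr0 rmorph_sign.
rewrite triple_dot; have chi'1 : 'chi_i' 1%g = 'chi_i1 1%g.
  by rewrite chi' cfunE irr1_degree rmorph_nat.
have chi'x : 'chi_i' x = 'chi_i1 x by rewrite chi' cfunE; exact: conj_chix.
have [e1 | n1] := eqVneq i1 i'; first by rewrite /cfReal -chi' -e1 eqxx.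
rewrite mulr0n add0r; have sign_inj (b b' : bool) : (-1) ^+ b = (-1) ^+ b' :> algC -> b = b'.
  by case: b; case: b' => // /eqP; rewrite ?(eq_sym (- 1)) -subr_eq0 opprK -mulr2n pnatr_eq0.
have [e2 | n2] := eqVneq i2 i'.
  rewrite -e2 (eq_sym i3) (negPf i23) addr0 => /sign_inj b12; case: eq12 => //.
    by rewrite e2 chi'1.
  by rewrite /v e2 chi'1 chi'x.
have [e3 | n3] := eqVneq i3 i'; rewrite add0r.
  move=> /sign_inj b13; case: eq13 => //; first by rewrite e3 chi'1.
  by rewrite /v e3 chi'1 chi'x.
by move/eqP; rewrite eq_sym signr_eq0.
Qed.

End Triple.

(** Squares of elements of [O] and [X] lie in [O], those of elements of [Y] lie in [X]; as |Y| = |G|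
    / 4 the mean is 2 (3/4) - 2 (1/4). *)
Let sum_g2_sqr : \sum_(g in G) g2 (g * g)%g = #|G|%:R.
Proof.
have sq g : g \in G -> g2 (g * g)%g = 2%:R - 4%:R * (g \in Y)%:R.
  move=> Gg; have gg2 : constt (g * g)%g 2 = (constt g 2 * constt g 2)%g by rewrite consttM.
  case/or3P: (GE Gg) => [Og|Xg|Yg].
  - have [_ ->] := ctO Og; have Ogg : (g * g)%g \in O.
      by rewrite inO groupM //= gg2; case/setIdP: Og => _ /eqP->; rewrite mulg1.
    by rewrite g2E Ogg; have [-> _] := ctO Ogg; rewrite !mulr0 mulr1.
  - have [_ ->] := ctX Xg; have Ogg : (g * g)%g \in O.
      by rewrite inO groupM //= gg2; case/setIdP: Xg => _ /xxJ->.
    by rewrite g2E Ogg; have [-> _] := ctO Ogg; rewrite !mulr0 mulr1.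
  have Xgg : (g * g)%g \in X.
    by rewrite inX groupM //= gg2; case/setIdP: Yg => _ /yyJ.
  by rewrite g2E Xgg Yg; have [-> _] := ctX Xgg; rewrite /= mulr0 !mulr1 sub0r; ring.
rewrite (eq_bigr _ sq) sumrB sumr_const -mulr_sumr -natr_sum.
have -> : (\sum_(g in G) (g \in Y) = #|Y|)%N.
  rewrite -sum1_card [RHS]big_mkcond [LHS]big_mkcond /=; apply: eq_bigr => g _.
  by rewrite inY; case: (g \in G); case: (_ \in _).
have [cY _] := cXY; rewrite -natrM -cY.
by rewrite -mulr_natl; ring.
Qed.

Lemma Q8_FS_irr (b : bool) i n : cfReal 'chi_i -> '[g2, 'chi_i] = (-1) ^+ b -> 'chi_i 1%g = n%:R ->
  \sum_(g in G) 'chi_i (g * g)%g = (-1) ^+ (~~ odd n) * #|G|%:R.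
Proof.
move=> real_i g2i chi1; have [g2_3 g2_1 Th1 Th4 Thg2] := norms.
have i_neq0 : i != 0.
  apply: contra_eqN g2i => /eqP->.
  by rewrite irr0 g2_1 eq_sym signr_eq0.
have chi_1 : '['chi_i, 1] = 0 by rewrite -irr0 cfdot_irr (negPf i_neq0).
have b1 : (-1) ^+ b = 1 :> algC \/ (-1) ^+ b = -1 :> algC by case: (b); [right | left].
have Zm : '[Th, 'chi_i] \in Num.int by apply: Cint_cfdot_vchar_irr.
apply: (FS_values real_i chi_1 g2i b1 (erefl _) _ chi1).
(* Bessel's inequality: [Th] has norm 4 and contains 1 once, which leaves 3 for the other
   constituents. *)
have le3 : `|'[Th, 'chi_i]| ^+ 2 <= 3%:R.
  move: Th4 Th1; move: Th => f f4 f1.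
  have := cfnorm_ge0 (f - 1 - '[f, 'chi_i] *: 'chi_i).
  have -> : '[f - 1 - '[f, 'chi_i] *: 'chi_i] = 3%:R - `|'[f, 'chi_i]| ^+ 2.
    rewrite (cfnormB (f - 1)) (cfnormB f 1) f4 f1 cfnorm1 cfnormZ cfnorm_irr mulr1 conjC1.
    rewrite cfdotZr cfdotBl (cfdotC 1 'chi_i) chi_1 conjC0 subr0 -normCKC.
    rewrite (geC0_conj (exprn_ge0 _ _)) ?normr_ge0 //.
    by ring.
  by rewrite subr_ge0.
case/intrP: Zm le3 => z ->; rewrite intr_normK ?intr_int // -rmorphXn /= -[3%:R]/(3%:R%:~R) ler_int.
move/int_sqr_le3; rewrite !inE => /or3P[]/eqP->; rewrite ?rmorph0 ?rmorph1 ?rmorphN1 ?eqxx ?orbT //.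
Qed.

(* Exactly one constituent of g2 has coefficient -1, and its three degrees have
   even sum; as the indicators are 1 in odd and -1 in even degree, their signed
   sum is -1 or 3, whereas evaluating the mean of g2 over squares gives 1. *)
Lemma Q8_false : False.
Proof.
have [g2_3 g2_1 Th1 Th4 Thg2] := norms.
have [S0 [/orthonormalP[uS onS] ZS0 DS]] := zchar_small_norm Zg2 g2_3 isT.
have {}ZS0 : {subset tval S0 <= 'Z[irr G]} := ZS0.
case: (tval S0) (size_tuple S0) uS onS ZS0 DS => [|a [|b [|c []]]] //= _ uS onS ZS0 DS.
rewrite !big_cons big_nil addr0 in DS.
have [b1 [i1 Da]] : exists b1 i1, a = (-1) ^+ nat_of_bool b1 *: 'chi_i1.
  by apply: vchar_norm1P; rewrite ?ZS0 ?onS ?inE ?eqxx ?orbT.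
have [b2 [i2 Db]] : exists b1 i1, b = (-1) ^+ nat_of_bool b1 *: 'chi_i1.
  by apply: vchar_norm1P; rewrite ?ZS0 ?onS ?inE ?eqxx ?orbT.
have [b3 [i3 Dc]] : exists b1 i1, c = (-1) ^+ nat_of_bool b1 *: 'chi_i1.
  by apply: vchar_norm1P; rewrite ?ZS0 ?onS ?inE ?eqxx ?orbT.
have dist (d d' : bool) (i j : Iirr G) : '[(-1) ^+ d *: 'chi_i, (-1) ^+ d' *: 'chi_j] = 0 -> i != j.
  rewrite cfdotZl cfdotZr rmorph_sign cfdot_irr; case: eqVneq => // _ /eqP.
  by rewrite mulr1 mulf_eq0 !signr_eq0.
move: uS; rewrite !inE negb_or andbT -andbA => /and3P[ab ac bc].
have i12 : i1 != i2 by apply: (dist b1 b2); rewrite -Da -Db onS ?inE ?eqxx ?orbT // (negPf ab).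
have i13 : i1 != i3 by apply: (dist b1 b3); rewrite -Da -Dc onS ?inE ?eqxx ?orbT // (negPf ac).
have i23 : i2 != i3 by apply: (dist b2 b3); rewrite -Db -Dc onS ?inE ?eqxx ?orbT // (negPf bc).
have D123 : g2 = (-1) ^+ b1 *: 'chi_i1 + (-1) ^+ b2 *: 'chi_i2 + (-1) ^+ b3 *: 'chi_i3.
  by rewrite DS Da Db Dc addrA.
have D213 : g2 = (-1) ^+ b2 *: 'chi_i2 + (-1) ^+ b1 *: 'chi_i1 + (-1) ^+ b3 *: 'chi_i3.
  by rewrite D123 [X in X + _]addrC.
have D312 : g2 = (-1) ^+ b3 *: 'chi_i3 + (-1) ^+ b1 *: 'chi_i1 + (-1) ^+ b2 *: 'chi_i2.
  by rewrite D123 [LHS]addrC addrA.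
have i21 : i2 != i1 by rewrite eq_sym.
have i31 : i3 != i1 by rewrite eq_sym.
have i32 : i3 != i2 by rewrite eq_sym.
have real1 := triple_real i12 i13 i23 D123.
have real2 := triple_real i21 i23 i13 D213.
have real3 := triple_real i31 i32 i12 D312.
have [bs _ _] := triple_arith D123.
have /natrP[n1 Dn1] := Cnat_irr1 i1.
have /natrP[n2 Dn2] := Cnat_irr1 i2.
have /natrP[n3 Dn3] := Cnat_irr1 i3.
have e1 := triple_deg D123 Dn1 Dn2 Dn3.
apply: (parity_signs bs e1); apply: (mulIf (neq0CG G)); rewrite mul1r -[RHS]sum_g2_sqr.
have dot1 : '[g2, 'chi_i1] = (-1) ^+ b1.
  by rewrite (triple_dot D123) eqxx (negPf i21) (negPf i31) !addr0.
have dot2 : '[g2, 'chi_i2] = (-1) ^+ b2.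
  by rewrite (triple_dot D123) eqxx (negPf i12) (negPf i32) addr0 add0r.
have dot3 : '[g2, 'chi_i3] = (-1) ^+ b3.
  by rewrite (triple_dot D123) eqxx (negPf i13) (negPf i23) !add0r.
rewrite D123; under [RHS]eq_bigr => g Gg do rewrite !cfunE.
rewrite !big_split /= -!mulr_sumr (Q8_FS_irr real1 dot1 Dn1) (Q8_FS_irr real2 dot2 Dn2).
by rewrite (Q8_FS_irr real3 dot3 Dn3) !mulrDl !mulrA.
Qed.

End Q8.

(** * Quaternion Sylow 2-subgroups of order at least 16 *)

Section LargeQuaternion.
Variables (gT : finGroupType) (G S : {group gT}) (x s t c : gT).
Let A := <[s]>%G.
Hypotheses (sylS : 2.-Sylow(G) S) (Ss : s \in S) (St : t \in S) (oSA : #|S : A| = 2).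
Hypotheses (invA : {in A, forall a, a ^ t = a^-1}) (Ac : c \in A) (cc : c * c = x).
Hypotheses (xx : x * x = 1) (ntx : x != 1) (ZS : 'Z(S) \subset <[x]>).
Hypothesis A2 : {in A, forall a, a * a = 1 -> a = 1 \/ a = x}.
Hypothesis A4 : {in A, forall a, a * a != 1 -> exists j, a ^+ j \in [set c; c^-1]}.
Hypothesis ss : s * s \notin <[x]>.
Hypothesis genG : <<x ^: G>> = G.
Hypothesis oddK : {in x ^: G &, forall k l, odd #[k * l]}.

Let sSG : S \subset G := pHall_sub sylS.
Let sAS : A \subset S. Proof. by rewrite cycle_subG. Qed.
Let sAG : A \subset G := subset_trans sAS sSG.
Let pS : 2.-group S := pHall_pgroup sylS.
Let Gx : x \in G. Proof. by rewrite -cc groupM ?(subsetP sAG). Qed.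
Let Gt : t \in G := subsetP sSG t St.
Let abA : abelian A. Proof. exact: cycle_abelian. Qed.
Let M := 'C_G[c]%G.
Let sMG : M \subset G. Proof. exact: subsetIl. Qed.
Let sAM : A \subset M.
Proof. by rewrite subsetI sAG sub_cent1 (subsetP abA). Qed.

(** [A] has index 2 in [S], so a larger 2-subgroup of [M] would be conjugate to [S], with a
    conjugate of [c], of order 4, in the center of [S]. *)
Let sylA : 2.-Sylow(M) A.
Proof.
have pA : 2.-group A := pgroupS sAS pS.
have [T sylT sAT] := Sylow_superset sAM pA.
suff -> : A = T by [].
have [sTM pT _] := and3P sylT; have sTG := subset_trans sTM sMG.
have [u Gu sTuS] := Sylow_Jsub sylS sTG pT.
apply/group_inj/eqP; rewrite eqEcard sAT /= leqNgt; apply/negP=> ltAT.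
have oS : #|S| = (#|A| * 2)%N by rewrite -oSA Lagrange.
have eTuS : T :^ u = S.
  apply/eqP; rewrite eqEcard sTuS cardJg oS -(Lagrange sAT) leq_pmul2l ?cardG_gt0 //.
  rewrite ltn_neqAle indexg_gt0 andbT eq_sym indexg_eq1.
  by apply: contraL ltAT => /subset_leq_card; rewrite -leqNgt.
have : c ^ u \in 'Z(S).
  apply/centerP; rewrite -eTuS memJ_conjg (subsetP sAT) //; split=> // _ /imsetP[v Tv ->].
  rewrite /commute -!conjMg; congr (_ ^ u).
  by have /setIP[_ /cent1P] := subsetP sTM v Tv => /commute_sym.
move=> /(subsetP ZS)/cycleP[i cu].
have : c ^ u * c ^ u != 1 by rewrite -conjMg cc conjg_eq1.
by rewrite cu -expgMn // xx expg1n eqxx.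
Qed.

Let O := 'O_2^'(M)%G.
Let defM : O ><| A = M.
Proof. by rewrite cyclic_Sylow2_sdprod ?cycle_cyclic. Qed.

Let conjA m : m \in M -> exists2 v, v \in M & m.`_2 ^ v \in A.
Proof.
move=> Mm; have pm : 2.-group <[m.`_2]> by rewrite /pgroup -orderE; exact: p_elt_constt.
have smM : <[m.`_2]> \subset M by rewrite cycle_subG groupX.
by have [v Mv] := Sylow_Jsub sylA smM pm; rewrite -cycleJ cycle_subG; exists v.
Qed.

(** A character of A / <x> nontrivial on [s * s] is not real; it exists exactly because [s * s] is
    outside <x>, that is, |S| > 8. It extends to [M] by inflation through M / O. *)
Let lamP : exists2 lam : 'CF(M), lam \is a linear_char &
  [/\ (lam x = 1)%R, (lam s ^+ 2 != 1)%R & {in M, forall m, lam m = lam m.`_2}].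
Proof.
have sxA : <[x]> \subset A by rewrite cycle_subG -cc groupM.
have nsxA : <[x]> <| A by rewrite -sub_abelian_normal.
have As := cycle_id s; have Ax : x \in A by rewrite -cc groupM.
have ntss : coset <[x]> (s * s) != 1.
  apply: contra ss => /eqP/coset_idr; apply.
  by rewrite (subsetP (normal_norm nsxA)) ?groupM.
have [mu lin_mu mu_ss] := lin_char_neq1 (quotient_abelian _ abA) ntss.
pose lamA := (mu %% <[x]>)%CF; have lin_lamA : lamA \is a linear_char by apply: cfMod_lin_char.
pose lam := cfSdprod defM lamA; have lin_lam : lam \is a linear_char by rewrite cfSdprod_lin_char.
have lamE a : a \in A -> lam a = lamA a.
  by move=> Aa; rewrite -[a in LHS]mul1g cfSdprodE.
exists lam => //; split.
- by rewrite lamE // cfModE // coset_id ?cycle_id // lin_char1.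
- by rewrite lamE // expr2 -lin_charM // cfModE ?groupM.
move=> m Mm; rewrite -{1}(consttC 2 m) lin_charM ?groupX //.
suff Om : m.`_2^' \in O by rewrite -[m.`_2^']mulg1 cfSdprodE // lin_char1 ?mulr1.
have hallO : 2^'.-Hall(M) O by apply/(sdprod_p'core_HallP sylA).
have /sdprod_context[nsO _ _ _ _] := defM.
by rewrite (mem_normal_Hall hallO nsO) ?groupX // p_elt_constt.
Qed.

Let M4 d : d \in M -> d * d != 1 -> d.`_2 = d -> exists j, d ^+ j \in [set c; c^-1].
Proof.
move=> Md dd d2; have [v Mv] := conjA Md; rewrite d2 => Adv.
have [|j dvj] := A4 Adv; first by rewrite -conjMg conjg_eq1.
have cv : c ^ v^-1 = c.
  have /setIP[_ /cent1P cvc] : v^-1 \in M by rewrite groupV.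
  by rewrite conjgE -cvc mulKg.
exists j; move: dvj; rewrite -conjXg !inE => /orP[] /eqP dvj; apply/orP; [left | right].
  by rewrite -[d ^+ j](conjgK v) dvj cv.
by rewrite -[d ^+ j](conjgK v) dvj conjVg cv.
Qed.

Let c4 d : d \in [set c; c^-1] -> d * d = x.
Proof.
rewrite !inE => /orP[] /eqP-> //; rewrite -invMg cc.
by apply/eqP; rewrite eq_invg_mul xx.
Qed.

Let setV d : (d^-1 \in [set c; c^-1]) = (d \in [set c; c^-1]).
Proof. by rewrite !inE orbC !(can2_eq invgK invgK) invgK. Qed.

Let c4_M d : d \in M -> d.`_2 = d -> d * d != 1 -> d ^+ 4 = 1 -> d \in [set c; c^-1].
Proof.
move=> Md d2 dd d4; have [j] := M4 Md dd d2.
have d3 : d ^+ 3 = d^-1 by apply: (mulgI d); rewrite mulgV -expgS.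
have dd2 : (d ^+ 2) * (d ^+ 2) = 1 by rewrite -expgD.
rewrite -(expg_mod j d4); have : j %% 4 < 4 by rewrite ltn_mod.
case: (j %% 4) => [|[|[|[|]]]] // _ Dj; last by rewrite d3 setV in Dj.
  by have := c4 Dj; rewrite expg0 mulg1 => x1; case/eqP: ntx.
by have := c4 Dj; rewrite dd2 => x1; case/eqP: ntx.
Qed.

Let nM u m : c ^ u \in [set c; c^-1] -> (m ^ u \in 'C[c]) = (m \in 'C[c]).
Proof.
move=> cu; suff {1}-> : 'C[c] = 'C[c] :^ u by rewrite memJ_conjg.
rewrite -cent1J; move: cu; rewrite !inE => /orP[] /eqP-> //.
by apply/setP=> z; apply/cent1P/cent1P=> [/commuteV | /commuteV]; rewrite ?invgK.
Qed.

(** Some power of the 2-part of [m] is [c] or its inverse, so [c ^ u] lies in [M], whose only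
    elements of order 4 are these two. *)
Let conj_M2 m u : m \in M -> u \in G -> m.`_2 * m.`_2 != 1 -> m ^ u \in M ->
  c ^ u \in [set c; c^-1].
Proof.
move=> Mm Gu m22 Mmu; have [|||j mj] := @M4 m.`_2; rewrite ?groupX //.
  by rewrite constt_p_elt // p_elt_constt.
have pc : 2.-elt c := mem_p_elt (pgroupS sAS pS) Ac.
have Mcu : c ^ u \in M.
  have Mmj : (m.`_2 ^+ j) ^ u \in M by rewrite conjXg groupX // -consttJ groupX.
  case/set2P: mj => mj; first by rewrite -mj.
  by rewrite -groupV -conjVg -mj.
apply: c4_M => //; first by rewrite constt_p_elt // p_eltJ.
  by rewrite -conjMg cc conjg_eq1.
by rewrite -conjXg !expgS expg0 mulg1 mulgA cc -cc !mulgA -mulgA cc xx conj1g.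
Qed.

Local Open Scope ring_scope.

Let tM m : m \in M -> (m ^ t \in M)%g.
Proof.
case/setIP=> Gm Cm; rewrite inE groupJ // nM // invA // set22.
by [].
Qed.

Section Lam.
Variable lam : 'CF(M).
Hypotheses (lin_lam : lam \is a linear_char) (lamx : lam x = 1) (lams : lam s ^+ 2 != 1).
Hypothesis lam2 : {in M, forall m, lam m = lam (constt m 2)}.

Let lam_inv m : m \in M -> (constt m 2 * constt m 2 = 1)%g -> lam m = 1.
Proof.
move=> Mm m22; rewrite lam2 //; have [v Mv Av] := conjA Mm.
rewrite -(cfunJ _ _ Mv); have [] := A2 Av; first by rewrite -conjMg m22 conj1g.
  by move=> ->; rewrite lin_char1.
by move=> ->.
Qed.

Let lam_t m : m \in M -> lam (m ^ t)%g = (lam m)^*.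
Proof.
move=> Mm; rewrite lam2 ?tM // consttJ [lam m]lam2 //; have [v Mv Av] := conjA Mm.
rewrite -[in RHS](cfunJ lam _ Mv) -lin_charV_conj ?(subsetP sAM) // -(invA Av).
by rewrite (conjJg _ v t) (cfunJ lam _ (tM Mv)).
Qed.

(* An element of M whose 2-part does not square to 1 is only conjugated into M by
   M and M t, and t conjugates lam; so f restricts to 2 - lam - lam^* on M and has
   norm 3. *)
Let f := 'Ind[G] (1 - lam).

Let f_inv g : g \in G -> (constt g 2 * constt g 2 = 1)%g -> f g = 0.
Proof.
move=> Gg g22; rewrite cfIndE // big1 ?mulr0 // => u Gu.
have [Mgu|nMgu] := boolP (g ^ u \in M)%g; last by rewrite cfun0.
by rewrite !cfunE cfun1E Mgu lam_inv ?subrr // consttJ -conjMg g22 conj1g.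
Qed.

Let f_M m : m \in M -> f m = 2%:R - lam m - (lam m)^*.
Proof.
move=> Mm; have Gm := subsetP sMG m Mm.
have [m22|m22] := eqVneq (constt m 2 * constt m 2)%g 1%g.
  by rewrite f_inv // lam_inv // conjC1; ring.
have NM u : u \in G -> (u \in M) = (c ^ u == c)%g.
  move=> Gu; rewrite inE Gu; apply/cent1P/eqP => [cu | cu]; first by rewrite conjgE -cu mulKg.
  by apply: (mulgI u^-1%g); rewrite -conjgE cu mulKg.
have ct : (c ^ t)%g = c^-1%g by apply: invA.
have c_neqV : c^-1%g != c.
  by apply: contra_neq ntx => cV; rewrite -cc -{1}cV mulVg.
have NMt u : u \in G -> (u * t^-1 \in M)%g = (c ^ u == c^-1)%g.
  by move=> Gu; rewrite NM ?groupM ?groupV // conjgM -(inj_eq (conjg_inj t)) conjgKV ct.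
pose F u := (1 - lam) (m ^ u)%g.
have splitF u : u \in G -> F u =
    (if (u \in M) then F u else 0) + (if (u * t^-1 \in M)%g then F u else 0).
  move=> Gu; rewrite NM // NMt //; case: eqVneq => [->|cu].
    by rewrite eq_sym (negPf c_neqV) addr0.
  case: eqVneq => [_ | cuV]; first by rewrite add0r.
  rewrite addr0 /F cfun0 //; apply/negP => Mmu.
  by have := conj_M2 Mm Gu m22 Mmu; rewrite !inE (negPf cu) (negPf cuV).
rewrite cfIndE // (eq_bigr _ splitF) big_split /=.
have -> : \sum_(u in G) (if u \in M then F u else 0) = #|M|%:R * (1 - lam m).
  rewrite -big_mkcondr (eq_bigl (mem M)) => [|u]; last first.
    by rewrite andb_idl // => /(subsetP sMG).
  rewrite mulr_natl -sumr_const; apply: eq_bigr => u Mu.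
  by rewrite /F cfunJ // !cfunE cfun1E Mm.
have -> : \sum_(u in G) (if (u * t^-1 \in M)%g then F u else 0) = #|M|%:R * (1 - (lam m)^* ).
  rewrite -big_mkcondr (reindex_inj (mulIg t)) /= (eq_bigl (mem M)) => [|u]; last first.
    rewrite mulgK groupMr // andb_idl // => /(subsetP sMG).
    by [].
  rewrite mulr_natl -sumr_const; apply: eq_bigr => u Mu.
  have Mmu : (m ^ u)%g \in M by rewrite groupJ.
  by rewrite /F conjgM !cfunE cfun1E tM // lam_t // cfunJ.
by rewrite -mulrDr mulKf ?neq0CG //; ring.
Qed.

Lemma large_quaternion_lam_false : False.
Proof.
have irr_lam := lin_char_irr lin_lam.
have nlam1 : lam != 1.
  by apply: contraNneq lams => ->; rewrite cfun1E (subsetP sAM) ?cycle_id // expr1n.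
have lamJ_lin : (lam^*)%CF \is a linear_char by rewrite cfAut_lin_char.
have irr_lamJ := lin_char_irr lamJ_lin.
have nlamJ1 : (lam^*)%CF != 1.
  by apply: contraNneq nlam1 => e; rewrite -(cfConjCK lam) e cfConjC_cfun1.
have nlamJ : (lam^*)%CF != lam.
  apply: contraNneq lams => e; rewrite expr2 -{1}e cfunE -normCKC.
  by rewrite (normC_lin_char lin_lam) ?expr1n // (subsetP sAM) ?cycle_id.
have dot (a b : 'CF(M)) : a \in irr M -> b \in irr M -> a != b -> '[a, b] = 0.
  case/irrP=> i -> /irrP[j ->] ij; rewrite cfdot_irr; case: (eqVneq i j) ij => [->|//].
  by rewrite eqxx.
have irr1 : (1 : 'CF(M)) \in irr M by apply: cfun1_irr.
have ResE : 'Res[M] f = 2%:R *: 1 - lam - (lam^*)%CF.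
  by apply/cfun_inP=> m Mm; rewrite cfResE // f_M // !cfunE cfun1E Mm mulr1.
apply: (@vchar_norm3_false _ G x Gx genG f).
- by rewrite cfInd_vchar ?rpredB ?cfun1_vchar ?char_vchar ?lin_charW.
(* By reciprocity the norm is the product of 1 - lam with 2 - lam - conj(lam), where 1, lam and its
   conjugate are distinct irreducibles: 2 + 1. *)
- rewrite -Frobenius_reciprocity ResE cfdotBl !cfdotBr !cfdotZr conjC_nat cfnorm1.
  rewrite (dot 1 lam) 1?eq_sym // (dot 1 lam^*%CF) 1?eq_sym // (dot lam 1) //.
  rewrite (dot lam lam^*%CF) 1?eq_sym //.
  have -> : '[lam] = 1 by case/irrP: irr_lam => i ->; rewrite cfnorm_irr.
  by ring.
- rewrite -Frobenius_reciprocity cfRes_cfun1 // cfdotBl cfnorm1 dot //.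
  by rewrite subr0.
- by rewrite f_inv ?group1 // constt1 mulg1.
- rewrite f_inv //; rewrite constt_p_elt ?xx //.
  by rewrite (mem_p_elt pS) // (subsetP sAS) // -cc groupM.
move=> u Gu; have xu2 : constt (x * x ^ u)%g 2 = 1%g.
  by apply/constt1P; rewrite /p_elt -odd_2'nat oddK ?class_refl ?imset_f.
by apply: f_inv; rewrite ?xu2 ?mulg1 // groupM ?groupJ.
Qed.

End Lam.

Lemma large_quaternion_false : False.
Proof.
have [lam lin_lam [lamx lams lam2]] := lamP.
exact: large_quaternion_lam_false lin_lam lamx lams lam2.
Qed.

End LargeQuaternion.

(** The function [f] extends to [G] the sign character of S / A. It is virtual by [vchar_Sylow2] and
    has norm 1, so [f x = f 1] makes it constant, although it is -1 on S outside A. *)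
Lemma fusion_index2_false (gT : finGroupType) (G S A : {group gT}) (B : {set gT}) (x : gT) :
    2.-Sylow(G) S -> A \subset S -> #|S : A| = 2 -> G \subset 'N(B) ->
    {in S, forall s, (s \in B) = (s \in A)} -> x \in A -> <<x ^: G>> = G -> False.
Proof.
move=> sylS sAS iA nB BA Ax genG; have [sSG pS _] := and3P sylS.
have Gx : x \in G by rewrite (subsetP sSG) ?(subsetP sAS).
pose D := [set g in G | g.`_2 \in B].
have nsDG : D <| G.
  apply/andP; split; first by apply/subsetP=> g /setIdP[].
  apply/subsetP=> u Gu; rewrite inE; apply/subsetP=> _ /imsetP[g /setIdP[Gg Bg] ->].
  by rewrite inE groupJ // consttJ memJ_norm // (subsetP nB).
pose f : 'CF(G) := (2%:R *: '1_D - 1)%R.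
have fE g : g \in G -> f g = ((-1) ^+ (g.`_2 \notin B))%R.
  move=> Gg; rewrite !cfunE cfun1E cfuniE // Gg inE Gg /=.
  by case: (_ \in B) => /=; [rewrite mulr1 addrK | rewrite mulr0 sub0r].
have f2 : {in G, forall g, f g = f g.`_2}.
  by move=> g Gg; rewrite !fE ?groupX // [g.`_2.`_2]constt_p_elt // p_elt_constt.
have sS s : s \in S -> s.`_2 = s by move=> Ss; rewrite constt_p_elt // (mem_p_elt pS).
have Zf : (f \in 'Z[irr G])%R.
  apply: (vchar_Sylow2 sylS f2).
  rewrite (_ : 'Res _ = 'Ind[S, A] 1 - 1)%R ?rpredB ?cfInd_vchar ?cfun1_vchar //.
  have nsA := index2_normal sAS iA.
  apply/cfun_inP=> s Ss; rewrite cfResE // fE ?(subsetP sSG) // cfInd_cfun1 // !cfunE.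
  rewrite cfuniE // cfun1E Ss sS // BA // iA.
  by case: (s \in A) => /=; [rewrite mulr1 addrK | rewrite mulr0 sub0r].
have f1 : ('[f] = 1)%R.
  apply: (mulfI (neq0CG G)); rewrite cfdotE mulVKf ?neq0CG // mulr1 -sumr_const.
  by apply: eq_bigr => g Gg; rewrite fE // -normCK normr_sign expr1n.
have B1 : 1 \in B by rewrite BA ?group1.
have fx : (f x = f 1%g)%R by rewrite !fE // constt1 B1 sS ?BA ?Ax // (subsetP sAS).
have [b Df] := norm1_vchar_gen_class genG Zf f1 fx.
have /subsetPn[s Ss As] : ~~ (S \subset A) by rewrite -indexg_eq1 iA.
have /eqP : f s = f 1%g by rewrite Df !cfunE !cfun1E group1 (subsetP sSG).
rewrite !fE ?(subsetP sSG) // constt1 B1 sS // BA // As /= expr1 expr0.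
by rewrite -subr_eq0 -opprD oppr_eq0 -mulr2n pnatr_eq0.
Qed.

Lemma quaternion_Sylow2_false (gT : finGroupType) (G S : {group gT}) (n : nat) (x : gT) :
    2.-Sylow(G) S -> 2 < n -> S \isog 'Q_(2 ^ n) -> x \in S -> #[x] = 2 ->
    <<x ^: G>> = G -> {in x ^: G &, forall k l, odd #[k * l]} -> False.
Proof.
move=> sylS n_gt2 isoS Sx ox genG oddK; have [sSG pS _] := and3P sylS.
have [[s t] gens [ot tt st]] := generators_quaternion n_gt2 isoS.
have [oS Ss os /setDP[St nAt]] := gens.
have [[_ X4 invA] _ [ZS _ inv1 _ _] _ _] := quaternion_structure n_gt2 gens isoS.
have Dx : x = s ^+ (2 ^ n.-2) by apply: inv1.
rewrite -Dx in ZS inv1 tt.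
have ntx : x != 1 by rewrite -order_gt1 ox.
have xx : x * x = 1 by have := expg_order x; rewrite ox.
have invS u : u \in S -> u * u = 1 -> u != 1 -> u = x.
  by move=> Su uu ntu; apply: inv1 => //; apply: nt_prime_order; rewrite ?expgS ?expg0 ?mulg1.
have oSA : #|S : <[s]>| = 2.
  rewrite -divgS ?cycle_subG // oS -[#|<[s]>|]/#[s] os -{1}(ltn_predK n_gt2) expnS.
  by rewrite mulnK ?expn_gt0.
have invAt : {in <[s]>, forall a, a ^ t = a^-1}.
  by move=> a Aa; apply: invA => //; apply/setDP.
have [n3 | n_neq3] := eqVneq n 3.
  rewrite {n n_gt2}n3 in isoS oS os Dx gens *.
  have ss : s * s = x by rewrite Dx.
  have S4 u : u \in S -> [|| u == 1, u == x | u * u == x].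
    move=> Su; have u4 : u ^+ 4 = 1.
      have [/cycleP[i ->]|nAu] := boolP (u \in <[s]>).
        by rewrite -expgM mulnC expgM -[4]/(2 ^ 3.-1)%N -os expg_order expg1n.
      by rewrite -(X4 u) ?expg_order //; apply/setDP.
    have [uu1|nuu1] := eqVneq (u * u) 1.
      by case: (eqVneq u 1) => //= ntu; rewrite (invS u) ?eqxx.
    by rewrite (invS (u * u)) ?groupM ?eqxx ?orbT // -!mulgA.
  have Sinv u : u \in S -> u * u = x -> exists2 w, w \in S & u ^ w = u^-1.
    move=> Su uu; have [Au|nAu] := boolP (u \in <[s]>); first by exists t; rewrite ?invAt.
    exists s => //; have su : s ^ u = s^-1 by apply: invA; rewrite ?cycle_id //; apply/setDP.
    rewrite conjgE mulgA [s^-1 * u]conjgC conjVg su invgK -mulgA ss.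
    by apply: (mulgI u); rewrite mulgV mulgA uu xx.
  (* Otherwise the elements of [S] conjugate to a power of [u] are exactly those of <u>, of index 2
     in [S], and [fusion_index2_false] applies. *)
  have fuse u : u \in S -> u * u = x -> exists2 v, v \in S & (v \notin <[u]>) && (v \in u ^: G).
    move=> Su uu; apply/exists_inP; apply: contraT => /exists_inPn/= nofuse.
    have uE v : v \in S -> v \in <[u]> -> [|| v == 1, v == x, v == u | v == u^-1].
      move=> Sv /cycleP[i ->]; have u4 : u ^+ 4 = 1 by rewrite !expgS expg0 mulg1 mulgA uu xx.
      rewrite -(expg_mod i u4); have : i %% 4 < 4 by rewrite ltn_mod.
      case: (i %% 4) => [|[|[|[|]]]] // _; rewrite ?eqxx ?orbT //.
        by rewrite -uu eqxx !orbT.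
      by rewrite (_ : u ^+ 3 = u^-1) ?eqxx ?orbT //; apply: (mulgI u); rewrite mulgV -expgS.
    have ntu : u != 1 by apply: contraNneq ntx => u1; rewrite -uu u1 mulg1.
    have ou : #[u] = 4.
      apply: (@orderXprime _ 2 2); rewrite ?expgS ?expg0 ?mulg1 ?uu //.
    have sUS : <[u]> \subset S by rewrite cycle_subG.
    have iU : #|S : <[u]>| = 2 by rewrite -divgS // oS -[#|<[u]>|]/#[u] ou.
    pose B := [set 1] :|: x ^: G :|: u ^: G :|: u^-1 ^: G.
    exfalso; apply: (@fusion_index2_false _ G S <[u]>%G B x) => //.
    - by rewrite !normsU ?norms1 ?class_norm.
    - move=> v Sv; rewrite !in_setU inE; apply/idP/idP => [|Uv].
        case/orP=> [/orP[/orP[/eqP->|Kv]|uv]|uv]; rewrite ?group1 //.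
        + rewrite (invS v) // -?uu ?groupM ?cycle_id //.
            by case/imsetP: Kv => g _ ->; rewrite -conjMg xx conj1g.
          by case/imsetP: Kv => g _ ->; rewrite conjg_eq1.
        + by have := nofuse v Sv; rewrite uv andbT negbK.
        have uv' : v^-1 \in u ^: G.
          by case/imsetP: uv => g Gg ->; rewrite -conjVg invgK imset_f.
        by have := nofuse v^-1; rewrite !groupV uv' andbT negbK => /(_ Sv).
      case/or4P: (uE v Sv Uv) => /eqP->; rewrite ?class_refl ?eqxx ?orbT //.
    by rewrite -uu groupM ?cycle_id.
  pose cs v := v \in s ^: G.
  have csx v : v \in S -> v * v = x -> cs v -> cs v^-1.
    move=> Sv vv csv; have [w Sw <-] := Sinv v Sv vv.
    by rewrite /cs memJ_norm // (subsetP (class_norm _ _)) // (subsetP sSG).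
  have iR v w : v \in S -> w \in S -> v \notin <[s]> -> w \notin <[s]> ->
      v * w^-1 \in <[s]>.
    move=> Sv Sw nv nw; have : v \in S :\: <[s]> by apply/setDP.
    suff <- : <[s]> :* w = S :\: <[s]> by rewrite mem_rcoset.
    apply/eqP; rewrite eqEcard card_rcoset cardsD (setIidPr _) ?cycle_subG //.
    rewrite -[#|<[s]>|]/#[s] oS os andbT; apply/subsetP=> _ /rcosetP[a Aa ->].
    by rewrite inE groupMl // nw groupM // (subsetP _ _ Aa) // cycle_subG.
  (* [S] has three cyclic subgroups of order 4, and by [fuse] each is fused with another one. A
     graph on three vertices without isolated vertex is connected. *)
  have all_cs v : v \in S -> v * v = x -> cs v.
    have As u : u \in S -> u \in <[s]> -> u * u = x -> cs u.
      move=> Su /cycleP[i Du] uu; have s4 : s ^+ 4 = 1.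
        by rewrite -[4]/(2 ^ 3.-1)%N -os expg_order.
      move: uu; rewrite Du -(expg_mod i s4); have : i %% 4 < 4 by rewrite ltn_mod.
      case: (i %% 4) => [|[|[|[|]]]] // _.
      - by rewrite expg0 mulg1 => x1; case/eqP: ntx.
      - by move=> _; rewrite /cs class_refl.
      - by rewrite expgS expg1 ss xx => x1; case/eqP: ntx.
      move=> _; rewrite (_ : s ^+ 3 = s^-1); first by apply: csx; rewrite // /cs class_refl.
      by apply: (mulgI s); rewrite mulgV -expgS.
    have ifs u v' : v' \in u ^: G -> cs v' -> cs u.
      by move=> uv csv'; apply/class_eqP; rewrite -(class_eqP uv) (class_eqP csv').
    move=> Sv vv; have [|nAv] := boolP (v \in <[s]>); first by move/As; apply.
    have [w Sw /andP[nAw csw]] := fuse s Ss ss.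
    have [v' Sv' /andP[nVv' vv']] := fuse v Sv vv.
    have sq a u : a * a = x -> u \in a ^: G -> u \in S -> u * u = x.
      move=> aa /imsetP[g Gg ->] Sag; have : a ^ g * a ^ g != 1 by rewrite -conjMg aa conjg_eq1.
      by have /or3P[/eqP->|/eqP->|/eqP//] := S4 _ Sag; rewrite ?mulg1 ?xx eqxx.
    have ww := sq s w ss csw Sw; have vv'x := sq v v' vv vv' Sv'.
    have [|nAv'] := boolP (v' \in <[s]>).
      by move/(As v' Sv') => /(_ vv'x); apply: ifs.
    have xcw : x * w = w^-1 by apply: (mulIg w); rewrite mulVg -mulgA ww xx.
    have Zw z : z * z = 1 -> z \in <[s]> -> cs (z * w).
      move=> zz Az; have Sz : z \in S by rewrite (subsetP _ _ Az) ?cycle_subG.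
      have [->|ntz] := eqVneq z 1; first by rewrite mul1g.
      by rewrite (invS z) // xcw; apply: csx.
    have AA a b : a \in <[s]> -> b \in <[s]> -> a * a = x -> b * b = x -> (a * b) * (a * b) = 1.
      move=> Aa Ab aa bb; have cab : commute a b by apply: (centsP (cycle_abelian s)).
      have := expgMn 2 cab; rewrite !expgS !expg0 !mulg1 aa bb xx.
      by [].
    have A2 a : a \in <[s]> -> a * a = 1 \/ a * a = x.
      move=> Aa; have Sa : a \in S by rewrite (subsetP _ _ Aa) ?cycle_subG.
      by have /or3P[/eqP->|/eqP->|/eqP->] := S4 _ Sa; rewrite ?mulg1; auto.
    have Aa := iR _ _ Sv' Sw nAv' nAw; have Ad := iR _ _ Sv' Sv nAv' nAv.
    have [aa|aa] := A2 _ Aa; first by apply: (ifs v v') => //; have := Zw _ aa Aa; rewrite mulgKV.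
    have [dd|dd] := A2 _ Ad.
      case/negP: nVv'; rewrite -(mulgKV v v') groupM ?cycle_id //.
      have Sd : v' * v^-1 \in S by rewrite groupM ?groupV.
      have [->|ntd] := eqVneq (v' * v^-1) 1; first by rewrite group1.
      by rewrite (invS _ Sd) // -vv groupM ?cycle_id.
    have Adi : (v' * v^-1)^-1 \in <[s]> by rewrite groupV.
    have ddi : (v' * v^-1)^-1 * (v' * v^-1)^-1 = x.
      by rewrite -invMg dd; apply/eqP; rewrite eq_invg_mul xx.
    have := Zw _ (AA _ _ Adi Aa ddi aa) (groupM Adi Aa).
    by rewrite invMg invgK !mulgA mulgKV mulgKV.
  apply: (@Q8_false _ G S x s t) => //.
  - by rewrite [s * t]conjgC st mulgKV.
  - by rewrite ZS.
  move=> u Su; have /or3P[->|->|/eqP uu] := S4 u Su; rewrite ?orbT //.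
  by rewrite -[_ \in _]/(cs u) all_cs ?orbT.
have n_gt3 : 3 < n by rewrite ltn_neqAle eq_sym n_neq3.
pose c := s ^+ (2 ^ n.-2.-1).
have n3E : n.-2 = n.-2.-1.+1 by case: (n) n_gt3 => [|[|[|[]]]].
have n1E : n.-1 = n.-2.+1 by case: (n) n_gt3 => [|[|[|[]]]].
have cc : c * c = x by rewrite Dx n3E expnS mulnC expgM.
apply: (@large_quaternion_false _ G S x s t c) => //.
- exact: mem_cycle.
- by rewrite ZS.
- move=> a Aa aa; have [->|nta] := eqVneq a 1; [by left | right].
  by apply: invS => //; rewrite (subsetP _ _ Aa) ?cycle_subG.
- move=> a Aa aa; have Sa : a \in S by rewrite (subsetP _ _ Aa) ?cycle_subG.
  have /p_natP[k oa] := mem_p_elt pS Sa.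
  have k_gt1 : 1 < k.
    case: k oa => [|[|]] // oa; case/eqP: aa.
      by move/eqP: oa; rewrite order_eq1 => /eqP->; rewrite mulg1.
    by have := expg_order a; rewrite oa.
  pose d := a ^+ (2 ^ k.-2); exists (2 ^ k.-2)%N; rewrite -/d.
  have Ad : d \in <[s]> by rewrite groupX.
  have dd : d * d = x.
    have dde : d * d = a ^+ (2 ^ k.-1).
      by rewrite -(prednK (_ : 0 < k.-1)) ?expnS 1?mulnC ?expgM //; case: (k) k_gt1 => [|[]].
    apply: invS; first by rewrite dde groupX.
      by rewrite dde -[_ * _](expgM a _ 2) mulnC -expnS prednK ?(ltnW k_gt1) // -oa expg_order.
    by rewrite dde -order_dvdn oa dvdn_Pexp2l // -ltnNge prednK ?(ltnW k_gt1).
  have Ac : c \in <[s]> by rewrite mem_cycle.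
  have cdc : commute d c^-1 by apply: (centsP (cycle_abelian s)); rewrite ?groupV.
  have : d * c^-1 * (d * c^-1) = 1.
    have := expgMn 2 cdc; rewrite !expgS !expg0 !mulg1 dd -invMg cc => ->.
    by rewrite mulgV.
  have [dc _|ntdc dc1] := eqVneq (d * c^-1) 1.
    by rewrite inE; apply/orP; left; rewrite inE eq_mulgV1 dc.
  have : d * c^-1 = x.
    by apply: invS => //; rewrite groupM ?groupV ?(subsetP _ _ Ad) ?(subsetP _ _ Ac) ?cycle_subG.
  move=> dcx; rewrite !inE; apply/orP; right; apply/eqP.
  rewrite -[d](mulgKV c) dcx; apply: (mulIg c); rewrite mulVg -mulgA cc xx.
  by [].
apply/negP=> /cycleP[i ssx].
have : s ^+ 4 = 1.
  have : (s * s) * (s * s) = 1 by rewrite ssx -expgMn // xx expg1n.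
  by rewrite -!mulgA.
move/eqP; rewrite -order_dvdn os -[4]/(2 ^ 2)%N dvdn_Pexp2l // -ltnS.
by rewrite (ltn_predK n_gt3) leqNgt n_gt3.
Qed.

(** * Classes of involutions whose products have odd prime order *)

Lemma invol_conjM (gT : finGroupType) (k l : gT) :
  k * k = 1 -> l * l = 1 -> (k * l) ^ k = (k * l)^-1.
Proof.
move=> kk ll; have kV : k^-1 = k by apply/eqP; rewrite eq_invg_mul kk.
have lV : l^-1 = l by apply/eqP; rewrite eq_invg_mul ll.
by rewrite conjgE invMg kV lV !mulgA kk mul1g.
Qed.

(** With d = k l, conjugating k by d^j gives k d^(2j), and 2j = p + 1. *)
Lemma dihedral_conj (gT : finGroupType) (p : nat) (k l : gT) : odd p ->
  k * k = 1 -> l * l = 1 -> (k * l) ^+ p = 1 -> k ^ ((k * l) ^+ (p.+1)./2) = l.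
Proof.
move=> odd_p kk ll klp; set d := k * l; set j := _./2.
have kV : k^-1 = k by apply/eqP; rewrite eq_invg_mul kk.
have lV : l^-1 = l by apply/eqP; rewrite eq_invg_mul ll.
have dk : d ^ k = d^-1 by apply: invol_conjM.
rewrite conjgE (conjgCV k) kV conjXg dk mulgA -expVgn -expgnDr addnn.
have -> : j.*2 = p.+1 by rewrite halfK /= odd_p subn0.
by rewrite expgS expVgn klp invg1 mulg1 /d invMg kV lV -mulgA kk mulg1.
Qed.

Section InvolutionClass.
Variables (gT : finGroupType) (p : nat).
Implicit Types (G H : {group gT}) (x : gT).

(** [dihedral_conj] conjugates by a power of [x * k], which lies in any subgroup containing both;
    this lets the induction on |G| pass to subgroups. *)
Lemma class_sub_invol G H x : odd p -> x * x = 1 ->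
    {in x ^: G &, forall k l, (k * l) ^+ p = 1} -> H \subset G -> x \in H ->
  x ^: G :&: H = x ^: H.
Proof.
move=> odd_p xx Kp sHG Hx; apply/setP=> k; apply/setIP/idP => [[Kk Hk]|]; last first.
  case/imsetP=> h Hh ->; rewrite groupJ // imset_f //.
  exact: (subsetP sHG).
have kk : k * k = 1 by case/imsetP: Kk => g _ ->; rewrite -conjMg xx conj1g.
rewrite -(dihedral_conj odd_p xx kk (Kp _ _ (class_refl _ _) Kk)).
by rewrite imset_f // groupX ?groupM.
Qed.

(** [phi k] is the midpoint of k and [k ^ y] in the dihedral group they generate, hence fixed by
    [y]. It maps the class equivariantly onto the class of [x] in C_G(y), and the midpoint is [x]
    exactly when [k ^ x = k ^ y], that is, when k commutes with [x * y]. *)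
Lemma class_invol_split G x y : odd p -> x * x = 1 -> y * y = 1 -> commute x y ->
    x \in G -> y \in G -> {in x ^: G &, forall k l, (k * l) ^+ p = 1} ->
  #|x ^: G| = (#|x ^: 'C_G[y]| * #|x ^: 'C_G[x * y]|)%N.
Proof.
move=> odd_p xx yy cxy Gx Gy Kp; set j := (p.+1)./2.
have j2 : j.*2 = p.+1 by rewrite halfK /= odd_p subn0.
pose phi k := k * (k * k ^ y) ^+ j.
have KK k : k \in x ^: G -> k * k = 1 by case/imsetP=> g _ ->; rewrite -conjMg xx conj1g.
have Ky k : k \in x ^: G -> k ^ y \in x ^: G.
  by move=> Kk; rewrite memJ_norm // (subsetP (class_norm _ _)).
have kV k : k \in x ^: G -> k^-1 = k by move=> Kk; apply/eqP; rewrite eq_invg_mul KK.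
have yV : y^-1 = y by apply/eqP; rewrite eq_invg_mul yy.
have dk k : k \in x ^: G -> (k * k ^ y) ^ k = (k * k ^ y)^-1.
  by move=> Kk; rewrite invol_conjM ?KK ?Ky.
have dy k : k \in x ^: G -> (k * k ^ y) ^ y = (k * k ^ y)^-1.
  by move=> Kk; rewrite conjMg -conjgM yy conjg1 invMg (kV _ (Ky _ Kk)) (kV _ Kk).
(* Conjugation by d^(j j) multiplies k by d^(2 j j), and 2j = p + 1 reduces this to d^j. *)
have phiE k : k \in x ^: G -> phi k = k ^ ((k * k ^ y) ^+ (j * j)).
  move=> Kk; rewrite /phi; set d := k * k ^ y; have dp : d ^+ p = 1 by rewrite Kp ?Ky.
  have kd i : d ^- i * k = k * d ^+ i.
    by rewrite -expVgn -(dk k Kk) -conjXg conjgC -conjgM KK // conjg1.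
  rewrite [RHS]conjgE mulgA kd -mulgA -expgnDr addnn -mul2n mulnA mul2n j2 mulSn expgnDr.
  by rewrite expgM dp expg1n mulg1.
have phiy k : k \in x ^: G -> phi k ^ y = phi k.
  move=> Kk; rewrite /phi conjMg conjXg dy //; set d := k * k ^ y.
  have dp : d ^+ p = 1 by rewrite Kp ?Ky.
  have -> : k ^ y = k * d by rewrite /d mulgA KK // mul1g.
  rewrite -mulgA; congr (k * _); apply: (mulIg (d ^+ j)).
  by rewrite -mulgA expVgn mulVg mulg1 -expgnDr addnn j2 expgS dp mulg1.
have phiK k : k \in x ^: G -> phi k \in x ^: 'C_G[y].
  move=> Kk; rewrite -(class_sub_invol odd_p xx Kp (subsetIl G 'C[y])); last first.
    by rewrite inE Gx; apply/cent1P.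
  have Gphi : phi k \in x ^: G.
    by rewrite phiE // memJ_norm // (subsetP (class_norm _ _)) // groupX // groupM //;
      apply: (subsetP (class_subG Gx (subxx G))); rewrite ?Ky.
  apply/setIP; split=> //; apply/setIP; split; first exact: (subsetP (class_subG Gx (subxx G))).
  by apply/cent1P; rewrite /commute conjgC phiy.
rewrite (@card_fibres _ 'C_G[y] _ x phi) //; first 1 last.
- by rewrite (subset_trans (subsetIl _ _)) ?class_norm.
- move=> u /setIP[Gu /cent1P cuy] k; rewrite /phi [RHS]conjMg [in RHS]conjXg [in RHS]conjMg.
  by rewrite -!conjgM cuy.
have Cxy : x \in 'C_G[x * y].
  by rewrite inE Gx; apply/cent1P/commuteM.
rewrite -(class_sub_invol odd_p xx Kp (subsetIl G 'C[x * y]) Cxy).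
congr (_ * _)%N; apply: eq_card => k; rewrite !in_setI inE; case Kk: (k \in x ^: G) => //=.
have Gk := subsetP (class_subG Gx (subxx G)) k Kk; rewrite Gk /=.
have Kx := class_refl G x; have dp : (k * k ^ y) ^+ p = 1 by rewrite Kp ?Ky.
apply/eqP/cent1P => [phikx | ckxy].
  have kxy : k ^ x = k ^ y.
    have kx : k = x * (k * k ^ y) ^- j by apply: (mulIg ((k * k ^ y) ^+ j)); rewrite mulgKV -phikx.
    have dx : (k * k ^ y) ^ x = (k * k ^ y)^-1.
      rewrite -{1}phikx /phi conjgM dk // conjVg; congr _^-1.
      by rewrite [LHS]conjgE -expgS expgSr mulKg.
    have := congr1 (conjg^~ x) kx; have := congr1 (conjg^~ y) kx.
    move: dx (dy k Kk); set d := k * k ^ y => dx' dy' /= -> ->.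
    rewrite !conjMg !conjVg !conjXg dx' dy'; congr (_ * _).
    by rewrite !conjgE cxy !mulKg.
  have : k ^ (x * y) = k by rewrite conjgM kxy -conjgM yy conjg1.
  by move=> kxyk; rewrite /commute conjgC kxyk.
have kxy : k ^ y = k ^ x.
  have : k ^ (x * y) = k by rewrite conjgE ckxy mulKg.
  by rewrite conjgM => e; rewrite -{1}e -(conjgM _ y y) yy conjg1.
have kkx : k * k ^ y = (k * x) * (k * x).
  by rewrite kxy conjgE (kV _ Kx) !mulgA.
rewrite /phi kkx -[(k * x) * (k * x)](_ : (k * x) ^+ 2 = _) // -expgM mul2n j2.
by rewrite expgS Kp // mulg1 mulgA KK // mul1g.
Qed.

End InvolutionClass.

(* x acts on the odd-order group O; it fixes a Sylow r-subgroup R since their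
   number is odd, and [r^-1 * r ^ x] is a product of two conjugates of x. *)
Lemma invol_cyclic_Sylow2_pnat (gT : finGroupType) (G S : {group gT}) (x : gT) (p : nat) :
    prime p -> odd p -> x * x = 1 -> {in x ^: G &, forall k l, (k * l) ^+ p = 1} ->
    2.-Sylow(G) S -> cyclic S -> x \in S -> S \subset 'C[x] -> <<x ^: G>> = G ->
  p.-nat #|x ^: G|.
Proof.
move=> p_pr odd_p xx Kp sylS cycS Sx cSx genG; have [sSG pS p'GS] := and3P sylS.
have Gx := subsetP sSG x Sx; pose O := 'O_2^'(G)%G.
have defG : O ><| S = G by apply: cyclic_Sylow2_sdprod.
have [nsO _ OS _ _] := sdprod_context defG.
have oddO : odd #|O| by rewrite odd_2'nat -/(pgroup _ _) pcore_pgroup.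
have nOx : x \in 'N(O) by rewrite (subsetP (normal_norm nsO)).
(* [S] centralizes [x], so O<x> is normal in G = O S; containing [x], it is all of [G]. *)
have sGOx : G \subset O <*> <[x]>.
  have nOxG : G \subset 'N(O <*> <[x]>).
    have sOJ : O \subset 'N(O <*> <[x]>).
      by rewrite (subset_trans (joing_subl O <[x]>)) ?normG.
    have nSO : S \subset 'N(O) := subset_trans sSG (normal_norm nsO).
    by rewrite -OS mul_subG // normsY // cents_norm // cent_cycle.
  by rewrite -{1}genG gen_subG class_sub_norm // mem_gen // inE cycle_id orbT.
have sxS : <[x]> \subset S by rewrite cycle_subG.
have px : 2.-group <[x]> := pgroupS sxS pS.
apply/pnatP=> [|r r_pr]; first by rewrite -index_cent1 indexg_gt0.
rewrite -index_cent1 => r_dv; rewrite inE; apply: contraLR r_dv => r_neq_p.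
have sSC : S \subset 'C_G[x] by rewrite subsetI sSG.
have [r2 | r_neq2] := eqVneq r 2.
  rewrite r2 dvdn2 negbK; apply: dvdn_odd (indexgS G sSC) _.
  by rewrite odd_2'nat.
have actsx : [acts <[x]>, on 'Syl_r(O) | 'JG].
  apply/actsP=> u xu P; rewrite !inE -{1}(normsP (normal_norm nsO) u _) ?pHallJ2 //.
  by rewrite (subsetP _ u xu) // cycle_subG.
have := pgroup_fix_mod px actsx; have : odd #|'Syl_r(O)|.
  by apply: dvdn_odd (card_Syl_dvd r O) oddO.
move=> oddSyl fix_mod; have [R] : exists R, R \in 'Fix_('Syl_r(O) | 'JG)(<[x]>).
  apply/set0Pn; rewrite -cards_eq0; apply: contraTneq oddSyl => fix0.
  by rewrite -dvdn2 /dvdn fix_mod fix0.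
case/setIP; rewrite inE => sylR /afixP fixR; have nRx : R :^ x = R.
  by have := fixR x (cycle_id x) => /(congr1 (@gval _)).
have [sRO rR r'R] := and3P sylR; have sRG := subset_trans sRO (normal_sub nsO).
have cRx : R \subset 'C_G[x].
  apply/subsetP=> u Ru; have Gu := subsetP sRG u Ru; rewrite inE Gu; apply/cent1P.
  have xuE : u^-1 * u ^ x = x ^ u * x.
    by rewrite !conjgE -[x^-1](_ : x = _) ?mulgA // ; apply/esym/eqP; rewrite eq_invg_mul xx.
  have Rux : u^-1 * u ^ x \in R by rewrite groupM ?groupV // -nRx memJ_conjg.
  have : u^-1 * u ^ x == 1.
    rewrite -order_eq1 -dvdn1; have [k oux] := p_natP (mem_p_elt rR Rux).
    have: #[u^-1 * u ^ x] %| p by rewrite order_dvdn xuE Kp ?class_refl ?imset_f.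
    have copr : coprime #[u^-1 * u ^ x] p.
      by rewrite oux coprimeXl // prime_coprime // dvdn_prime2.
    by rewrite -(Gauss_dvdr 1 copr) muln1.
  by rewrite -eq_mulVg1 => /eqP ux; rewrite /commute conjgC -ux.
apply/negP=> /dvdn_trans/(_ (indexgS G cRx)).
rewrite -(Lagrange_index (normal_sub nsO) sRO) Euclid_dvdM //.
have -> : #|G : O| = #|S|.
  by rewrite -divgS ?normal_sub // -(sdprod_card defG) mulKn ?cardG_gt0.
case/orP=> [rS | rR'].
  by have /pnatP := pS => /(_ (cardG_gt0 S) r r_pr rS); rewrite inE (negPf r_neq2).
by have /pnatP := r'R => /(_ (indexg_gt0 _ _) r r_pr rR'); rewrite !inE eqxx.
Qed.

(** If k l is central then k and l commute, and their product has odd order. Thus |K| is unchanged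
    in G / Z(G). *)
Lemma quotient_center_invol_class (gT : finGroupType) (G : {group gT}) (x : gT) (p : nat) :
    odd p -> x * x = 1 -> x \in G -> {in x ^: G &, forall k l, (k * l) ^+ p = 1} ->
  {in x ^: G &, injective (coset 'Z(G))}.
Proof.
move=> odd_p xx Gx Kp k l Kk Kl kl.
have kk : k * k = 1 by case/imsetP: Kk => g _ ->; rewrite -conjMg xx conj1g.
have ll : l * l = 1 by case/imsetP: Kl => g _ ->; rewrite -conjMg xx conj1g.
have sKG := subsetP (class_subG Gx (subxx G)).
have nZ g : g \in G -> g \in 'N('Z(G)) by move=> Gg; rewrite (subsetP (gFnorm _ _)).
have lV : l^-1 = l by apply/eqP; rewrite eq_invg_mul ll.
have Zkl : k * l \in 'Z(G).
  by have /(rcoset_kercosetP (nZ k (sKG k Kk)) (nZ l (sKG l Kl))) := kl; rewrite mem_rcoset lV.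
apply: odd_commute_invol_eq => //; last first.
  by apply: dvdn_odd odd_p; rewrite order_dvdn Kp.
have /centerP[_ ckl] := Zkl; have := ckl k (sKG k Kk).
by rewrite /commute -mulgA => /mulgI.
Qed.

Lemma invol_class_pnat (p : nat) : prime p -> odd p ->
  forall (gT : finGroupType) (G : {group gT}) (x : gT), x \in G -> x * x = 1 ->
    {in x ^: G &, forall k l, (k * l) ^+ p = 1} -> p.-nat #|x ^: G|.
Proof.
move=> p_pr odd_p gT G; have [n] := ubnP #|G|.
elim: n gT G => // n IHn gT G leGn x Gx xx Kp.
have IHsub (H : {group gT}) : H \proper G -> x \in H -> p.-nat #|x ^: H|.
  move=> prHG Hx; apply: IHn Hx xx _.
    by rewrite -ltnS (leq_trans _ leGn) // ltnS proper_card.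
  have sKHG : x ^: H \subset x ^: G by rewrite imsetS ?proper_sub.
  by move=> k l Hk Hl; apply: Kp; apply: (subsetP sKHG).
have [genG | ngenG] := eqVneq <<x ^: G>> G; last first.
  have sHG : <<x ^: G>> \subset G by rewrite gen_subG class_subG.
  have Hx : x \in <<x ^: G>> by rewrite mem_gen ?class_refl.
  rewrite -(setIidPl (subset_gen (x ^: G))) (class_sub_invol odd_p xx Kp sHG Hx).
  by apply: IHsub => //; rewrite properEneq ngenG.
have nKG := class_norm x G; have sKG := class_subG Gx (subxx G).
have [Z1 | ntZ] := eqsVneq 'Z(G) 1; last first.
  have nZG : G \subset 'N('Z(G)) := normal_norm (center_normal G).
  have sKN := subset_trans sKG nZG; have Nx := subsetP nZG x Gx.
  rewrite -(card_in_imset (quotient_center_invol_class odd_p xx Gx Kp)).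
  rewrite -(morphimEsub (coset_morphism 'Z(G)) sKN) -quotientE (quotient_class Nx nZG).
  apply: IHn; first 1 [exact: leq_trans (ltn_quotient ntZ (center_sub G)) _ | idtac].
  - exact: mem_quotient.
  - by rewrite -morphM // xx morph1.
  rewrite -(quotient_class Nx nZG) => _ _ /morphimP[k Nk Kk ->] /morphimP[l Nl Kl ->].
  by rewrite -morphM // -morphX ?groupM // Kp // morph1.
have [-> | ntx] := eqVneq x 1; first by rewrite class1G cards1.
have [y /and4P[Cy ntyx yy nty] | uniq_x] :=
  pickP [pred y in 'C_G[x] | [&& y != x, y * y == 1 & y != 1]].
  have /setIP[Gy /cent1P cyx] := Cy; have cxy := commute_sym cyx.
  have prC z : z \in G -> z != 1 -> 'C_G[z] \proper G.
    move=> Gz ntz; rewrite properE subsetIl; apply: contra ntz => /subsetIP[_ sGC].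
    rewrite -in_set1 -set1gE -Z1; apply/centerP; split=> // u Gu.
    by apply/commute_sym/cent1P/(subsetP sGC).
  rewrite (class_invol_split odd_p xx (eqP yy) cxy Gx Gy Kp) pnatM.
  rewrite !IHsub ?prC ?groupM //; try by rewrite inE Gx; apply/cent1P => //; apply: commuteM.
  by apply: contraNneq ntyx => xy1; rewrite -[y](mulKg x) xy1 mulg1 eq_invg_mul xx.
have {}uniq_x u : u \in 'C_G[x] -> u * u = 1 -> u != 1 -> u = x.
  move=> Cu uu ntu; have /= := uniq_x u; rewrite Cu uu eqxx ntu !andbT => /negbFE/eqP.
  by [].
have p2x : 2.-elt x by rewrite /p_elt (@nt_prime_order _ 2) // !expgS expg0 mulg1.
(* By [uniq_x], conjugation by [x] fixes only [x] in its class. As |K| = |G : C_G(x)| is odd, a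
   Sylow 2-subgroup of the centralizer is Sylow in [G]. *)
have oddK : odd #|x ^: G|.
  have actsx : [acts <[x]>, on x ^: G | 'J].
    by rewrite astabsJ (subset_trans _ nKG) // cycle_subG.
  have := pgroup_fix_mod p2x actsx; rewrite (_ : 'Fix_(_ | _)(_) = [set x]).
    by rewrite cards1 !modn2; case: odd.
  apply/setP=> k; rewrite in_setI inE; apply/andP/eqP => [[Kk /afixP/(_ x (cycle_id x)) kx] | ->].
    apply: uniq_x.
    - rewrite inE (subsetP sKG) //; apply/cent1P.
      by rewrite /commute conjgC; congr (_ * _).
    - by case/imsetP: Kk => g _ ->; rewrite -conjMg xx conj1g.
    by case/imsetP: Kk => g _ ->; rewrite conjg_eq1.
  split; first exact: class_refl.
  by apply/afixP=> u /cycleP[i ->]; rewrite /= conjgE (commuteX i (commute_refl x)) mulKg.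
have [S sylSC] := Sylow_exists 2 'C_G[x]; have [sSC pS p'S] := and3P sylSC.
have sSG := subset_trans sSC (subsetIl _ _).
have sylS : 2.-Sylow(G) S.
  rewrite /pHall sSG pS -(Lagrange_index (subsetIl G 'C[x]) sSC) pnatM index_cent1.
  by rewrite -odd_2'nat oddK.
have cSx : S \subset 'C[x] := subset_trans sSC (subsetIr _ _).
have Cx : x \in 'C_G[x] by rewrite inE Gx cent1id.
have Sx : x \in S.
  have nsx : <[x]> <| 'C_G[x].
    by rewrite /normal cycle_subG Cx cents_norm // cent_cycle subsetIr.
  by rewrite -cycle_subG (subset_trans (pcore_max p2x nsx)) ?pcore_sub_Hall.
have ntS : S :!=: 1 by apply: contraNneq ntx => S1; rewrite -in_set1 -set1gE -S1.
have oOhm : #|'Ohm_1(S)| = 2.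
  have -> : 'Ohm_1(S) = <[x]>.
    apply/eqP; rewrite (OhmE 1 pS) eqEsubset gen_subG cycle_subG; apply/andP; split.
      apply/subsetP=> u /LdivP[Su u2]; have [->|ntu] := eqVneq u 1; first exact: group1.
      by rewrite (uniq_x u) ?cycle_id // (subsetP sSC).
    by rewrite mem_gen //; apply/LdivP; rewrite !expgS expg0 mulg1.
  by rewrite -[#|_|]/#[x] (@nt_prime_order _ 2) // !expgS expg0 mulg1.
have := introT (prime_Ohm1P pS ntS) oOhm; case/orP=> [cycS | /andP[_ /eqP qS]].
  exact: invol_cyclic_Sylow2_pnat odd_p xx Kp sylS cycS Sx cSx genG.
have [m m_gt2 isoS] := (quaternion_classP S).1 qS.
have ox : #[x] = 2 by rewrite (@nt_prime_order _ 2) // !expgS expg0 mulg1.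
case: (quaternion_Sylow2_false sylS m_gt2 isoS Sx ox genG) => k l Kk Kl.
by apply: dvdn_odd odd_p; rewrite order_dvdn Kp.
Qed.

Lemma invol_class_pgroup (gT : finGroupType) (G : {group gT}) (x : gT) (p : nat) :
    prime p -> odd p -> x \in G -> x * x = 1 ->
    {in x ^: G &, forall k l, (k * l) ^+ p = 1} -> p.-nat #|x ^: G| ->
  exists2 P : {group gT}, p.-group P & {in x ^: G, forall k, x * k \in P}.
Proof.
move=> p_pr odd_p Gx xx Kp pK.
have sKG := subsetP (class_subG Gx (subxx G)).
have xV : x^-1 = x by apply/eqP; rewrite eq_invg_mul xx.
pose gP (Q : {group gT}) := [&& p.-group Q, Q \subset G & x \in 'N(Q)].
have [|P maxP _] := @maxgroup_exists _ gP 1%G.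
  by rewrite /gP pgroup1 sub1G norm1 inE.
have [/and3P[pP sPG nPx] maxPP] := maxgroupP maxP.
(* If k normalizes [P], adjoining [x * k] gives a p-group still normalized by [x], which inverts
   [x * k]; maximality puts [x * k] in [P]. *)
have KN k : k \in x ^: G -> k \in 'N(P) -> x * k \in P.
  move=> Kk nPk; have kk : k * k = 1 by case/imsetP: Kk => g _ ->; rewrite -conjMg xx conj1g.
  have nPd : <[x * k]> \subset 'N(P) by rewrite cycle_subG groupM.
  have defQ := norm_joinEr nPd.
  have gQ : gP (P <*> <[x * k]>)%G.
    apply/and3P; split=> /=.
    - rewrite defQ pgroupM pP /= /pgroup -orderE.
      by apply: pnat_dvd (pnat_id p_pr); rewrite order_dvdn Kp ?class_refl.
    - by rewrite join_subG sPG cycle_subG groupM // sKG.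
    rewrite -cycle_subG normsY ?cycle_subG //; apply/normP.
    by rewrite -cycleJ invol_conjM // cycleV.
  have := maxPP _ gQ (joing_subl _ _) => /= <-.
  by rewrite mem_gen // inE cycle_id orbT.
have sylP : p.-Sylow(G) P.
  have [P1 sylP1 sPP1] := Sylow_superset sPG pP.
  have [-> // | nPP1] := eqVneq P P1.
  have [sP1G pP1 _] := and3P sylP1.
  have prPP1 : P \proper P1 by rewrite properEneq nPP1.
  pose Q := 'N_P1(P)%G; have prPQ := nilpotent_proper_norm (pgroup_nil pP1) prPP1.
  suff eQP : Q :=: P.
    have := proper_card prPQ; have /= -> := congr1 (fun A : {set gT} => #|A|) eQP.
    by rewrite ltnn.
  apply: (maxPP Q _ (proper_sub prPQ)); apply/and3P; split.
  - by apply: pgroupS pP1; apply: subsetIl.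
  - exact: subset_trans (subsetIl _ _) sP1G.
  rewrite inE; apply/subsetP=> _ /imsetP[u Qu ->]; have /setIP[P1u nPu] := Qu.
  have Gu := subsetP sP1G u P1u.
  have Pux : x * x ^ u \in P by rewrite KN ?imset_f // groupJ.
  have -> : u ^ x = u * (x * x ^ u)^-1.
    by rewrite invMg !conjgE !invMg xV invgK !mulgA mulgV mul1g.
  by rewrite groupM // groupV (subsetP (proper_sub prPQ)).
have cpP : #|P| = (#|x ^: G| * #|'C_G[x]|`_p)%N.
  rewrite (card_Hall sylP) -(Lagrange (subsetIl G 'C[x])) index_cent1.
  by rewrite partnM ?cardG_gt0 -?index_cent1 ?indexg_gt0 // index_cent1 mulnC part_pnat_id.
have GCP : 'C_G[x] * P = G.
  apply/eqP; rewrite eqEcard mul_subG ?subsetIl //=.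
  have I_gt0 : 0 < #|'C_G[x] :&: P| by apply: cardG_gt0.
  rewrite -(leq_pmul2r I_gt0) -mul_cardG cpP mulnCA.
  rewrite -{1}(Lagrange (subsetIl G 'C[x])) index_cent1 [X in X * _ <= _]mulnC -!mulnA.
  rewrite !leq_mul2l; apply/orP; right; apply/orP; right.
  have pI : p.-group ('C_G[x] :&: P) := pgroupS (subsetIr _ _) pP.
  by rewrite -(part_pnat_id pI) dvdn_leq ?part_gt0 // partn_dvd ?cardG_gt0 // cardSg ?subsetIl.
exists P => // k /imsetP[g + ->]; rewrite -{1}GCP => /mulsgP[c u /setIP[_ /cent1P cxc] Pu ->].
rewrite conjgM (_ : x ^ c = x); last by rewrite conjgE -cxc mulKg.
have -> : x * x ^ u = (u^-1) ^ x * u by rewrite !conjgE xV !mulgA.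
by rewrite groupM // memJ_norm ?groupV.
Qed.

(** * Classes whose square is the identity and one class *)

Lemma gen_abelem (gT : finGroupType) p (A : {set gT}) :
  prime p -> {in A &, commutative *%g} -> {in A, forall a, a ^+ p = 1} ->
  p.-abelem <<A>>.
Proof.
move=> pr_p cAA Ap1.
have abA : abelian <<A>>.
  by rewrite abelian_gen; apply/centsP=> a Aa b Ab; apply: cAA.
rewrite abelemE // abA; apply/exponentP=> u Au.
have gL := group_Ldiv p abA.
have : <<A>> \subset Group gL.
  by rewrite gen_subG; apply/subsetP=> a Aa; rewrite /= !inE mem_gen // Ap1 /=.
by move/subsetP/(_ u Au)/LdivP=> [].
Qed.

Lemma dvdn_ge_pred m q : 2 < q -> q.-1 <= m -> m %| q -> m = q.
Proof. by move=> q3 qm /dvdnP[[|[|c]]]; nia. Qed.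

Section SquareOfClass.
Variables (gT : finGroupType) (G : {group gT}) (x : gT) (D : {set gT}).
Let K := x ^: G.
Hypotheses (Gx : x \in G) (classD : D \in classes G) (sqK : K * K = [set 1] :|: D).

Let Kx : x \in K. Proof. exact: class_refl. Qed.
Let sKG : K \subset G. Proof. exact: class_subG. Qed.
Let nKG : G \subset 'N(K). Proof. exact: class_norm. Qed.
Let KJ k u : u \in G -> (k ^ u \in K) = (k \in K).
Proof. by move=> Gu; rewrite memJ_norm ?(subsetP nKG). Qed.
Let nDG : G \subset 'N(D). Proof. by have /imsetP[d _ ->] := classD; apply: class_norm. Qed.
Let KKP k l : k \in K -> l \in K -> (k * l == 1) || (k * l \in D).
Proof. by move=> Kk Kl; have := mem_mulg Kk Kl; rewrite sqK !inE. Qed.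
Let DKK d : d \in D -> exists2 k, k \in K & exists2 l, l \in K & d = k * l.
Proof.
move=> Dd; have : d \in K * K by rewrite sqK inE Dd orbT.
by case/mulsgP=> k l Kk Kl ->; exists k => //; exists l.
Qed.

(** 1 in K K gives one element of [K] whose inverse is in [K]; conjugation gives the rest. *)
Let KV k : k \in K -> k^-1 \in K.
Proof.
have : 1 \in K * K by rewrite sqK !inE eqxx.
case/mulsgP=> a b Ka Kb ab; have {}Kb : a^-1 \in K by rewrite -[a^-1]mulg1 ab mulKg.
case/imsetP=> g Gg ->; rewrite -conjVg KJ //.
by case/imsetP: Ka Kb => h Gh ->; rewrite -conjVg KJ.
Qed.

Let KVK k l : k \in K -> l \in K -> (k^-1 * l == 1) || (k^-1 * l \in D).
Proof. by move/KV; apply: KKP. Qed.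

Lemma gen_class_comm : <<D>> = [~: [set x], G].
Proof.
apply/eqP; rewrite eqEsubset !gen_subG; apply/andP; split; apply/subsetP.
  move=> _ /DKK[k /KV Kk [l Kl ->]]; rewrite -[k]invgK.
  case/imsetP: Kk => h Gh ->; case/imsetP: Kl => g Gg ->.
  have -> : (x ^ h)^-1 * x ^ g = [~ x, h]^-1 * [~ x, g].
    by rewrite /commg !invMg !invgK !mulgA mulgK.
  by rewrite groupM ?groupV ?mem_commg ?set11.
move=> _ /imset2P[y g /set1P-> Gg ->].
have Kxg : x ^ g \in K by rewrite KJ.
rewrite commgEl; by have /orP[/eqP->|Dxg] := KVK Kx Kxg; [apply: group1 | apply: mem_gen].
Qed.

Let sDK : D \subset <<K>>.
Proof. by apply/subsetP=> _ /DKK[k Kk [l Kl ->]]; rewrite groupM ?mem_gen. Qed.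
Let xxD : x * x \in <<D>>.
Proof. by have /orP[/eqP->|Dxx] := KKP Kx Kx; [apply: group1 | apply: mem_gen]. Qed.
Let nDx : <[x]> \subset 'N(<<D>>).
Proof. by rewrite cycle_subG (subsetP _ x Gx) // norms_gen. Qed.

Lemma gen_class_mul : <<K>> = <[x]> * [~: [set x], G].
Proof.
rewrite -gen_class_comm -(norm_joinEl nDx); apply/eqP; rewrite eqEsubset join_subG.
apply/and3P; split; last by rewrite gen_subG.
  rewrite gen_subG; apply/subsetP=> k Kk; rewrite -[k](mulKVg x).
  have xD : x^-1 * k \in <<D>>.
    by have /orP[/eqP->|] := KVK Kx Kk; [apply: group1 | apply: mem_gen].
  by rewrite groupM // mem_gen // inE ?cycle_id // xD orbT.
by rewrite cycle_subG mem_gen.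
Qed.

Let quoK : <<K>> / <<D>> = <[coset <<D>> x]>.
Proof.
rewrite gen_class_mul -gen_class_comm quotientMidr quotient_cycle //.
by rewrite -cycle_subG.
Qed.

Lemma gen_class_index : #|<<K>> / <<D>>| <= 2.
Proof.
have Nx : x \in 'N(<<D>>) by rewrite -cycle_subG.
rewrite quoK dvdn_leq // order_dvdn; apply/eqP.
by rewrite -morphX //; apply: coset_id.
Qed.

Lemma gen_class_sol : solvable <<D>> -> solvable <<K>>.
Proof.
move=> solD; have nsDK : <<D>> <| <<K>>.
  rewrite /normal gen_subG sDK norms_gen // (subset_trans _ nDG) //.
  by rewrite gen_subG.
by rewrite (series_sol nsDK) solD quoK abelian_sol ?cycle_abelian.
Qed.

Lemma class_card1_gen : #|K| = 1%N -> <<D>> = 1.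
Proof.
move=> K1; have {}K1 : K = [set x].
  by apply/esym/eqP; rewrite eqEcard sub1set Kx cards1 K1.
have x2 : x * x = 1.
  by apply/esym/set1P; rewrite -[[set _]]mulg_set1 -K1 sqK !inE eqxx.
apply/trivgP; rewrite gen_subG; apply/subsetP=> _ /DKK[k + [l + ->]].
by rewrite K1 => /set1P-> /set1P->; rewrite x2 inE.
Qed.

Section Card2.
Hypothesis K2 : #|K| = 2.

Lemma class_card2_invol : #[x] = 2 ->
  [/\ <<K>> \isog [set: 'Z_2 * 'Z_2], <<D>> \isog [set: 'Z_2]
    & <<D>> \subset 'Z(G)].
Proof.
move=> ox; have x2 : x * x = 1 by rewrite -[x * x]/(x ^+ 2) -ox expg_order.
have : #|K :\ x| == 1%N by move/eqP: K2; rewrite (cardsD1 x) Kx.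
case/cards1P=> k Kdef; have : k \in K :\ x by rewrite Kdef set11.
case/setD1P=> nkx Kk; have {}Kdef : K = [set x; k].
  by rewrite -Kdef setD1K.
have k2 : k * k = 1.
  by case/imsetP: Kk => g _ ->; rewrite -conjMg x2 conj1g.
have cxk : k * x = x * k.
  have : k ^ x \in K by rewrite KJ.
  rewrite {1}Kdef => /set2P[kxx|kxk].
    by case/negP: nkx; rewrite -(inj_eq (conjg_inj x)) kxx conjgE mulKg.
  by rewrite -{2}kxk conjgE mulgA mulgV mul1g.
have nxk1 : x * k != 1.
  by apply: contra nkx => /eqP xk1; rewrite -[k]mul1g -x2 -mulgA xk1 mulg1.
have Dxk : x * k \in D by have := KKP Kx Kk; rewrite (negPf nxk1).
have sD d : d \in D -> d = 1 \/ d = x * k.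
  case/DKK=> a + [b + ->]; rewrite Kdef => /set2P[]-> /set2P[]->; rewrite ?x2 ?k2 ?cxk; auto.
have D1 : D = [set x * k].
  apply/setP=> d; rewrite inE; apply/idP/eqP=> [Dd|-> //].
  case: (sD d Dd) => // d1; case/imsetP: classD => e _ De.
  case/negP: nxk1; move: Dxk Dd; rewrite De d1 => /imsetP[g _ ->] /imsetP[h _ /esym/eqP].
  by rewrite conjg_eq1 => /eqP->; rewrite conj1g.
have xk2 : (x * k) ^+ 2 = 1.
  by rewrite expgS expg1 -{1}cxk mulgA -(mulgA k) x2 mulg1 k2.
have oxk : #[x * k] = 2 by apply: nt_prime_order.
have gD : <<D>> = <[x * k]> by rewrite D1.
have cK : #|<<K>>| = 4.
  have nx : x \notin <[x * k]>.
    rewrite cycle2g //; apply/set2P=> -[x1|].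
      by move: ox; rewrite x1 order1.
    rewrite -{1}[x]mulg1 => /mulgI k1; case/imsetP: Kk ox => g _.
    by rewrite -k1 => /esym/eqP; rewrite conjg_eq1 => /eqP->; rewrite order1.
  rewrite gen_class_mul -gen_class_comm gD TI_cardMg -?orderE ?ox ?oxk //.
  by apply: prime_TIg; rewrite -?orderE ?ox //= cycle_subG.
split.
- have abK : 2.-abelem <<K>>.
    apply: gen_abelem => //; rewrite Kdef.
      by move=> a b /set2P[]-> /set2P[]->.
    by move=> a /set2P[]->.
  rewrite (isog_abelem_card _ abK); apply/andP; split.
    apply/abelemP=> //; split=> [|[a b] _].
      apply/centsP=> -[a b] _ [c d] _; congr (_, _); exact: Zp_mulgC.
    by case: a => -[|[|]] // ?; case: b => -[|[|]] // ?; congr (_, _); apply: val_inj.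
  rewrite cardsT card_prod !card_ord; apply/eqP.
  by rewrite /= cK.
- rewrite gD isog_cyclic_card ?cycle_cyclic // cardsT card_ord -orderE oxk eqxx andbT.
  by apply/cyclicP; exists Zp1; apply: Zp_cycle.
rewrite gen_subG D1 sub1set; apply/centerP; split.
  by rewrite groupM // (subsetP sKG).
move=> g Gg; apply/commgP; apply/conjg_fixP; apply/set1P; rewrite -D1 memJ_norm //.
by apply: (subsetP nDG).
Qed.

Lemma class_card2_cyclic n : #[x] = n -> 2 < n ->
  <<K>> \isog [set: 'Z_n] /\ cyclic <<D>>.
Proof.
move=> ox n_gt2; have Vx : x^-1 != x.
  apply/eqP=> Vx; have : #[x] <= 2.
    by rewrite dvdn_leq // order_dvdn expgS expg1 -{1}Vx mulVg.
  by rewrite ox leqNgt n_gt2.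
have Kdef : K = [set x; x^-1].
  apply/esym/eqP; rewrite eqEcard subUset !sub1set Kx KV //= cards2 eq_sym Vx.
  by rewrite K2.
have gK : <<K>> = <[x]>.
  apply/eqP; rewrite eqEsubset gen_subG cycle_subG mem_gen // andbT Kdef.
  by rewrite subUset !sub1set groupV cycle_id.
split; last by apply: cyclicS (cycle_cyclic x); rewrite /= -gK gen_subG.
rewrite gK isog_cyclic_card ?cycle_cyclic // cardsT card_ord -orderE ox.
rewrite Zp_cast ?(ltnW n_gt2) // eqxx andbT.
by apply/cyclicP; exists Zp1; apply: Zp_cycle.
Qed.

End Card2.

Let DJ d e : d \in D -> e \in D -> exists2 g, g \in G & e = d ^ g.
Proof.
case/imsetP: classD => c _ -> /imsetP[g Gg ->] /imsetP[h Gh ->].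
by exists (g^-1 * h); rewrite ?groupM ?groupV // -conjgM mulKVg.
Qed.
Let orderD d e : d \in D -> e \in D -> #[d] = #[e].
Proof. by move=> Dd /(DJ Dd)[g _ ->]; rewrite orderJ. Qed.
Let KKX n d k l : d \in D -> d ^+ n = 1 -> k \in K -> l \in K -> (k * l) ^+ n = 1.
Proof.
move=> Dd dn Kk Kl; have /orP[/eqP->|Dkl] := KKP Kk Kl; first exact: expg1n.
by have [g _ ->] := DJ Dd Dkl; rewrite -conjXg dn conj1g.
Qed.

Section Card3.
Hypothesis K3 : 3 <= #|K|.

Let D1 : 1 \notin D.
Proof.
apply/negP=> D1; have {D1} KK1 : {in K &, forall k l, k * l = 1}.
  by move=> k l Kk Kl; rewrite -[_ * _]expg1; apply: KKX D1 (expg1 1) Kk Kl.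
have: K \subset [set x^-1].
  apply/subsetP=> k Kk; rewrite inE.
  by rewrite eq_sym eq_invg_mul KK1.
by move/subset_leq_card; rewrite cards1 leqNgt (leq_trans _ K3).
Qed.

Lemma class_card3_invol : #[x] = 2 ->
  (2.-abelem <<K>> /\ 2.-abelem <<D>>)
  \/ (exists p r : nat,
        [/\ prime p, odd p, 0 < r, p.-group <<D>> & #|K| = p ^ r]%N).
Proof.
move=> ox; have x2 : x * x = 1 by rewrite -[x * x]/(x ^+ 2) -ox expg_order.
have K_2 k : k \in K -> k * k = 1.
  by case/imsetP=> g _ ->; rewrite -conjMg x2 conj1g.
have V k : k \in K -> k^-1 = k.
  by move=> Kk; rewrite -[k^-1]mul1g -(K_2 k Kk) mulgK.
have [k /setD1P[nkx Kk]] : exists k, k \in K :\ x.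
  apply/set0Pn; rewrite -card_gt0; move: K3; rewrite (cardsD1 x) Kx.
  by case: #|_|.
pose d := x * k; have nd1 : d != 1.
  by apply: contra nkx; rewrite /d -eq_invg_mul V // eq_sym.
have Dd : d \in D by have := KKP Kx Kk; rewrite (negPf nd1).
have [d2|nd2] := eqVneq (d * d) 1; [left | right].
  have abK : 2.-abelem <<K>>.
    apply: gen_abelem => // a b Ka Kb; have : (a * b) ^+ 2 = 1 by apply: (KKX (n := 2) Dd d2).
    by move/eqP; rewrite expgS expg1 -eq_invg_mul invMg !V // => /eqP.
  by split=> //; apply: abelemS abK; rewrite gen_subG.
have dx : d ^ x = d^-1 by apply: invol_conjM; rewrite ?K_2.
(* [x] inverts [d], so even powers of [d] are again products of two elements of [K]. *)
have DX i : d ^+ i ^+ 2 != 1 -> d ^+ i ^+ 2 \in D.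
  have <- : x * x ^ (d ^+ i) = d ^+ i ^+ 2.
    by rewrite conjgE !mulgA -{1}[x]V // -[x^-1 * _ * x]mulgA -conjgE conjVg conjXg dx expgVn invgK.
  have Kxd : x ^ (d ^+ i) \in K.
    by rewrite KJ // groupX // groupM // (subsetP sKG).
  by move=> n1; have := KKP Kx Kxd; rewrite (negPf n1).
(* Otherwise d^2, a member of [D], has half the order of [d], though [D] is one class. *)
have m_odd : odd #[d].
  case: (boolP (odd #[d])) => //; rewrite -dvdn2 => /orderXdiv.
  have Dd2 : d ^+ 2 \in D := DX 1%N nd2.
  rewrite -(orderD Dd Dd2) => /eqP; rewrite eqn_leq [X in X && _]leqNgt.
  by rewrite ltn_Pdiv.
set m := #[d] in m_odd; have m_gt1 : 1 < m by rewrite order_gt1.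
pose p := pdiv m; have pr_p : prime p by apply: pdiv_prime.
have p_odd : odd p by apply: dvdn_odd (pdiv_dvd m) m_odd.
pose j := m %/ p; have jp : (j * p)%N = m by rewrite divnK ?pdiv_dvd.
have oj : #[d ^+ j] = p.
  rewrite orderXdiv -/m; last by rewrite -jp dvdn_mulr.
  by rewrite -jp mulKn //; move: (order_gt0 d); rewrite -/m -jp muln_gt0 => /andP[].
have Dj : d ^+ j \in D.
  have ej : d ^+ j = d ^+ (j * m.+1./2) ^+ 2.
    rewrite -expgM -mulnA muln2 halfK /= m_odd subn0 mulnS expgD.
    by rewrite mulnC [X in _ * X]expgM expg_order expg1n mulg1.
  by rewrite ej DX // -ej -order_eq1 oj; case: (p) pr_p => [|[]].
have KKp : {in K &, forall k l, (k * l) ^+ p = 1}.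
  by move=> a b Ka Kb; apply: KKX Dj _ Ka Kb; rewrite -oj expg_order.
have pK := invol_class_pnat pr_p p_odd Gx x2 KKp.
have [P pP KP] := invol_class_pgroup pr_p p_odd Gx x2 KKp pK.
have [r Kr] := p_natP pK.
exists p, r; split=> //.
  by case: r Kr K3 => // ->.
apply: pgroupS pP; rewrite gen_subG; apply/subsetP=> _ /DKK[a Ka [b Kb ->]].
have -> : a * b = (x * a)^-1 * (x * b) by rewrite invMg !V // -mulgA (mulgA x) x2 mul1g.
by rewrite groupM ?groupV ?KP.
Qed.

Lemma class_card3_order_gt2 : 2 < #[x] ->
  exists p : nat,
    [/\ prime p, odd p, p.-abelem <<D>> & #[x] = p \/ #[x] = (2 * p)%N].
Proof.
move=> ox; have nx2 : x * x != 1.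
  apply: contraL ox => /eqP x2; rewrite -leqNgt dvdn_leq // order_dvdn.
  exact/eqP.
have Dxx : x * x \in D by have := KKP Kx Kx; rewrite (negPf nx2).
have Ddef : D = (x * x) ^: G.
  by case/imsetP: classD Dxx => d _ -> /class_eqP.
have sC : 'C_G[x] \subset 'C_G[x * x].
  apply/subsetP=> c /setIP[Gc /cent1P cx]; apply/setIP; split=> //.
  by apply/cent1P; apply: commuteM.
have dvDK : #|D| %| #|K|.
  rewrite Ddef -!index_cent1.
  by rewrite -(Lagrange_index (subsetIl G _) sC) dvdn_mulr.
have sKaD a : a \in K -> (K :* a^-1) :\ 1 \subset D.
  move=> Ka; apply/subsetP=> d /setD1P[nd1 /rcosetP[b Kb def_d]].
  by have := KKP Kb (KV Ka); rewrite -def_d (negPf nd1).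
have Ka1 a : a \in K -> #|(K :* a^-1) :\ 1| = #|K|.-1.
  move=> Ka; rewrite -(card_rcoset K a^-1) [in RHS](cardsD1 1) mem_rcoset.
  by rewrite invgK mul1g Ka.
have cDK : #|D| = #|K|.
  have leKD : #|K|.-1 <= #|D| by rewrite -(Ka1 x Kx) subset_leq_card ?sKaD.
  exact: dvdn_ge_pred.
(* As |D| = |K|, each a in [K] is moved out of [K] by exactly one d in [D]. Since |miss d| is
   constant on the class [D], double counting makes it 1. *)
pose miss d := [set a in K | d * a \notin K].
have missJ d g : g \in G -> #|miss (d ^ g)| = #|miss d|.
  move=> Gg; rewrite -(cardJg (miss d) g); congr #|pred_of_set _|; apply/setP=> a.
  rewrite mem_conjg !inE -(KJ a (groupVr Gg)).
  by rewrite -(KJ (d ^ g * a) (groupVr Gg)) conjMg conjgK.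
have miss_a a : a \in K -> #|[set d in D | d * a \notin K]| = 1%N.
  move=> Ka; have -> : [set d in D | d * a \notin K] = D :\: ((K :* a^-1) :\ 1).
    apply/setP=> d; rewrite !inE mem_rcoset invgK andbC.
    by have [->|//] := eqVneq d 1; rewrite (negPf D1) !andbF.
  by rewrite cardsD (setIidPr (sKaD a Ka)) Ka1 // cDK; case: #|_| K3 => // n; rewrite subSnn.
have miss1 d : d \in D -> #|miss d| = 1%N.
  move=> Dd; have D_gt0 : 0 < #|D| by rewrite cDK; apply: leq_trans K3.
  apply/eqP; rewrite -(eqn_pmul2l D_gt0) muln1 {2}cDK; apply/eqP.
  have -> : (#|D| * #|miss d| = \sum_(e in D) \sum_(a in K | (e * a)%g \notin K) 1)%N.
    rewrite -sum_nat_const; apply: eq_bigr => e De; have [g Gg ->] := DJ Dd De.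
    by rewrite -(missJ d g Gg) sum1dep_card.
  rewrite (exchange_big_dep (mem K)) /=; last by move=> e a _ /andP[].
  rewrite -sum1_card; apply: eq_bigr => a Ka.
  by rewrite -[RHS](miss_a a Ka) -[RHS]sum1dep_card; apply: eq_bigl => e; rewrite Ka.
(* At most two a in [K] have e a or d e a outside [K]; a third one gives d e = (d e a) a^-1. This is
   where |K| >= 3 is needed. *)
have mulD d e : d \in D -> e \in D -> d * e \in K * K.
  move=> Dd De; have : ~~ (K \subset miss e :|: e^-1 *: miss d).
    apply/negP=> /subset_leq_card; rewrite leqNgt => /negP; apply.
    apply: leq_trans K3; apply: leq_ltn_trans (leq_card_setU _ _).1 _.
    by rewrite card_lcoset !miss1.
  case/subsetPn=> a Ka; rewrite !inE Ka /= negb_or negbK mem_lcoset invgK.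
  rewrite !inE => /andP[Kea]; rewrite Kea negbK mulgA => Kdea.
  by rewrite -[d * e](mulgK a) mem_mulg // KV.
have gN : group_set (K * K).
  apply/group_setP; split=> [|d e Nd Ne]; first by rewrite sqK setU11.
  move: (Nd) (Ne); rewrite sqK => /setU1P[->|Dd]; first by rewrite mul1g -sqK.
  by case/setU1P=> [->|De]; rewrite -?sqK ?mulg1 ?mulD.
pose N := Group gN.
have ND d : d \in D -> d \in N by rewrite /= sqK inE orbC => ->.
have DN d : d \in N -> d != 1 -> d \in D by rewrite /= sqK => /setU1P[->|//]; rewrite eqxx.
have nsNG : N <| G.
  apply/andP; split; first by rewrite mul_subG.
  by rewrite /= normsM.
pose p := pdiv #|N|.
have ntN : N :!=: 1.
  by apply/trivgPn; exists (x * x) => //; apply: ND.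
have pr_p : prime p by rewrite pdiv_prime // cardG_gt1.
have DX r e : prime r -> e \in N -> #[e] = r -> {in D, forall d, #[d] = r}.
  move=> pr_r Ne oe d Dd; rewrite -oe; apply: orderD => //; apply: DN => //.
  by rewrite -order_gt1 oe prime_gt1.
have oD : {in D, forall d, #[d] = p}.
  have [d Nd od] := Cauchy pr_p (pdiv_dvd #|N|).
  exact: DX od.
have pN : p.-group N.
  apply/pgroupP=> r pr_r /(Cauchy pr_r)[e Ne oe].
  by rewrite inE /= -(DX r e pr_r Ne oe _ Dxx) oD.
have abN : p.-abelem N.
  apply/abelemP=> //; split=> [|d Nd]; last first.
    by have [->|/(DN d Nd)/oD <-] := eqVneq d 1; rewrite ?expg1n ?expg_order.
  (* The nontrivial center of the p-group [N] is normal in [G] and meets the single class [D], so it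
     contains all of it. *)
  have ntZ : 'Z(N) != 1 by rewrite center_nil_eq1 ?(pgroup_nil pN).
  have [z Zz nz1] := trivgPn _ ntZ.
  have nsZG : 'Z(N) <| G by apply: gFnormal_trans.
  have zD : z \in D by apply: DN nz1; apply: subsetP (center_sub N) z Zz.
  suff sNZ : N \subset 'Z(N) by apply: abelianS sNZ (center_abelian N).
  apply/subsetP=> d Nd; have [->|/(DN d Nd) Dd] := eqVneq d 1; first exact: group1.
  by have [g Gg ->] := DJ zD Dd; rewrite memJ_norm // (subsetP (normal_norm nsZG)).
have sDN : <<D>> \subset N by rewrite gen_subG; apply/subsetP.
exists p; split=> //.
- apply: contraT => p_even; have p2 : p = 2 by case: (even_prime pr_p) p_even => [|->].
  have eC : 'C_G[x] = 'C_G[x * x].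
    apply/eqP; rewrite eqEcard sC /= -(leq_pmul2r (leq_trans _ K3 : 0 < #|K|)) //.
    by rewrite -{1}cDK Ddef -!index_cent1 !Lagrange ?subsetIl.
  have cNx c : c \in N -> commute x c.
    move=> Nc; have : c \in 'C_G[x * x].
      rewrite inE (subsetP (normal_sub nsNG)) //=; apply/cent1P.
      by apply: (centsP (abelem_abelian abN)) => //; apply: ND.
    by rewrite -eC => /setIP[_ /cent1P].
  have : D = [set x * x].
    apply/eqP; rewrite eqEsubset sub1set Dxx andbT Ddef; apply/subsetP=> _ /imsetP[g Gg ->].
    rewrite inE conjMg; set k := x ^ g; have Kk : k \in K by rewrite KJ.
    have Nxk : x^-1 * k \in N by rewrite /= mem_mulg ?KV.
    have -> : k * k = (x * (x^-1 * k)) ^+ 2 by rewrite mulKVg.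
    rewrite expgMn; last exact: cNx.
    have [_ /(_ _ Nxk)] := abelemP pr_p abN.
    by rewrite p2 => ->; rewrite mulg1.
  by move/(congr1 (fun A : {set gT} => #|A|)); rewrite cDK cards1 => K1; move: K3; rewrite K1.
- exact: abelemS abN.
have oxx : #[x * x] = p := oD _ Dxx.
have : #[x] %| (2 * p)%N.
  by rewrite order_dvdn expgM -[x ^+ 2]/(x * x) -oxx expg_order.
have : p %| #[x] by rewrite -oxx; apply: (orderXdvd x 2).
case/dvdnP=> c oc; rewrite oc dvdn_pmul2r ?prime_gt0 //.
have [_ dvd2] := primeP (isT : prime 2).
by case/dvd2/pred2P=> ->; [left; rewrite mul1n | right].
Qed.

End Card3.

Lemma gen_class_cyclic_or_pgroup :
  cyclic <<D>> \/ (exists2 p, prime p & p.-group <<D>>).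
Proof.
have ox_gt1 : 1 < #|K| -> 1 < #[x].
  by rewrite order_gt1; apply: contraTneq => x1; rewrite /K x1 class1G cards1.
have [K_gt2|K_le2] := ltnP 2 #|K|.
  right; have [ox|ox_le2] := ltnP 2 #[x].
    have [p [pr_p _ abD _]] := class_card3_order_gt2 K_gt2 ox.
    by exists p => //; apply: abelem_pgroup abD.
  have ox : #[x] = 2 by apply/eqP; rewrite eqn_leq ox_le2 ox_gt1 // ltnW.
  have [[_ abD]|[p [r [pr_p _ _ pD _]]]] := class_card3_invol K_gt2 ox.
    by exists 2 => //; apply: abelem_pgroup abD.
  by exists p.
left; have [K_gt1|K_le1] := ltnP 1 #|K|; last first.
  rewrite class_card1_gen ?cyclic1 //; apply/eqP; rewrite eqn_leq K_le1 card_gt0.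
  by apply/set0Pn; exists x.
have K2 : #|K| = 2 by apply/eqP; rewrite eqn_leq K_le2.
have [ox|ox_le2] := ltnP 2 #[x].
  by have [] := class_card2_cyclic K2 (erefl _) ox.
have ox : #[x] = 2 by apply/eqP; rewrite eqn_leq ox_le2 ox_gt1.
have [_ /card_isog D2 _] := class_card2_invol K2 ox.
by apply: prime_cyclic; rewrite D2 cardsT card_ord.
Qed.

End SquareOfClass.

Theorem theoremA (gT : finGroupType) (G : {group gT}) (x : gT) (K D : {set gT})
    (Gx : x \in G) (defK : K = x ^: G) (classD : D \in classes G)
    (sqK : K * K = [set 1] :|: D) :
  [/\ <<D>> = [~: [set x], G],
      cyclic <<D>> \/ (exists2 p, prime p & p.-group <<D>>),
      #|<<K>> / <<D>>| <= 2,
      <<K>> = <[x]> * [~: [set x], G]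
    & solvable <<K>>]
  /\ (#|K| = 2 ->
        (#[x] = 2 ->
           [/\ <<K>> \isog [set: 'Z_2 * 'Z_2],
               <<D>> \isog [set: 'Z_2]
             & <<D>> \subset 'Z(G)])
        /\ (forall n : nat, #[x] = n -> 2 < n ->
              <<K>> \isog [set: 'Z_n] /\ cyclic <<D>>))
  /\ (3 <= #|K| ->
        (#[x] = 2 ->
           (2.-abelem <<K>> /\ 2.-abelem <<D>>)
           \/ (exists p r : nat,
                 [/\ prime p, odd p, 0 < r, p.-group <<D>> & #|K| = p ^ r]%N))
        /\ (2 < #[x] ->
              exists p : nat,
                [/\ prime p, odd p, p.-abelem <<D>>
                  & #[x] = p \/ #[x] = (2 * p)%N])).
Proof.
subst K; have cycD := gen_class_cyclic_or_pgroup Gx classD sqK.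
have solD : solvable <<D>>.
  by case: cycD => [/cyclic_abelian/abelian_sol | [p _ /pgroup_sol]].
split; first split=> //.
- exact: gen_class_comm.
- exact: gen_class_index.
- exact: gen_class_mul classD sqK.
- exact: gen_class_sol classD sqK solD.
split=> [K2|K3]; split.
- exact: class_card2_invol.
- by move=> n; apply: class_card2_cyclic.
- exact: class_card3_invol.
exact: class_card3_order_gt2 classD sqK K3.
Qed.
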